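(* Let $V:\mathbb{Z}\to\mathbb{R}$ be bounded and let $H$ be the operator on $\ell^2(\mathbb{Z})$ given by $[H\psi](n)=\psi(n+1)+\psi(n-1)+V(n)\psi(n)$. Let $K\ge 4$ be such that $\sigma(H)\subseteq[-K+1,K-1]$. Suppose that for some $C\in(0,\infty)$ and $\alpha\in(0,1)$ we have, as $T\to\infty$, $$\int_{-K}^{K}\Big(\max_{3\le n\le CT^\alpha}\big\|\Phi(n,E+\tfrac{i}{T})\big\|^2\Big)^{-1}dE=O(T^{-m})$$ and $$\int_{-K}^{K}\Big(\max_{3\le -n\le CT^\alpha}\big\|\Phi(n,E+\tfrac{i}{T})\big\|^2\Big)^{-1}dE=O(T^{-m})$$ for every $m\ge 1$. Then $\alpha_u^+\le\alpha$. In particular, $\beta^+_{\delta_1}(p)\le\alpha$ for every $p>0$.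
   Context: For $z\in\mathbb{C}$ and $m\in\mathbb{Z}$ let $T(m,z)=\begin{pmatrix} z-V(m) & -1\\ 1 & 0\end{pmatrix}$, and define transfer matrices $\Phi(n,z)=T(n,z)\cdots T(1,z)$ for $n\ge1$, $\Phi(0,z)=\mathrm{Id}$, and $\Phi(n,z)=[T(n+1,z)]^{-1}\cdots[T(0,z)]^{-1}$ for $n\le -1$; thus $(u(n+1),u(n))^T=\Phi(n,z)(u(1),u(0))^T$ for every solution of $u(n+1)+u(n-1)+V(n)u(n)=zu(n)$. $\|\cdot\|$ is the operator norm of a $2\times 2$ matrix. Let $\delta_n$ be the standard basis vectors of $\ell^2(\mathbb{Z})$. For $T>0$ set $a(n,T)=\frac{2}{T}\int_0^\infty e^{-2t/T}|\langle e^{-itH}\delta_1,\delta_n\rangle|^2dt$, $\langle|X|^p_{\delta_1}\rangle(T)=\sum_n|n|^pa(n,T)$, and $P(N,T)=\sum_{|n|>N}a(n,T)$. For $\alpha'\in[0,\infty]$ define $S^+(\alpha')=-\limsup_{T\to\infty}\frac{\log P(T^{\alpha'}-2,T)}{\log T}$, and $\alpha_u^+=\sup\{\alpha'\ge0: S^+(\alpha')<\infty\}$. The upper transport exponent is $\beta^+_{\delta_1}(p)=\limsup_{T\to\infty}\frac{\log\langle|X|^p_{\delta_1}\rangle(T)}{p\log T}$ for $p>0$. *)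

(* Defs.v *)
From Stdlib Require Import Reals ZArith List.
From Coquelicot Require Import Coquelicot.
Open Scope R_scope.

Definition Hop (V : Z -> R) (psi : Z -> C) : Z -> C :=
  fun n => Cplus (Cplus (psi (n + 1)%Z) (psi (n - 1)%Z)) (Cmult (RtoC (V n)) (psi n)).

Definition partial_sq (psi : Z -> C) (N : nat) : R :=
  sum_f_R0 (fun k => Cmod (psi (Z.of_nat k)) ^ 2 + Cmod (psi (- Z.of_nat k)%Z) ^ 2) N
  - Cmod (psi 0%Z) ^ 2.

Definition l2 (psi : Z -> C) : Prop := exists B, forall N, partial_sq psi N <= B.

Definition l2norm (psi : Z -> C) : R :=
  sqrt (real (Lub_Rbar (fun x => exists N, x = partial_sq psi N))).

Definition resolvent (V : Z -> R) (z : C) : Prop :=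
  exists (Rz : (Z -> C) -> (Z -> C)) (M : R),
    forall psi, l2 psi ->
      l2 (Rz psi) /\ l2norm (Rz psi) <= M * l2norm psi /\
      (forall n, Cminus (Hop V (Rz psi) n) (Cmult z (Rz psi n)) = psi n) /\
      (forall n, Rz (fun m => Cminus (Hop V psi m) (Cmult z (psi m))) n = psi n).

Definition spectrum (V : Z -> R) : C -> Prop := fun z => ~ resolvent V z.

Definition Hr (V : Z -> R) (psi : Z -> R) : Z -> R :=
  fun n => psi (n + 1)%Z + psi (n - 1)%Z + V n * psi n.

Definition delta (j : Z) : Z -> R := fun n => if Z.eq_dec n j then 1 else 0.

Fixpoint Hpow (V : Z -> R) (k : nat) : Z -> R :=
  match k with
  | O => delta 1
  | S k' => Hr V (Hpow V k')
  end.

(** <e^{-itH} delta_1, delta_n> given by the (norm-convergent) exponential series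
    sum_k (-it)^k / k! <H^k delta_1, delta_n>. *)
Definition amp_term (V : Z -> R) (t : R) (n : Z) (k : nat) : C :=
  Cmult (pow_n (K := C_Ring) (Cmult (RtoC (- t)) Ci) k)
        (RtoC (Hpow V k n / INR (fact k))).

Definition amp (V : Z -> R) (t : R) (n : Z) : C :=
  (Series (fun k => fst (amp_term V t n k)), Series (fun k => snd (amp_term V t n k))).

Definition a_nT (V : Z -> R) (n : Z) (T : R) : R :=
  2 / T * RInt_gen (fun t => exp (- 2 * t / T) * Cmod (amp V t n) ^ 2)
                   (at_point 0) (Rbar_locally p_infty).

(** Sum over Z of a nonnegative family, valued in Rbar (supremum of symmetric partial sums). *)
Definition sumZ (f : Z -> R) : Rbar :=
  Rbar_lub (fun x => exists N : nat,
    x = Finite (sum_f_R0 (fun k => f (Z.of_nat k) + f (- Z.of_nat k)%Z) N - f 0%Z)).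

Definition P_NT (V : Z -> R) (N T : R) : Rbar :=
  sumZ (fun n => if Rlt_dec N (IZR (Z.abs n)) then a_nT V n T else 0).

(** Rpower 0 p is not 0 in Stdlib, so we use the honest |n|^p (= 0 at n = 0 for p > 0). *)
Definition abspow (n : Z) (p : R) : R := if Z.eq_dec n 0 then 0 else Rpower (IZR (Z.abs n)) p.

Definition moment' (V : Z -> R) (p T : R) : Rbar :=
  sumZ (fun n => abspow n p * a_nT V n T).

Definition ln_Rbar (x : Rbar) : Rbar :=
  match x with
  | Finite r => if Rlt_dec 0 r then Finite (ln r) else m_infty
  | p_infty => p_infty
  | m_infty => m_infty
  end.

Definition limsup_infty (g : R -> Rbar) : Rbar :=
  Rbar_glb (fun y => exists M : R, y = Rbar_lub (fun x => exists T, M < T /\ x = g T)).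

Definition S_plus (V : Z -> R) (alpha' : R) : Rbar :=
  Rbar_opp (limsup_infty (fun T =>
    Rbar_mult (ln_Rbar (P_NT V (Rpower T alpha' - 2) T)) (Finite (/ ln T)))).

(** alpha_u^+ = sup { alpha' >= 0 : S^+(alpha') < oo }.  (alpha' = oo contributes
    nothing, since P(oo,T) = 0 gives S^+(oo) = +oo.) *)
Definition alpha_u_plus (V : Z -> R) : Rbar :=
  Rbar_lub (fun x => exists alpha' : R, 0 <= alpha' /\ x = Finite alpha' /\
                        Rbar_lt (S_plus V alpha') p_infty).

Definition beta_plus (V : Z -> R) (p : R) : Rbar :=
  limsup_infty (fun T =>
    Rbar_mult (ln_Rbar (moment' V p T)) (Finite (/ (p * ln T)))).

Definition M2 := ((C * C) * (C * C))%type.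
Definition M2mul (A B : M2) : M2 :=
  let '((a, b), (c, d)) := A in let '((e, f), (g, h)) := B in
  ((Cplus (Cmult a e) (Cmult b g), Cplus (Cmult a f) (Cmult b h)),
   (Cplus (Cmult c e) (Cmult d g), Cplus (Cmult c f) (Cmult d h))).
Definition M2id : M2 := ((RtoC 1, RtoC 0), (RtoC 0, RtoC 1)).
Definition M2app (A : M2) (v : C * C) : C * C :=
  let '((a, b), (c, d)) := A in
  (Cplus (Cmult a (fst v)) (Cmult b (snd v)), Cplus (Cmult c (fst v)) (Cmult d (snd v))).
Definition vnorm (v : C * C) : R := sqrt (Cmod (fst v) ^ 2 + Cmod (snd v) ^ 2).
Definition opnorm (A : M2) : R :=
  real (Lub_Rbar (fun x => exists v, vnorm v = 1 /\ x = vnorm (M2app A v))).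

Definition Tm (V : Z -> R) (m : Z) (z : C) : M2 :=
  ((Cminus z (RtoC (V m)), RtoC (-1)), (RtoC 1, RtoC 0)).
(** the inverse of Tm (Tm has determinant 1) *)
Definition Tminv (V : Z -> R) (m : Z) (z : C) : M2 :=
  ((RtoC 0, RtoC 1), (RtoC (-1), Cminus z (RtoC (V m)))).

Fixpoint Phi_pos (V : Z -> R) (k : nat) (z : C) : M2 :=
  match k with
  | O => M2id
  | S k' => M2mul (Tm V (Z.of_nat k) z) (Phi_pos V k' z)
  end.
Fixpoint Phi_neg (V : Z -> R) (k : nat) (z : C) : M2 :=
  match k with
  | O => M2id
  | S k' => M2mul (Tminv V (- Z.of_nat k')%Z z) (Phi_neg V k' z)
  end.
Definition Phi (V : Z -> R) (n : Z) (z : C) : M2 :=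
  if Z.leb 0 n then Phi_pos V (Z.to_nat n) z else Phi_neg V (Z.to_nat (- n)) z.

(** max_{3 <= n <= x} f n over integers n (0 if the range is empty) *)
Definition max_range (f : Z -> R) (x : R) : R :=
  fold_right Rmax 0 (map (fun k => f (Z.of_nat k)) (seq 3 (Z.to_nat (Int_part x) - 2))).

Definition Ipos (V : Z -> R) (K c0 alpha T : R) : R :=
  RInt (fun E => / max_range (fun n => opnorm (Phi V n (E, / T)) ^ 2) (c0 * Rpower T alpha))
       (- K) K.
Definition Ineg (V : Z -> R) (K c0 alpha T : R) : R :=
  RInt (fun E => / max_range (fun n => opnorm (Phi V (- n) (E, / T)) ^ 2) (c0 * Rpower T alpha))
       (- K) K.

Definition bigO_neg_pow (f : R -> R) (m : R) : Prop :=
  exists c T0, forall T, T0 <= T -> Rabs (f T) <= c * Rpower T (- m).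

(* Main.v *)
Require Import Defs.
From Stdlib Require Import Reals ZArith Lra Lia Psatz Classical ClassicalEpsilon List.
From Coquelicot Require Import Coquelicot.
Open Scope R_scope.

(* The time-dependent amplitude is written as the Dunford integral
   [<e^(-itH) delta_1, delta_n> = c * oint e^(-itz) G(n,1;z) dz] over the boundary of
   [-K,K] x [-1/(2T), 1/(2T)]. Hence [a(n,T)] is at most a constant times the square of the
   [L^1]-mass of the Green function on that contour, and no Plancherel theorem is needed:
   losing powers of [T] is harmless because the hypotheses beat every power.

   On the horizontal sides let [u = (H-z)^(-1) delta_1] and let [L] be the solution that equals
   [u] on (-oo,1]. Gluing [L] and [u] at a site [m] gives the resolvent applied to a multiple of
   [delta_m], so [|u(n)| |L(n)|] is bounded by the Wronskian [u(1)] over [Im z], while [u(1)]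
   itself is at least of order [Im z]. Every solution is a combination of [u] and [L], whence
   [|u(n)| * ||Phi(n,z)||] is at most a power of [T], and the tail of [u] beyond [n] is controlled
   by [u(n)], [u(n+1)]. On the vertical sides, and for very large [|n|], iterating this tail bound
   gives exponential decay.

   Thus [a(n,T)] is superpolynomially small in [T] and in [n] for [|n| >= T^alpha'],
   [alpha' > alpha], which gives both claims; for the moments, sites with [|n| <= T^alpha'] are
   handled by unitarity. *)

(** * Sums over integer intervals and square-summable sequences *)

(** The time weight fixes the height of the contour: at height [1/(2T)] the square of [|exp(-itz)|]
    is at most [exp(t/T)], and the weight [exp(-2t/T)] still leaves a convergent integral. The
    hypotheses are therefore used at [2T], which the gap between [alpha] and [alpha'] absorbs.

    They give smallness in [T] but no summability in [n]; the iterated tail bound gives decay in [n]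
    at the price of powers of [T]. Since [a(n,T)] is bounded by a square, one factor is spent on
    each.

    The analysis rests on inequalities for single sequences: self-adjointness enters through
    discrete Green identities whose boundary terms vanish along square-summable sequences, and a
    bound that improves itself takes the place of a Neumann series. The contour formula is proved
    for polynomials in [z] and applied to Taylor polynomials of the exponential; the delicate point
    is to bound these by [exp(t Im z)] instead of [exp(t |z|)]. *)

Fixpoint zsum (f : Z -> R) (a : Z) (m : nat) : R :=
  match m with
  | O => 0
  | S k => zsum f a k + f (a + Z.of_nat k)%Z
  end.

Lemma zsum_ext f g a m : (forall n, f n = g n) -> zsum f a m = zsum g a m.
Proof. intros H; induction m; simpl; [easy | now rewrite IHm, H]. Qed.

Lemma zsum_plus f g a m : zsum (fun n => f n + g n) a m = zsum f a m + zsum g a m.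
Proof. induction m; simpl; [ring | rewrite IHm; ring]. Qed.

Lemma zsum_scal c f a m : zsum (fun n => c * f n) a m = c * zsum f a m.
Proof. induction m; simpl; [ring | rewrite IHm; ring]. Qed.

Lemma zsum_le_in f g a m :
  (forall n, (a <= n < a + Z.of_nat m)%Z -> f n <= g n) -> zsum f a m <= zsum g a m.
Proof.
  intros H; induction m; [simpl; lra |].
  cbn [zsum]; apply Rplus_le_compat; [apply IHm; intros; apply H | apply H]; lia.
Qed.

Lemma zsum_le f g a m : (forall n, f n <= g n) -> zsum f a m <= zsum g a m.
Proof. intros H; apply zsum_le_in; auto. Qed.

Lemma zsum_nonneg f a m : (forall n, 0 <= f n) -> 0 <= zsum f a m.
Proof. intros H; induction m; simpl; [lra | specialize (H (a + Z.of_nat m)%Z); lra]. Qed.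

Lemma zsum_split f a m k : zsum f a (m + k) = zsum f a m + zsum f (a + Z.of_nat m) k.
Proof.
  induction k; [rewrite Nat.add_0_r; simpl; ring |].
  rewrite Nat.add_succ_r; cbn [zsum]; rewrite IHk.
  replace (a + Z.of_nat (m + k))%Z with (a + Z.of_nat m + Z.of_nat k)%Z by lia; ring.
Qed.

Lemma zsum_head f a m : zsum f a (S m) = f a + zsum f (a + 1) m.
Proof.
  replace (S m) with (1 + m)%nat by lia; rewrite zsum_split; simpl zsum.
  now rewrite Z.add_0_r, Rplus_0_l.
Qed.

Lemma zsum_subset f a m b k : (forall n, 0 <= f n) ->
  (b <= a)%Z -> (a + Z.of_nat m <= b + Z.of_nat k)%Z -> zsum f a m <= zsum f b k.
Proof.
  intros Hf Hb Hk.
  pose (p := Z.to_nat (a - b)); pose (q := Z.to_nat (b + Z.of_nat k - a - Z.of_nat m)).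
  replace k with (p + (m + q))%nat by (unfold p, q; lia).
  rewrite !zsum_split.
  replace (b + Z.of_nat p)%Z with a by (unfold p; lia).
  pose proof (zsum_nonneg f b p Hf); pose proof (zsum_nonneg f (a + Z.of_nat m) q Hf); lra.
Qed.

Lemma zsum_reflect f c a m :
  zsum (fun n => f (c - n)%Z) a m = zsum f (c - a - Z.of_nat m + 1) m.
Proof.
  induction m; [reflexivity |].
  rewrite (zsum_head f); cbn [zsum]; rewrite IHm.
  replace (c - a - Z.of_nat (S m) + 1 + 1)%Z with (c - a - Z.of_nat m + 1)%Z by lia.
  replace (c - a - Z.of_nat (S m) + 1)%Z with (c - (a + Z.of_nat m))%Z by lia; ring.
Qed.

Lemma zsum_shift f c a m : zsum (fun n => f (n + c)%Z) a m = zsum f (a + c) m.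
Proof.
  induction m; [reflexivity |]; cbn [zsum]; rewrite IHm; do 2 f_equal; lia.
Qed.

Lemma zsum_telescope (w : Z -> R) a m :
  zsum (fun n => w n - w (n - 1)%Z) a m = w (a + Z.of_nat m - 1)%Z - w (a - 1)%Z.
Proof.
  induction m; cbn [zsum].
  - replace (a + Z.of_nat 0 - 1)%Z with (a - 1)%Z by lia; ring.
  - rewrite IHm.
    replace (a + Z.of_nat (S m) - 1)%Z with (a + Z.of_nat m)%Z by lia; ring.
Qed.

Lemma zsum_zero_in f a m :
  (forall n, (a <= n < a + Z.of_nat m)%Z -> f n = 0) -> zsum f a m = 0.
Proof.
  intros H; induction m; [easy |].
  cbn [zsum]; rewrite IHm, H by (intros; try apply H; lia); ring.
Qed.

Lemma zsum_single f j a m : (forall n, n <> j -> f n = 0) ->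
  (a <= j < a + Z.of_nat m)%Z -> zsum f a m = f j.
Proof.
  intros H Hj; induction m; [lia |].
  cbn [zsum]; destruct (Z.eq_dec (a + Z.of_nat m) j) as [<-|Hn].
  - rewrite zsum_zero_in; [ring |]; intros; apply H; lia.
  - rewrite IHm, (H (a + Z.of_nat m)%Z) by (easy || lia); ring.
Qed.

Lemma zsum_ge_term f j a m : (forall n, 0 <= f n) ->
  (a <= j < a + Z.of_nat m)%Z -> f j <= zsum f a m.
Proof.
  intros H Hj.
  apply Rle_trans with (zsum f j 1); [cbn [zsum]; rewrite Z.add_0_r; lra |].
  apply zsum_subset; [easy | lia | lia].
Qed.

(** [B] bounds the squared norm. Quantifying over all finite windows keeps every sum finite and
    makes translation and reflection immediate. *)
Definition bdd (f : Z -> C) (B : R) : Prop :=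
  forall a m, zsum (fun n => Cmod (f n) ^ 2) a m <= B.

Lemma Cmod_sq z : Cmod z ^ 2 = fst z ^ 2 + snd z ^ 2.
Proof. exact (Cmod2_alt z). Qed.

Lemma sym_sum_zsum (f : Z -> R) N :
  sum_f_R0 (fun k => f (Z.of_nat k) + f (- Z.of_nat k)%Z) N - f 0%Z =
  zsum f (- Z.of_nat N) (2 * N + 1).
Proof.
  induction N.
  - simpl; ring.
  - rewrite tech5.
    replace (2 * S N + 1)%nat with (S (2 * N + 1) + 1)%nat by lia.
    rewrite zsum_split, zsum_head.
    replace (- Z.of_nat (S N) + 1)%Z with (- Z.of_nat N)%Z by lia.
    rewrite <- IHN; cbn [zsum].
    replace (- Z.of_nat (S N) + Z.of_nat (S (2 * N + 1)) + Z.of_nat 0)%Z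
      with (Z.of_nat (S N)) by lia; ring.
Qed.

Lemma partial_sq_zsum psi N :
  partial_sq psi N = zsum (fun n => Cmod (psi n) ^ 2) (- Z.of_nat N) (2 * N + 1).
Proof. exact (sym_sum_zsum (fun n => Cmod (psi n) ^ 2) N). Qed.

Lemma bdd_partial_sq f B : bdd f B <-> forall N, partial_sq f N <= B.
Proof.
  split; intros H.
  - intros N; rewrite partial_sq_zsum; apply H.
  - intros a m; pose (N := (Z.to_nat (Z.abs a) + m)%nat).
    apply Rle_trans with (2 := H N); rewrite partial_sq_zsum.
    apply zsum_subset; [intros; apply pow2_ge_0 | unfold N; lia | unfold N; lia].
Qed.

Lemma l2_bdd f : l2 f <-> exists B, bdd f B.
Proof. split; intros [B H]; exists B; now apply bdd_partial_sq. Qed.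

Lemma bdd_nonneg f B : bdd f B -> 0 <= B.
Proof. intros H; exact (H 0%Z 0%nat). Qed.

Lemma bdd_le f B B' : bdd f B -> B <= B' -> bdd f B'.
Proof. intros H HB a m; specialize (H a m); lra. Qed.

Lemma bdd_ext f g B : (forall n, f n = g n) -> bdd f B -> bdd g B.
Proof.
  intros E H a m; rewrite <- (zsum_ext (fun n => Cmod (f n) ^ 2)); [apply H |].
  intros; now rewrite E.
Qed.

Lemma bdd_term f B n : bdd f B -> Cmod (f n) ^ 2 <= B.
Proof. intros H; specialize (H n 1%nat); cbn [zsum] in H; rewrite Z.add_0_r in H; lra. Qed.

Lemma bdd_dom f g B c : (forall n, Cmod (g n) ^ 2 <= c * Cmod (f n) ^ 2) -> 0 <= c ->
  bdd f B -> bdd g (c * B).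
Proof.
  intros E Hc H a m.
  apply Rle_trans with (zsum (fun n => c * Cmod (f n) ^ 2) a m); [now apply zsum_le |].
  rewrite zsum_scal; now apply Rmult_le_compat_l.
Qed.

Lemma Cmod_sq_plus a b : Cmod (Cplus a b) ^ 2 <= 2 * Cmod a ^ 2 + 2 * Cmod b ^ 2.
Proof.
  rewrite !Cmod_sq; destruct a as [a1 a2], b as [b1 b2]; unfold Cplus, fst, snd.
  pose proof (pow2_ge_0 (a1 - b1)); pose proof (pow2_ge_0 (a2 - b2)); lra.
Qed.

Lemma bdd_plus f g A B : bdd f A -> bdd g B ->
  bdd (fun n => Cplus (f n) (g n)) (2 * A + 2 * B).
Proof.
  intros Hf Hg a m.
  apply Rle_trans with (zsum (fun n => 2 * Cmod (f n) ^ 2 + 2 * Cmod (g n) ^ 2) a m).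
  - apply zsum_le; intros; apply Cmod_sq_plus.
  - rewrite zsum_plus, !zsum_scal; specialize (Hf a m); specialize (Hg a m); lra.
Qed.

Lemma bdd_scal c f B : bdd f B -> bdd (fun n => Cmult c (f n)) (Cmod c ^ 2 * B).
Proof.
  intros H; apply (bdd_dom f); [| apply pow2_ge_0 | exact H].
  intros n; rewrite Cmod_mult, Rpow_mult_distr; lra.
Qed.

Lemma Cmod_neg1 z : Cmod (Cmult (RtoC (-1)) z) = Cmod z.
Proof. rewrite Cmod_mult, Cmod_R, Rabs_left; lra. Qed.

Lemma bdd_minus f g A B : bdd f A -> bdd g B ->
  bdd (fun n => Cminus (f n) (g n)) (2 * A + 2 * B).
Proof.
  intros Hf Hg.
  apply (bdd_ext (fun n => Cplus (f n) (Cmult (RtoC (-1)) (g n)))); [intros; ring |].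
  apply bdd_plus; [exact Hf |].
  replace B with (1 * B) by ring; apply (bdd_dom g); [| lra | exact Hg].
  intros; rewrite Cmod_neg1; lra.
Qed.

Lemma bdd_shift f c B : bdd f B -> bdd (fun n => f (n + c)%Z) B.
Proof. intros H a m; rewrite (zsum_shift (fun n => Cmod (f n) ^ 2)); apply H. Qed.

Lemma bdd_reflect f c B : bdd f B -> bdd (fun n => f (c - n)%Z) B.
Proof. intros H a m; rewrite (zsum_reflect (fun n => Cmod (f n) ^ 2)); apply H. Qed.

Lemma l2_minus f g : l2 f -> l2 g -> l2 (fun n => Cminus (f n) (g n)).
Proof.
  rewrite !l2_bdd; intros [A Hf] [B Hg]; exists (2 * A + 2 * B); now apply bdd_minus.
Qed.

Lemma l2_scal c f : l2 f -> l2 (fun n => Cmult c (f n)).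
Proof. rewrite !l2_bdd; intros [A Hf]; exists (Cmod c ^ 2 * A); now apply bdd_scal. Qed.

Definition dlt (j n : Z) : C := RtoC (delta j n).

Lemma delta_eq j : delta j j = 1.
Proof. unfold delta; destruct (Z.eq_dec j j); easy. Qed.

Lemma delta_neq j n : n <> j -> delta j n = 0.
Proof. unfold delta; destruct (Z.eq_dec n j); easy. Qed.

(** Cutting a solution at a site leaves a source on two neighbouring sites; this bounds the norm of
    that source. *)
Lemma bdd_two f j B : (forall n, n <> j -> n <> (j + 1)%Z -> f n = RtoC 0) ->
  Cmod (f j) ^ 2 + Cmod (f (j + 1)%Z) ^ 2 <= B -> bdd f B.
Proof.
  intros H HB a m.
  pose (b := Z.min a j); pose (k := Z.to_nat (Z.max (a + Z.of_nat m) (j + 2) - b)).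
  apply Rle_trans with (zsum (fun n => Cmod (f n) ^ 2) b k).
  { apply zsum_subset; [intros; apply pow2_ge_0 | unfold b; lia | unfold k; lia]. }
  replace k with (Z.to_nat (j - b) + (2 + (k - Z.to_nat (j - b) - 2)))%nat by lia.
  rewrite !zsum_split; rewrite (zsum_zero_in _ b), (zsum_zero_in _ (_ + _ + _)%Z).
  - replace (b + Z.of_nat (Z.to_nat (j - b)))%Z with j by lia; cbn [zsum].
    replace (j + Z.of_nat 0)%Z with j by lia; replace (j + Z.of_nat 1)%Z with (j + 1)%Z by lia.
    lra.
  - intros n Hn; rewrite H by lia; rewrite Cmod_0; ring.
  - intros n Hn; rewrite H by lia; rewrite Cmod_0; ring.
Qed.

Lemma bdd_dlt j : bdd (dlt j) 1.
Proof.
  apply (bdd_two _ j); unfold dlt.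
  - intros; now rewrite delta_neq.
  - rewrite delta_eq, delta_neq, Cmod_0, Cmod_1 by lia; lra.
Qed.

(** The window [[a, b]], where no domination is assumed, adds only a finite sum. This puts truncated
    and glued solutions into [l2]. *)
Lemma l2_eventually_dominated f h c a b : l2 h ->
  (forall n, (n < a \/ b < n)%Z -> Cmod (f n) <= c * Cmod (h n)) -> l2 f.
Proof.
  rewrite !l2_bdd; intros [B HB] H.
  pose (k := Z.to_nat (b - a + 1)).
  exists (c ^ 2 * B + zsum (fun n => Cmod (f n) ^ 2) a k).
  intros x m.
  set (F := fun n => Cmod (f n) ^ 2); set (G := fun n => c ^ 2 * Cmod (h n) ^ 2).
  pose (F1 := fun n => if Z_le_dec a n then if Z_le_dec n b then F n else 0 else 0).
  assert (HF1 : forall n, 0 <= F1 n).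
  { intros n; unfold F1; destruct (Z_le_dec a n), (Z_le_dec n b);
      try lra; apply pow2_ge_0. }
  apply Rle_trans with (zsum (fun n => G n + F1 n) x m).
  - apply zsum_le; intros n; unfold F1.
    assert (0 <= G n) by (unfold G; apply Rmult_le_pos; apply pow2_ge_0).
    destruct (Z_le_dec a n), (Z_le_dec n b); try lra;
    (unfold F, G; rewrite <- Rpow_mult_distr, Rplus_0_r; apply pow_incr; split;
      [apply Cmod_ge_0 | apply H; lia]).
  - rewrite zsum_plus; apply Rplus_le_compat.
    + unfold G; rewrite zsum_scal; apply Rmult_le_compat_l; [apply pow2_ge_0 | apply HB].
    + pose (y := Z.min x a); pose (p := Z.to_nat (Z.max (x + Z.of_nat m) (a + Z.of_nat k) - y)).
      apply Rle_trans with (zsum F1 y p).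
      { apply zsum_subset; [easy | unfold y; lia | unfold p; lia]. }
      replace p with (Z.to_nat (a - y) + (k + (p - Z.to_nat (a - y) - k)))%nat by lia.
      rewrite !zsum_split; rewrite (zsum_zero_in _ y), (zsum_zero_in _ (_ + _ + _)%Z).
      * replace (y + Z.of_nat (Z.to_nat (a - y)))%Z with a by lia.
        rewrite Rplus_0_l, Rplus_0_r; apply zsum_le; intros n; unfold F1.
        assert (0 <= F n) by (apply pow2_ge_0).
        destruct (Z_le_dec a n), (Z_le_dec n b); lra.
      * intros n Hn; unfold F1; destruct (Z_le_dec a n), (Z_le_dec n b); try lra; lia.
      * intros n Hn; unfold F1; destruct (Z_le_dec a n), (Z_le_dec n b); try lra; lia.
Qed.

(** Serves to discard the boundary terms of summation by parts. *)
Lemma bdd_tendsto_0 f B eta : bdd f B -> 0 < eta ->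
  exists N : nat, forall n, (Z.of_nat N <= Z.abs n)%Z -> Cmod (f n) ^ 2 <= eta.
Proof.
  intros H Heta.
  pose (a := fun k => Cmod (f (Z.of_nat k)) ^ 2 + Cmod (f (- Z.of_nat k)%Z) ^ 2).
  assert (Ha : forall k, 0 <= a k).
  { intros k; unfold a.
    pose proof (pow2_ge_0 (Cmod (f (Z.of_nat k)))).
    pose proof (pow2_ge_0 (Cmod (f (- Z.of_nat k)%Z))); lra. }
  assert (Hs : ex_series a).
  { apply (ex_finite_lim_seq_incr _ (B + Cmod (f 0%Z) ^ 2)).
    - intros n; rewrite sum_Sn; unfold plus; simpl; specialize (Ha (S n)); lra.
    - intros n; rewrite sum_n_Reals.
      pose proof (proj1 (bdd_partial_sq f B) H n) as P; unfold partial_sq in P.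
      unfold a; lra. }
  apply ex_series_lim_0 in Hs.
  apply is_lim_seq_spec in Hs; destruct (Hs (mkposreal eta Heta)) as [N HN]; simpl in HN.
  exists N; intros n Hn.
  specialize (HN (Z.to_nat (Z.abs n)) ltac:(lia)).
  rewrite Rminus_0_r, Rabs_pos_eq in HN by apply Ha.
  unfold a in HN.
  pose proof (pow2_ge_0 (Cmod (f (Z.of_nat (Z.to_nat (Z.abs n)))))).
  pose proof (pow2_ge_0 (Cmod (f (- Z.of_nat (Z.to_nat (Z.abs n)))%Z))).
  destruct (Z_le_dec 0 n).
  - replace (Z.of_nat (Z.to_nat (Z.abs n))) with n in * by lia; lra.
  - replace (- Z.of_nat (Z.to_nat (Z.abs n)))%Z with n in * by lia; lra.
Qed.

(** * Quantitative resolvent bounds *)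

Definition Hz (V : Z -> R) (z : C) (f : Z -> C) (n : Z) : C :=
  Cminus (Hop V f n) (Cmult z (f n)).

Definition bounded_by (V : Z -> R) (B : R) := forall n, Rabs (V n) <= B.

(* [D] bounds the square of the norm of the resolvent. *)
Definition good (V : Z -> R) (z : C) (D : R) : Prop :=
  0 <= D /\ forall f B, l2 f -> bdd (Hz V z f) B -> bdd f (D * B).

Lemma good_mono V z D D' : good V z D -> D <= D' -> good V z D'.
Proof.
  intros [HD G] HDD; split; [lra |]; intros f B Lf HB.
  apply (bdd_le _ _ _ (G f B Lf HB)), Rmult_le_compat_r; [exact (bdd_nonneg _ _ HB) | easy].
Qed.

Lemma inv_unit T : 1 <= T -> 0 < / T <= 1.
Proof.
  intros HT; split; [apply Rinv_0_lt_compat; lra |].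
  rewrite <- Rinv_1; apply Rinv_le_contravar; lra.
Qed.

(** Existence is kept apart from the a priori bound [good]: off the real axis the latter follows
    from a Green identity, while existence is taken from the resolvent. *)
Definition solvable (V : Z -> R) (z : C) : Prop :=
  forall psi, l2 psi -> exists f, l2 f /\ forall n, Hz V z f n = psi n.

Lemma Hz_ext V z f g : (forall n, f n = g n) -> forall n, Hz V z f n = Hz V z g n.
Proof. intros E n; unfold Hz, Hop; now rewrite !E. Qed.

Lemma bdd_Hop V Bv f B : bounded_by V Bv -> bdd f B -> bdd (Hop V f) ((8 + 2 * Bv ^ 2) * B).
Proof.
  intros HV Hf; unfold Hop.
  assert (H1 : bdd (fun n => Cmult (RtoC (V n)) (f n)) (Bv ^ 2 * B)).
  { apply (bdd_dom f); [| apply pow2_ge_0 | exact Hf].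
    intros n; rewrite Cmod_mult, Cmod_R, Rpow_mult_distr.
    apply Rmult_le_compat_r; [apply pow2_ge_0 |].
    apply pow_incr; split; [apply Rabs_pos | apply HV]. }
  assert (H2 := bdd_plus _ _ _ _ (bdd_shift f 1 B Hf) (bdd_shift f (-1) B Hf)).
  refine (bdd_le _ _ _ (bdd_plus _ _ _ _ H2 H1) _); lra.
Qed.

Lemma bdd_Hz V Bv z f B : bounded_by V Bv -> bdd f B ->
  bdd (Hz V z f) (2 * ((8 + 2 * Bv ^ 2) * B) + 2 * (Cmod z ^ 2 * B)).
Proof.
  intros HV Hf; unfold Hz; apply bdd_minus; [now apply bdd_Hop | now apply bdd_scal].
Qed.

Lemma l2_Hz V Bv z f : bounded_by V Bv -> l2 f -> l2 (Hz V z f).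
Proof.
  rewrite !l2_bdd; intros HV [B HB]; eexists; apply (bdd_Hz V Bv); eassumption.
Qed.

Lemma l2norm_spec f : l2 f -> bdd f (l2norm f ^ 2).
Proof.
  intros Hf; apply bdd_partial_sq; intros N; unfold l2norm.
  destruct (Lub_Rbar_correct (fun x => exists N, x = partial_sq f N)) as [Hub Hlub].
  destruct Hf as [B HB].
  assert (H1 : Rbar_le (partial_sq f N) (Lub_Rbar (fun x => exists N, x = partial_sq f N))).
  { apply Hub; now exists N. }
  assert (H2 : Rbar_le (Lub_Rbar (fun x => exists N, x = partial_sq f N)) B).
  { apply Hlub; intros x [M ->]; apply HB. }
  destruct (Lub_Rbar _) as [r | |]; simpl in *; try easy.
  assert (0 <= partial_sq f N).
  { rewrite partial_sq_zsum; apply zsum_nonneg; intros; apply pow2_ge_0. }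
  rewrite Rmult_1_r, sqrt_sqrt; lra.
Qed.

Lemma l2norm_le f B : bdd f B -> l2norm f <= sqrt B.
Proof.
  intros Hf; unfold l2norm.
  destruct (Lub_Rbar_correct (fun x => exists N, x = partial_sq f N)) as [Hub Hlub].
  assert (H2 : Rbar_le (Lub_Rbar (fun x => exists N, x = partial_sq f N)) B).
  { apply Hlub; intros x [M ->]; now apply bdd_partial_sq. }
  assert (H1 : Rbar_le (partial_sq f 0) (Lub_Rbar (fun x => exists N, x = partial_sq f N))).
  { apply Hub; now exists 0%nat. }
  destruct (Lub_Rbar _) as [r | |]; simpl in *; try easy.
  now apply sqrt_le_1_alt.
Qed.

(** The left inverse gives the bound, since it recovers [f] from [Hz V z f]; the right inverse gives
    solvability. *)
Lemma resolvent_good V Bv z : bounded_by V Bv -> resolvent V z ->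
  (exists D, good V z D) /\ solvable V z.
Proof.
  intros HV (Rz & M & H); split.
  - exists (M ^ 2); split; [apply pow2_ge_0 |].
    intros f B Hf HB.
    assert (Hl := l2_Hz V Bv z f HV Hf).
    destruct (H _ Hl) as (L & HM & _ & _).
    destruct (H _ Hf) as (_ & _ & _ & Hinv).
    apply (bdd_ext _ f) with (2 := l2norm_spec _ L) in Hinv.
    apply (bdd_le _ _ _ Hinv).
    assert (HBs := l2norm_le _ _ HB); assert (HB0 := bdd_nonneg _ _ HB).
    assert (P : 0 <= l2norm (Rz (Hz V z f))) by apply sqrt_pos.
    assert (P' : 0 <= l2norm (Hz V z f)) by apply sqrt_pos.
    apply Rle_trans with ((M * l2norm (Hz V z f)) ^ 2); [now apply pow_incr |].
    rewrite Rpow_mult_distr; apply Rmult_le_compat_l; [apply pow2_ge_0 |].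
    rewrite <- (pow2_sqrt B HB0); now apply pow_incr.
  - intros psi Hpsi; exists (Rz psi); destruct (H _ Hpsi) as (L & _ & E & _); split; auto.
Qed.

(** Up to a factor, the probability current through the bond from [n] to [n + 1]. *)
Definition flux (f : Z -> C) (n : Z) : R := Im (Cmult (Cconj (f n)) (f (n + 1)%Z)).

(** The potential is real and drops out of the imaginary part; the two hopping terms combine to a
    difference of consecutive fluxes, which telescopes. *)
Lemma green_sum V z f a m :
  zsum (fun n => Im (Cmult (Cconj (f n)) (Hz V z f n))) a m =
  - snd z * zsum (fun n => Cmod (f n) ^ 2) a m
  + flux f (a + Z.of_nat m - 1) - flux f (a - 1).
Proof.
  rewrite <- zsum_scal.
  unfold Rminus; rewrite Rplus_assoc.
  change (flux f (a + Z.of_nat m - 1) + - flux f (a - 1))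
    with (flux f (a + Z.of_nat m - 1) - flux f (a - 1)).
  rewrite <- zsum_telescope, <- zsum_plus; apply zsum_ext; intros n.
  unfold flux; replace (n - 1 + 1)%Z with n by lia.
  rewrite Cmod_sq; unfold Hz, Hop.
  destruct (f n) as [x y], (f (n + 1)%Z) as [x1 y1], (f (n - 1)%Z) as [x2 y2], z as [z1 z2].
  simpl; ring.
Qed.

Lemma flux_le f n : Rabs (flux f n) <= (Cmod (f n) ^ 2 + Cmod (f (n + 1)%Z) ^ 2) / 2.
Proof.
  unfold flux; rewrite !Cmod_sq.
  destruct (f n) as [x y], (f (n + 1)%Z) as [x1 y1]; simpl.
  apply Rabs_le; split.
  - pose proof (pow2_ge_0 (x + y1)); pose proof (pow2_ge_0 (y - x1)); lra.
  - pose proof (pow2_ge_0 (x - y1)); pose proof (pow2_ge_0 (y + x1)); lra.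
Qed.

Lemma flux_tendsto_0 f eta : l2 f -> 0 < eta ->
  exists N : nat, forall n, (Z.of_nat N <= Z.abs n)%Z -> Rabs (flux f n) <= eta.
Proof.
  rewrite l2_bdd; intros [B Hf] He.
  destruct (bdd_tendsto_0 f B eta Hf He) as [N HN]; exists (S N); intros n Hn.
  pose proof (HN n ltac:(lia)); pose proof (HN (n + 1)%Z ltac:(lia)).
  pose proof (flux_le f n); lra.
Qed.

Lemma cross_le e a b : 0 < e ->
  Rabs (Im (Cmult (Cconj a) b)) <= e / 2 * Cmod a ^ 2 + / (2 * e) * Cmod b ^ 2.
Proof.
  intros He.
  assert (H : Rabs (Im (Cmult (Cconj a) b)) <= Cmod a * Cmod b).
  { rewrite <- (Cmod_conj a), <- Cmod_mult; unfold Im.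
    eapply Rle_trans; [apply Rmax_r | apply Rmax_Cmod]. }
  apply Rle_trans with (1 := H).
  assert (0 <= (e * Cmod a - Cmod b) ^ 2 / (2 * e)).
  { apply Rmult_le_pos; [apply pow2_ge_0 | left; apply Rinv_0_lt_compat; lra]. }
  replace ((e * Cmod a - Cmod b) ^ 2 / (2 * e))
    with (e / 2 * Cmod a ^ 2 + / (2 * e) * Cmod b ^ 2 - Cmod a * Cmod b) in H0
    by (field; lra); lra.
Qed.

Lemma zsum_abs_le f g a m : (forall n, Rabs (f n) <= g n) -> Rabs (zsum f a m) <= zsum g a m.
Proof.
  intros H; induction m; cbn [zsum]; [rewrite Rabs_R0; lra |].
  eapply Rle_trans; [apply Rabs_triang |].
  specialize (H (a + Z.of_nat m)%Z); lra.
Qed.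

(** On a window so wide that both boundary fluxes are negligible, [green_sum] bounds [|Im z|] times
    the mass of [f] by a cross term. [cross_le] splits it into half of the left side, which is
    absorbed, and a multiple of the source. This is the self-adjoint resolvent bound
    [1 / |Im z|]. *)
Lemma good_nonreal V z : snd z <> 0 -> good V z (/ (snd z) ^ 2).
Proof.
  intros Hz0; pose (e := Rabs (snd z)).
  assert (He : 0 < e) by now apply Rabs_pos_lt.
  assert (He2 : (snd z) ^ 2 = e ^ 2) by (unfold e; now rewrite pow2_abs).
  rewrite He2; split; [left; apply Rinv_0_lt_compat, pow_lt, He |].
  intros f B Hf HB a m; apply le_epsilon; intros eta Heta.
  (* Two fluxes of this size make up the [eta * e / 2] in [F4]. *)
  destruct (flux_tendsto_0 f (eta * e / 4) Hf ltac:(apply Rdiv_lt_0_compat; nra)) as [N HN].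
  pose (b := (Z.min a 0 - Z.of_nat N - 1)%Z).
  pose (k := Z.to_nat (Z.max (a + Z.of_nat m) 0 + Z.of_nat N + 1 - b)).
  apply Rle_trans with (zsum (fun n => Cmod (f n) ^ 2) b k).
  { apply zsum_subset; [intros; apply pow2_ge_0 | unfold b; lia | unfold k, b; lia]. }
  set (S := zsum _ b k).
  assert (G := green_sum V z f b k); fold S in G.
  pose proof (HN (b + Z.of_nat k - 1)%Z ltac:(unfold k, b; lia)) as F1.
  pose proof (HN (b - 1)%Z ltac:(unfold b; lia)) as F2.
  pose proof (zsum_abs_le _ _ b k (fun n => cross_le e (f n) (Hz V z f n) He)) as F3.
  rewrite zsum_plus, !zsum_scal in F3; fold S in F3.
  specialize (HB b k).
  assert (F4 : e * S <= e / 2 * S + / (2 * e) * B + eta * e / 2).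
  { assert (Hs : e * S = Rabs (snd z * S)).
    { rewrite Rabs_mult; unfold e; f_equal; symmetry; apply Rabs_pos_eq.
      apply zsum_nonneg; intros; apply pow2_ge_0. }
    rewrite Hs.
    replace (snd z * S) with
      (flux f (b + Z.of_nat k - 1) + (- flux f (b - 1)
       + - zsum (fun n : Z => Im (Cconj (f n) * Hz V z f n)%C) b k)) by (rewrite G; ring).
    assert (0 < / (2 * e)) by (apply Rinv_0_lt_compat; lra).
    assert (/ (2 * e) * zsum (fun n : Z => Cmod (Hz V z f n) ^ 2) b k <= / (2 * e) * B)
      by (apply Rmult_le_compat_l; lra).
    eapply Rle_trans; [apply Rabs_triang |].
    eapply Rle_trans; [apply Rplus_le_compat_l, Rabs_triang |].
    rewrite !Rabs_Ropp; lra. }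
  apply Rmult_le_reg_l with (e / 2); [lra |].
  replace (e / 2 * (/ e ^ 2 * B + eta)) with (/ (2 * e) * B + eta * e / 2) by (field; lra).
  lra.
Qed.

Lemma good_unique V z D f : good V z D -> l2 f -> (forall n, Hz V z f n = RtoC 0) ->
  forall n, f n = RtoC 0.
Proof.
  intros [_ H] Hf E n.
  assert (B0 : bdd (Hz V z f) 0).
  { intros a m; rewrite zsum_zero_in; [lra |]; intros; rewrite E, Cmod_0; ring. }
  assert (P := bdd_term _ _ n (H f 0 Hf B0)).
  apply Cmod_eq_0; rewrite Rmult_0_r in P; pose proof (Cmod_ge_0 (f n)); nra.
Qed.

Lemma Hz_reflect V c z f n :
  Hz (fun k => V (c - k)%Z) z (fun k => f (c - k)%Z) n = Hz V z f (c - n).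
Proof.
  unfold Hz, Hop.
  replace (c - (n + 1))%Z with (c - n - 1)%Z by lia.
  replace (c - (n - 1))%Z with (c - n + 1)%Z by lia; ring.
Qed.

(** The reflection [n -> 2 - n] fixes the source site 1, so bounds on the left half-line follow from
    those on the right half-line with a reflected potential. *)
Lemma Hz_reflect_delta V z u : (forall n, Hz V z u n = dlt 1 n) ->
  forall n, Hz (fun k => V (2 - k)%Z) z (fun k => u (2 - k)%Z) n = dlt 1 n.
Proof.
  intros E n; rewrite Hz_reflect, E; unfold dlt, delta.
  destruct (Z.eq_dec (2 - n) 1), (Z.eq_dec n 1); easy || lia.
Qed.

Lemma l2_reflect f c : l2 f -> l2 (fun n => f (c - n)%Z).
Proof. rewrite !l2_bdd; intros [B HB]; exists B; now apply bdd_reflect. Qed.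

Lemma good_reflect V c z D : good V z D -> good (fun k => V (c - k)%Z) z D.
Proof.
  intros [HD H]; split; [easy |]; intros f B Hf HB.
  pose (f' := fun n => f (c - n)%Z).
  apply (bdd_ext (fun n => f' (c - n)%Z)); [intros; unfold f'; f_equal; lia |].
  apply bdd_reflect, H; [now apply l2_reflect |].
  apply (bdd_ext (fun n => Hz (fun k => V (c - k)%Z) z f (c - n))); [| now apply bdd_reflect].
  intros n; rewrite (Hz_ext _ _ f (fun k => f' (c - k)%Z))
    by (intros; unfold f'; f_equal; lia).
  rewrite Hz_reflect; f_equal; lia.
Qed.

(** The map [x -> x / 2 + c] has the fixed point [2 * c], and membership in [l2] provides a finite
    bound to start the iteration. An unknown that reappears on the right with a small factor is
    absorbed this way. *)
Lemma bdd_contract f c : l2 f -> 0 <= c ->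
  (forall x, bdd f x -> bdd f (x / 2 + c)) -> bdd f (2 * c).
Proof.
  intros Hf Hc step; apply l2_bdd in Hf; destruct Hf as [b Hb].
  assert (iter : forall k, bdd f (b / 2 ^ k + 2 * c)).
  { induction k.
    - apply (bdd_le _ _ _ Hb); simpl; lra.
    - apply (bdd_le _ _ _ (step _ IHk)); simpl; right; field.
      apply pow_nonzero; lra. }
  intros a m; apply le_epsilon; intros eta Heta.
  assert (L := is_lim_seq_scal_l _ b _ (is_lim_seq_geom (1/2) ltac:(rewrite Rabs_pos_eq; lra))).
  simpl in L; rewrite Rmult_0_r in L; apply is_lim_seq_spec in L.
  destruct (L (mkposreal eta Heta)) as [k Hk]; specialize (Hk k (Nat.le_refl k)); simpl in Hk.
  specialize (iter k a m).
  rewrite Rminus_0_r in Hk; apply Rabs_def2 in Hk; destruct Hk as [Hk _].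
  unfold Rdiv in Hk; rewrite Rmult_1_l, pow_inv in Hk.
  unfold Rdiv in *; lra.
Qed.

(** From [z f = H f - (H - z) f]: the number [8 + 2 * Bv ^ 2] bounds the squared norm of [H], so for
    large [z] the term [H f] is absorbed. *)
Lemma bdd_far V Bv z f B : bounded_by V Bv -> 4 * (8 + 2 * Bv ^ 2) <= Cmod z ^ 2 ->
  l2 f -> bdd (Hz V z f) B -> bdd f (4 * B / Cmod z ^ 2).
Proof.
  intros HV Hz0 Hf HB.
  assert (Bv2 := pow2_ge_0 Bv).
  set (zz := Cmod z ^ 2) in *.
  assert (HB0 := bdd_nonneg _ _ HB).
  replace (4 * B / zz) with (2 * (2 * B / zz)) by (field; lra).
  apply bdd_contract; [exact Hf | |].
  { apply Rmult_le_pos; [lra | left; apply Rinv_0_lt_compat; lra]. }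
  intros x Hx; assert (Hx0 := bdd_nonneg _ _ Hx).
  assert (Hm := bdd_minus _ _ _ _ (bdd_Hop V Bv f x HV Hx) HB).
  apply (bdd_le _ (/ zz * (2 * ((8 + 2 * Bv ^ 2) * x) + 2 * B))).
  - apply (bdd_dom (fun n => Cminus (Hop V f n) (Hz V z f n)));
      [| left; apply Rinv_0_lt_compat; lra | exact Hm].
    intros n; replace (Cminus (Hop V f n) (Hz V z f n)) with (Cmult z (f n))
      by (unfold Hz; ring).
    rewrite Cmod_mult, Rpow_mult_distr; fold zz; right; field; lra.
  - apply Rmult_le_reg_l with zz; [lra |].
    replace (zz * (x / 2 + 2 * B / zz)) with (zz * x / 2 + 2 * B) by (field; lra).
    replace (zz * (/ zz * (2 * ((8 + 2 * Bv ^ 2) * x) + 2 * B)))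
      with (2 * ((8 + 2 * Bv ^ 2) * x) + 2 * B) by (field; lra).
    nra.
Qed.

(** * Holomorphy of the resolvent *)

Definition lipC (f : C -> C) (z : C) : Prop :=
  exists c r, 0 <= c /\ 0 < r /\ forall w, Cmod (Cminus w z) < r ->
    Cmod (Cminus (f w) (f z)) <= c * Cmod (Cminus w z).

(** Complex differentiability with a quadratic error, the form in which the resolvent identity
    delivers it. Together with [lipC] of the derivative it supplies the continuity required for
    differentiating under the integral. *)
Definition holC (f d : C -> C) (z : C) : Prop :=
  exists c r, 0 <= c /\ 0 < r /\ forall w, Cmod (Cminus w z) < r ->
    Cmod (Cminus (Cminus (f w) (f z)) (Cmult (d z) (Cminus w z))) <= c * Cmod (Cminus w z) ^ 2.

Lemma lipC_const k z : lipC (fun _ => k) z.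
Proof.
  exists 0, 1; split; [lra | split; [lra |]]; intros w _.
  replace (Cminus k k) with (RtoC 0) by ring; rewrite Cmod_0; lra.
Qed.

Lemma lipC_id z : lipC (fun w => w) z.
Proof. exists 1, 1; split; [lra | split; [lra |]]; intros w _; lra. Qed.

Lemma lipC_ext f g z : (forall w, f w = g w) -> lipC f z -> lipC g z.
Proof. intros E (c & r & Hc & Hr & H); exists c, r; repeat split; auto; intros; rewrite <- !E; auto. Qed.

Lemma lipC_plus f g z : lipC f z -> lipC g z -> lipC (fun w => Cplus (f w) (g w)) z.
Proof.
  intros (c & r & Hc & Hr & H) (c' & r' & Hc' & Hr' & H').
  exists (c + c'), (Rmin r r'); split; [lra | split; [now apply Rmin_pos |]].
  intros w Hw.
  specialize (H w (Rlt_le_trans _ _ _ Hw (Rmin_l _ _))).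
  specialize (H' w (Rlt_le_trans _ _ _ Hw (Rmin_r _ _))).
  replace (Cminus (Cplus (f w) (g w)) (Cplus (f z) (g z)))
    with (Cplus (Cminus (f w) (f z)) (Cminus (g w) (g z))) by ring.
  eapply Rle_trans; [apply Cmod_triangle |]; lra.
Qed.

Lemma lipC_mult f g z : lipC f z -> lipC g z -> lipC (fun w => Cmult (f w) (g w)) z.
Proof.
  intros (c & r & Hc & Hr & H) (c' & r' & Hc' & Hr' & H').
  exists (c * Cmod (g z) + (Cmod (f z) + c * r) * c'), (Rmin r r').
  pose proof (Cmod_ge_0 (f z)); pose proof (Cmod_ge_0 (g z)).
  split; [| split; [now apply Rmin_pos |]].
  { apply Rplus_le_le_0_compat; apply Rmult_le_pos; try easy; nra. }
  intros w Hw.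
  assert (Hw1 := Rlt_le_trans _ _ _ Hw (Rmin_l _ _)).
  specialize (H w Hw1).
  specialize (H' w (Rlt_le_trans _ _ _ Hw (Rmin_r _ _))).
  assert (Hfw : Cmod (f w) <= Cmod (f z) + c * r).
  { replace (f w) with (Cplus (f z) (Cminus (f w) (f z))) by ring.
    eapply Rle_trans; [apply Cmod_triangle |].
    pose proof (Rmult_le_compat_l c _ _ Hc (Rlt_le _ _ Hw1)); lra. }
  replace (Cminus (Cmult (f w) (g w)) (Cmult (f z) (g z)))
    with (Cplus (Cmult (Cminus (f w) (f z)) (g z)) (Cmult (f w) (Cminus (g w) (g z)))) by ring.
  eapply Rle_trans; [apply Cmod_triangle |]; rewrite !Cmod_mult.
  pose proof (Cmod_ge_0 (f w)); pose proof (Cmod_ge_0 (Cminus (g w) (g z))).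
  pose proof (Cmod_ge_0 (Cminus w z)).
  assert (Cmod (Cminus (f w) (f z)) * Cmod (g z) <= c * Cmod (Cminus w z) * Cmod (g z))
    by now apply Rmult_le_compat_r.
  assert (Cmod (f w) * Cmod (Cminus (g w) (g z)) <= (Cmod (f z) + c * r) * (c' * Cmod (Cminus w z)))
    by now apply Rmult_le_compat.
  lra.
Qed.

Lemma lipC_pow k z : lipC (fun w => Cpow w k) z.
Proof.
  induction k; [apply (lipC_const (RtoC 1)) |].
  apply (lipC_ext (fun w => Cmult w (Cpow w k))); [easy | apply lipC_mult; [apply lipC_id | easy]].
Qed.

Lemma holC_lipC f d z : holC f d z -> lipC f z.
Proof.
  intros (c & r & Hc & Hr & H); exists (c * r + Cmod (d z)), r.
  pose proof (Cmod_ge_0 (d z)).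
  split; [nra | split; [easy |]]; intros w Hw; specialize (H w Hw).
  replace (Cminus (f w) (f z)) with
    (Cplus (Cminus (Cminus (f w) (f z)) (Cmult (d z) (Cminus w z))) (Cmult (d z) (Cminus w z)))
    by ring.
  eapply Rle_trans; [apply Cmod_triangle |]; rewrite Cmod_mult.
  pose proof (Cmod_ge_0 (Cminus w z)).
  assert (c * Cmod (Cminus w z) ^ 2 <= c * r * Cmod (Cminus w z)).
  { simpl; rewrite Rmult_1_r, Rmult_assoc; apply Rmult_le_compat_l; nra. }
  lra.
Qed.

Lemma holC_const k z : holC (fun _ => k) (fun _ => RtoC 0) z.
Proof.
  exists 0, 1; split; [lra | split; [lra |]]; intros w _.
  replace (Cminus (Cminus k k) (Cmult (RtoC 0) (Cminus w z))) with (RtoC 0) by ring.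
  rewrite Cmod_0; lra.
Qed.

Lemma holC_id z : holC (fun w => w) (fun _ => RtoC 1) z.
Proof.
  exists 0, 1; split; [lra | split; [lra |]]; intros w _.
  replace (Cminus (Cminus w z) (Cmult (RtoC 1) (Cminus w z))) with (RtoC 0) by ring.
  rewrite Cmod_0; lra.
Qed.

Lemma holC_mult f df g dg z : holC f df z -> holC g dg z ->
  holC (fun w => Cmult (f w) (g w))
       (fun w => Cplus (Cmult (df w) (g w)) (Cmult (f w) (dg w))) z.
Proof.
  intros Hf Hg.
  destruct (holC_lipC _ _ _ Hf) as (l & s & Hl & Hs & L).
  destruct (holC_lipC _ _ _ Hg) as (l' & s' & Hl' & Hs' & L').
  destruct Hf as (c & r & Hc & Hr & H), Hg as (c' & r' & Hc' & Hr' & H').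
  pose proof (Cmod_ge_0 (f z)) as Pf; pose proof (Cmod_ge_0 (g z)) as Pg.
  exists (l * l' + c * Cmod (g z) + Cmod (f z) * c'), (Rmin (Rmin r r') (Rmin s s')).
  split; [| split; [repeat apply Rmin_pos; easy |]].
  { repeat apply Rplus_le_le_0_compat; now apply Rmult_le_pos. }
  intros w Hw.
  assert (Hw1 := Rlt_le_trans _ _ _ Hw (Rmin_l _ _)).
  assert (Hw2 := Rlt_le_trans _ _ _ Hw (Rmin_r _ _)).
  specialize (H w (Rlt_le_trans _ _ _ Hw1 (Rmin_l _ _))).
  specialize (H' w (Rlt_le_trans _ _ _ Hw1 (Rmin_r _ _))).
  specialize (L w (Rlt_le_trans _ _ _ Hw2 (Rmin_l _ _))).
  specialize (L' w (Rlt_le_trans _ _ _ Hw2 (Rmin_r _ _))).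
  set (h := Cminus w z) in *.
  set (ef := Cminus (Cminus (f w) (f z)) (Cmult (df z) h)) in *.
  set (eg := Cminus (Cminus (g w) (g z)) (Cmult (dg z) h)) in *.
  replace (Cminus _ _) with
    (Cplus (Cplus (Cmult (Cminus (f w) (f z)) (Cminus (g w) (g z))) (Cmult ef (g z)))
       (Cmult (f z) eg)) by (unfold ef, eg; ring).
  eapply Rle_trans; [apply Cmod_triangle |].
  eapply Rle_trans; [apply Rplus_le_compat_r, Cmod_triangle |]; rewrite !Cmod_mult.
  pose proof (Cmod_ge_0 (Cminus (f w) (f z))); pose proof (Cmod_ge_0 (Cminus (g w) (g z))).
  assert (Cmod (Cminus (f w) (f z)) * Cmod (Cminus (g w) (g z)) <= (l * Cmod h) * (l' * Cmod h))
    by now apply Rmult_le_compat.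
  assert (Cmod ef * Cmod (g z) <= c * Cmod h ^ 2 * Cmod (g z)) by now apply Rmult_le_compat_r.
  assert (Cmod (f z) * Cmod eg <= Cmod (f z) * (c' * Cmod h ^ 2)) by now apply Rmult_le_compat_l.
  simpl in *; lra.
Qed.

Definition entire (f : C -> C) : Prop :=
  exists d, forall z, holC f d z /\ lipC d z.

Lemma entire_const k : entire (fun _ => k).
Proof. exists (fun _ => RtoC 0); split; [apply holC_const | apply lipC_const]. Qed.

Lemma entire_mult f g : entire f -> entire g -> entire (fun w => Cmult (f w) (g w)).
Proof.
  intros [df Hf] [dg Hg].
  exists (fun w => Cplus (Cmult (df w) (g w)) (Cmult (f w) (dg w))); intros z.
  destruct (Hf z) as [H1 H2], (Hg z) as [H3 H4]; split; [now apply holC_mult |].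
  apply lipC_plus; apply lipC_mult; eauto using holC_lipC.
Qed.

Lemma entire_monomial k m : entire (fun w => Cmult k (Cpow w m)).
Proof.
  apply entire_mult; [apply entire_const |].
  induction m; [apply (entire_const (RtoC 1)) |]; apply (entire_mult (fun w => w)); [| easy].
  exists (fun _ => RtoC 1); split; [apply holC_id | apply lipC_const].
Qed.

Definition regular V z := (exists D, good V z D) /\ solvable V z.

(** A choice that is meaningful where [solvable] holds; elsewhere the value is arbitrary. *)
Definition solve V z (psi : Z -> C) : Z -> C :=
  epsilon (inhabits (fun _ : Z => RtoC 0)) (fun u => l2 u /\ forall n, Hz V z u n = psi n).

Lemma solve_spec V z psi : solvable V z -> l2 psi ->
  l2 (solve V z psi) /\ forall n, Hz V z (solve V z psi) n = psi n.
Proof. intros H Hp; unfold solve; apply epsilon_spec; now apply H. Qed.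

Definition green V z : Z -> C := solve V z (dlt 1).

Lemma l2_dlt j : l2 (dlt j).
Proof. apply l2_bdd; exists 1; apply bdd_dlt. Qed.

Lemma green_spec V z : solvable V z ->
  l2 (green V z) /\ forall n, Hz V z (green V z) n = dlt 1 n.
Proof. intros; apply solve_spec; [easy | apply l2_dlt]. Qed.

(** The difference [d] of the two sequences satisfies [(H - z) d = e + (w - z) x']. Writing
    [x' = d + x] feeds [d] back, with a factor that the smallness of [|w - z|] keeps below one
    half. *)
Lemma perturb_bound V z w D x x' e Bx E :
  good V z D -> l2 x' -> bdd x Bx ->
  (forall n, Hz V w x' n = Cplus (Hz V z x n) (e n)) -> bdd e E ->
  8 * D * Cmod (Cminus w z) ^ 2 <= 1 ->
  bdd (fun n => Cminus (x' n) (x n)) (4 * D * E + 8 * D * Cmod (Cminus w z) ^ 2 * Bx).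
Proof.
  intros [HD G] Hx' Hx Heq He Hs.
  set (h := Cminus w z) in *.
  assert (Hd : l2 (fun n => Cminus (x' n) (x n))).
  { apply l2_minus; [easy | apply l2_bdd; now exists Bx]. }
  assert (P : 0 <= D * Cmod h ^ 2) by (apply Rmult_le_pos; [easy | apply pow2_ge_0]).
  pose proof (bdd_nonneg _ _ Hx); pose proof (bdd_nonneg _ _ He).
  replace (4 * D * E + 8 * D * Cmod h ^ 2 * Bx)
    with (2 * (2 * D * E + 4 * D * Cmod h ^ 2 * Bx)) by ring.
  apply bdd_contract; [easy | |].
  { apply Rplus_le_le_0_compat; [nra |].
    replace (4 * D * Cmod h ^ 2 * Bx) with (4 * (D * Cmod h ^ 2) * Bx) by ring; nra. }
  intros b Hb.
  pose proof (bdd_nonneg _ _ Hb).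
  assert (Hb' : bdd x' (2 * b + 2 * Bx)).
  { apply (bdd_ext (fun n => Cplus (Cminus (x' n) (x n)) (x n))); [intros; ring |].
    now apply bdd_plus. }
  apply (bdd_le _ (D * (2 * E + 2 * (Cmod h ^ 2 * (2 * b + 2 * Bx))))).
  - apply G; [easy |].
    apply (bdd_ext (fun n => Cplus (e n) (Cmult h (x' n)))).
    + intros n.
      replace (Hz V z (fun n => Cminus (x' n) (x n)) n)
        with (Cminus (Cplus (Hz V w x' n) (Cmult h (x' n))) (Hz V z x n))
        by (unfold Hz, Hop, h; ring).
      rewrite Heq; ring.
    + apply bdd_plus; [easy | now apply bdd_scal].
  - replace (D * (2 * E + 2 * (Cmod h ^ 2 * (2 * b + 2 * Bx))))
      with (2 * D * E + 4 * D * Cmod h ^ 2 * Bx + (D * Cmod h ^ 2) * (4 * b)) by ring.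
    assert ((D * Cmod h ^ 2) * (4 * b) <= / 8 * (4 * b)) by (apply Rmult_le_compat_r; lra).
    lra.
Qed.

Lemma pow2_le_inv a b : 0 <= b -> a ^ 2 <= b ^ 2 -> a <= b.
Proof. intros; nra. Qed.

(** The square of the resolvent applied to [delta_1], which is the derivative of [green] in [z]. *)
Definition green' V z : Z -> C := solve V z (green V z).

(** With [h = w - z], applying [H - z] to [green V w - green V z - h * green' V z] yields
    [h * (green V w - green V z)]. The difference in it is itself of order [h], so the error is
    quadratic. *)
Lemma green_hol V (Om : C -> Prop) z n :
  (forall w, Om w -> regular V w) -> (exists r, 0 < r /\ forall w, Cmod (Cminus w z) < r -> Om w) ->
  holC (fun w => green V w n) (fun w => green' V w n) z /\ lipC (fun w => green' V w n) z.
Proof.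
  intros Hreg (r & Hr & HO).
  assert (Hzz : Om z).
  { apply HO; replace (Cminus z z) with (RtoC 0) by ring; rewrite Cmod_0; easy. }
  destruct (Hreg z Hzz) as [[D HG] HS].
  assert (HD := proj1 HG).
  destruct (green_spec V z HS) as [Lu Eu].
  destruct (solve_spec V z _ HS Lu) as [Lv Ev]; fold (green' V z) in Lv, Ev.
  destruct (proj1 (l2_bdd _) Lu) as [Bu HBu]; destruct (proj1 (l2_bdd _) Lv) as [Bv HBv].
  assert (PBu := bdd_nonneg _ _ HBu); assert (PBv := bdd_nonneg _ _ HBv).
  (* The second radius ensures [8 * D * |w - z| ^ 2 <= 1], as [perturb_bound] demands. *)
  pose (r' := Rmin r (/ (8 * D + 1))).
  assert (Hr' : 0 < r') by (apply Rmin_pos; [easy | apply Rinv_0_lt_compat; lra]).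
  assert (small : forall w, Cmod (Cminus w z) < r' -> 8 * D * Cmod (Cminus w z) ^ 2 <= 1).
  { intros w Hw; assert (H1 := Rlt_le_trans _ _ _ Hw (Rmin_r _ _)).
    pose proof (Cmod_ge_0 (Cminus w z)).
    assert (H2 : (8 * D + 1) * Cmod (Cminus w z) <= 1).
    { apply Rle_trans with ((8 * D + 1) * / (8 * D + 1)); [| right; field; lra].
      apply Rmult_le_compat_l; lra. }
    assert (Cmod (Cminus w z) <= 1) by nra.
    simpl; nra. }
  assert (cont : forall w, Cmod (Cminus w z) < r' ->
    solvable V w /\ bdd (fun n => Cminus (green V w n) (green V z n)) (8 * D * Bu * Cmod (Cminus w z) ^ 2)).
  { intros w Hw.
    destruct (Hreg w (HO w (Rlt_le_trans _ _ _ Hw (Rmin_l _ _)))) as [_ HSw].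
    split; [easy |]; destruct (green_spec V w HSw) as [Lw Ew].
    apply (bdd_le _ (4 * D * 0 + 8 * D * Cmod (Cminus w z) ^ 2 * Bu)); [| lra].
    apply (perturb_bound V z w D _ _ (fun _ => RtoC 0)); auto.
    - intros k; rewrite Eu, Ew; ring.
    - intros a m; rewrite zsum_zero_in; [lra |]; intros; rewrite Cmod_0; ring. }
  assert (Q1 : 0 <= 8 * D * Bu) by (apply Rmult_le_pos; lra).
  split.
  - exists (sqrt (D * (8 * D * Bu))), r'; split; [apply sqrt_pos | split; [easy |]].
    intros w Hw; destruct (cont w Hw) as [HSw Hc].
    destruct (green_spec V w HSw) as [Lw Ew].
    set (h := Cminus w z) in *.
    assert (P := bdd_term _ _ n (proj2 HG
      (fun k => Cminus (Cminus (green V w k) (green V z k)) (Cmult h (green' V z k)))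
      (Cmod h ^ 2 * (8 * D * Bu * Cmod h ^ 2))
      (l2_minus _ _ (l2_minus _ _ Lw Lu) (l2_scal h _ Lv)) ltac:(
        apply (bdd_ext (fun k => Cmult h (Cminus (green V w k) (green V z k))));
        [ intros k; set (f := green V w) in *; set (g := green V z) in *; set (v := green' V z) in *;
          transitivity (Cminus (Cminus (Cplus (Hz V w f k) (Cmult h (f k))) (Hz V z g k))
              (Cmult h (Hz V z v k)));
            [rewrite Eu, Ew, Ev; ring | unfold Hz, Hop, h; ring]
        | now apply bdd_scal ]))).
    apply pow2_le_inv; [apply Rmult_le_pos; [apply sqrt_pos | apply pow2_ge_0] |].
    rewrite Rpow_mult_distr, pow2_sqrt by (apply Rmult_le_pos; lra).
    replace (Cmult (green' V z n) h) with (Cmult h (green' V z n)) by ring.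
    eapply Rle_trans; [exact P |]; right; ring.
  - exists (sqrt (4 * D * (8 * D * Bu) + 8 * D * Bv)), r'; split; [apply sqrt_pos | split; [easy |]].
    intros w Hw; destruct (cont w Hw) as [HSw Hc].
    destruct (green_spec V w HSw) as [Lw _].
    destruct (solve_spec V w _ HSw Lw) as [Lv' Ev']; fold (green' V w) in Lv', Ev'.
    (* Now the source moves as well, from [green V z] to [green V w]; this change is the [e] of
       [perturb_bound]. *)
    assert (P := bdd_term _ _ n (perturb_bound V z w D _ _ _ _ _ HG Lv' HBv
       ltac:(intros k; rewrite Ev, Ev';
             instantiate (1 := fun k => Cminus (green V w k) (green V z k)); simpl; ring)
       Hc (small w Hw))); simpl in P.
    apply pow2_le_inv; [apply Rmult_le_pos; [apply sqrt_pos | apply Cmod_ge_0] |].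
    rewrite Rpow_mult_distr, pow2_sqrt
      by (apply Rplus_le_le_0_compat; apply Rmult_le_pos; try lra; nra).
    simpl; eapply Rle_trans; [exact P |]; right; ring.
Qed.

(** * Contour integrals over rectangles *)

(** Since [dz] is [dx] on horizontal and [i dy] on vertical sides, the real part of a contour
    integral involves [fst] of the integrand on the former and minus [snd] on the latter. Imaginary
    parts are reached by multiplying the integrand by [Ci]. *)
Definition hint (f : C -> C) (y a b : R) : R := RInt (fun x => fst (f (x, y))) a b.
Definition vint (f : C -> C) (x c e : R) : R := RInt (fun y => snd (f (x, y))) c e.

(* Real part of the counterclockwise integral of [f] over the boundary of [a,b] x [c,e]. *)
Definition rect (a b c e : R) (f : C -> C) : R :=
  hint f c a b - hint f e a b - vint f b c e + vint f a c e.

Lemma derive_of_quadratic (phi : R -> R) (x l c r : R) : 0 <= c -> 0 < r ->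
  (forall h, Rabs h < r -> Rabs (phi (x + h) - phi x - l * h) <= c * h ^ 2) ->
  is_derive phi x l.
Proof.
  intros Hc Hr H; apply is_derive_Reals; intros eps Heps.
  assert (Hd : 0 < Rmin r (eps / (c + 1))).
  { apply Rmin_pos; [easy | apply Rdiv_lt_0_compat; lra]. }
  exists (mkposreal _ Hd); intros h Hh0 Hh; simpl in Hh.
  specialize (H h (Rlt_le_trans _ _ _ Hh (Rmin_l _ _))).
  assert (Hh2 := Rlt_le_trans _ _ _ Hh (Rmin_r _ _)).
  replace ((phi (x + h) - phi x) / h - l) with ((phi (x + h) - phi x - l * h) / h) by (field; easy).
  assert (Ph : 0 < Rabs h) by now apply Rabs_pos_lt.
  unfold Rdiv; rewrite Rabs_mult, Rabs_inv.
  apply Rmult_lt_reg_r with (Rabs h); [easy |].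
  rewrite Rmult_assoc, Rinv_l, Rmult_1_r by lra.
  apply Rle_lt_trans with (1 := H).
  rewrite <- pow2_abs; simpl; rewrite Rmult_1_r, <- Rmult_assoc.
  apply Rmult_lt_compat_r; [easy |].
  apply Rle_lt_trans with (c * (eps / (c + 1))); [apply Rmult_le_compat_l; lra |].
  apply Rmult_lt_reg_r with (c + 1); [lra |].
  replace (c * (eps / (c + 1)) * (c + 1)) with (c * eps) by (field; lra); nra.
Qed.

Lemma Cmod_hor x h y : Cmod (Cminus (x + h, y) (x, y)) = Rabs h.
Proof.
  replace (Cminus (x + h, y) (x, y)) with (RtoC h) by (apply injective_projections; simpl; ring).
  apply Cmod_R.
Qed.

Lemma Cmod_ver x h y : Cmod (Cminus (x, y + h) (x, y)) = Rabs h.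
Proof.
  replace (Cminus (x, y + h) (x, y)) with (Cmult Ci (RtoC h))
    by (apply injective_projections; simpl; ring).
  now rewrite Cmod_mult, Cmod_Ci, Cmod_R, Rmult_1_l.
Qed.

Lemma fst_le_Cmod z : Rabs (fst z) <= Cmod z.
Proof. eapply Rle_trans; [apply Rmax_l | apply Rmax_Cmod]. Qed.

Lemma snd_le_Cmod z : Rabs (snd z) <= Cmod z.
Proof. eapply Rle_trans; [apply Rmax_r | apply Rmax_Cmod]. Qed.

Section partials.
Variables (f d : C -> C) (x y : R).
Hypothesis Hf : holC f d (x, y).

Lemma derive_snd_hor : is_derive (fun t => snd (f (t, y))) x (snd (d (x, y))).
Proof.
  destruct Hf as (c & r & Hc & Hr & H); apply (derive_of_quadratic _ _ _ c r Hc Hr).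
  intros h Hh; specialize (H (x + h, y)); rewrite Cmod_hor, pow2_abs in H.
  eapply Rle_trans; [| apply (H Hh)]; eapply Rle_trans; [| apply snd_le_Cmod].
  right; f_equal; simpl; ring.
Qed.

(** A Cauchy-Riemann equation: a step [i h] changes [f] by [i h d] to first order, whose real part
    is [- h] times [snd d]. *)
Lemma derive_fst_ver : is_derive (fun t => fst (f (x, t))) y (- snd (d (x, y))).
Proof.
  destruct Hf as (c & r & Hc & Hr & H); apply (derive_of_quadratic _ _ _ c r Hc Hr).
  intros h Hh; specialize (H (x, y + h)); rewrite Cmod_ver, pow2_abs in H.
  eapply Rle_trans; [| apply (H Hh)]; eapply Rle_trans; [| apply fst_le_Cmod].
  right; f_equal; simpl; ring.
Qed.
End partials.

Lemma lipC_hor_ball f x y : lipC f (x, y) -> exists c r, 0 <= c /\ 0 < r /\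
  forall t, Rabs (t - x) < r -> Cmod (Cminus (f (t, y)) (f (x, y))) <= c * Rabs (t - x).
Proof.
  intros (c & r & Hc & Hr & H); exists c, r; repeat split; auto.
  intros t Ht; specialize (H (x + (t - x), y)); rewrite Cmod_hor in H.
  replace (x + (t - x)) with t in H by ring; auto.
Qed.

Lemma lipC_ver_ball f x y : lipC f (x, y) -> exists c r, 0 <= c /\ 0 < r /\
  forall t, Rabs (t - y) < r -> Cmod (Cminus (f (x, t)) (f (x, y))) <= c * Rabs (t - y).
Proof.
  intros (c & r & Hc & Hr & H); exists c, r; repeat split; auto.
  intros t Ht; specialize (H (x, y + (t - y))); rewrite Cmod_ver in H.
  replace (y + (t - y)) with t in H by ring; auto.
Qed.

Lemma continuous_of_lip (phi : R -> R) x c r : 0 <= c -> 0 < r ->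
  (forall t, Rabs (t - x) < r -> Rabs (phi t - phi x) <= c * Rabs (t - x)) -> continuous phi x.
Proof.
  intros Hc Hr H; apply continuity_pt_filterlim; intros eps Heps.
  assert (Hd : 0 < Rmin r (eps / (c + 1))).
  { apply Rmin_pos; [easy | apply Rdiv_lt_0_compat; lra]. }
  exists (Rmin r (eps / (c + 1))); split; [easy |].
  simpl; unfold R_dist; intros t [_ Ht].
  apply Rle_lt_trans with (1 := H t (Rlt_le_trans _ _ _ Ht (Rmin_l _ _))).
  assert (Ht2 := Rlt_le_trans _ _ _ Ht (Rmin_r _ _)).
  apply Rle_lt_trans with (c * (eps / (c + 1))); [apply Rmult_le_compat_l; lra |].
  apply Rmult_lt_reg_r with (c + 1); [lra |].
  replace (c * (eps / (c + 1)) * (c + 1)) with (c * eps) by (field; lra); nra.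
Qed.

Lemma Cmod_diff a b : Rabs (Cmod a - Cmod b) <= Cmod (Cminus a b).
Proof.
  apply Rabs_le; split.
  - pose proof (Cmod_triangle (Cminus b a) a) as H.
    replace (Cplus (Cminus b a) a) with b in H by ring.
    replace (Cminus b a) with (Copp (Cminus a b)) in H by ring; rewrite Cmod_opp in H; lra.
  - pose proof (Cmod_triangle (Cminus a b) b) as H.
    replace (Cplus (Cminus a b) b) with a in H by ring; lra.
Qed.

Section continuity.
Variables (f : C -> C) (p : C -> R) (x y : R).
Hypothesis Hf : lipC f (x, y).
Hypothesis Hp : forall a b, Rabs (p a - p b) <= Cmod (Cminus a b).

Lemma cont_hor : continuous (fun t => p (f (t, y))) x.
Proof.
  destruct (lipC_hor_ball f x y Hf) as (c & r & Hc & Hr & H).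
  apply (continuous_of_lip _ _ c r Hc Hr); intros t Ht.
  eapply Rle_trans; [apply Hp | exact (H t Ht)].
Qed.

Lemma cont_ver : continuous (fun t => p (f (x, t))) y.
Proof.
  destruct (lipC_ver_ball f x y Hf) as (c & r & Hc & Hr & H).
  apply (continuous_of_lip _ _ c r Hc Hr); intros t Ht.
  eapply Rle_trans; [apply Hp | exact (H t Ht)].
Qed.
End continuity.

Lemma fst_diff a b : Rabs (fst a - fst b) <= Cmod (Cminus a b).
Proof. exact (fst_le_Cmod (Cminus a b)). Qed.

Lemma snd_diff a b : Rabs (snd a - snd b) <= Cmod (Cminus a b).
Proof. exact (snd_le_Cmod (Cminus a b)). Qed.

Definition cont_fst_hor f x y H := cont_hor f fst x y H fst_diff.
Definition cont_snd_hor f x y H := cont_hor f snd x y H snd_diff.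
Definition cont_snd_ver f x y H := cont_ver f snd x y H snd_diff.
Definition cont_Cmod_hor f x y H := cont_hor f Cmod x y H Cmod_diff.
Definition cont_Cmod_ver f x y H := cont_ver f Cmod x y H Cmod_diff.

Lemma lipC_near f x y : lipC f (x, y) -> forall eps, 0 < eps -> exists d, 0 < d /\
  forall u v, Rabs (u - x) < d -> Rabs (v - y) < d -> Cmod (Cminus (f (u, v)) (f (x, y))) < eps.
Proof.
  intros (c & r & Hc & Hr & H) eps He.
  assert (Hd : 0 < Rmin (r / 2) (eps / (2 * c + 1))).
  { apply Rmin_pos; [lra | apply Rdiv_lt_0_compat; lra]. }
  exists (Rmin (r / 2) (eps / (2 * c + 1))); split; [easy |]; intros u v Hu Hv.
  assert (Hm : Cmod (Cminus (u, v) (x, y)) <= Rabs (u - x) + Rabs (v - y)).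
  { replace (Cminus (u, v) (x, y)) with (Cplus (RtoC (u - x)) (Cmult Ci (RtoC (v - y))))
      by (apply injective_projections; simpl; ring).
    eapply Rle_trans; [apply Cmod_triangle |].
    rewrite Cmod_mult, Cmod_Ci, !Cmod_R; lra. }
  assert (H1 := Rmin_l (r / 2) (eps / (2 * c + 1))).
  assert (H2 := Rmin_r (r / 2) (eps / (2 * c + 1))).
  apply Rle_lt_trans with (1 := H (u, v) ltac:(lra)).
  apply Rle_lt_trans with (c * (2 * (eps / (2 * c + 1)))); [apply Rmult_le_compat_l; lra |].
  apply Rmult_lt_reg_r with (2 * c + 1); [lra |].
  replace (c * (2 * (eps / (2 * c + 1))) * (2 * c + 1)) with (2 * c * eps) by (field; lra); nra.
Qed.

Lemma ex_RInt_cont (phi : R -> R) a b : a <= b ->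
  (forall x, a <= x <= b -> continuous phi x) -> ex_RInt phi a b.
Proof.
  intros Hab H; apply (ex_RInt_continuous (V := R_CompleteNormedModule)).
  rewrite Rmin_left, Rmax_right by easy; auto.
Qed.

(** By Cauchy-Riemann the [y]-derivative of the integral along a horizontal segment is the integral
    of an [x]-derivative, hence a difference of values on the vertical sides; integrating in [y]
    closes the contour. The margin [eta] gives room to differentiate up to the boundary. *)
Lemma rect_cauchy f d a b c e eta : a <= b -> c <= e -> 0 < eta ->
  (forall x y, a - eta < x < b + eta -> c - eta < y < e + eta ->
     holC f d (x, y) /\ lipC d (x, y)) ->
  rect a b c e f = 0.
Proof.
  intros Hab Hce Heta H.
  assert (Hder : forall y, c <= y <= e ->
    is_derive (fun y => hint f y a b) y (- (snd (f (b, y)) - snd (f (a, y))))).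
  { intros y Hy.
    replace (- (snd (f (b, y)) - snd (f (a, y))))
      with (RInt (fun x => Derive (fun u => fst (f (x, u))) y) a b).
    - unfold hint.
      apply (is_derive_RInt_param (fun u x => fst (f (x, u)))).
      + exists (mkposreal eta Heta); intros y' Hy' x Hx.
        rewrite Rmin_left, Rmax_right in Hx by easy.
        unfold ball in Hy'; simpl in Hy'; unfold AbsRing_ball, abs, minus, plus, opp in Hy'; simpl in Hy'.
        apply Rabs_def2 in Hy'.
        exists (- snd (d (x, y'))); apply derive_fst_ver, H; lra.
      + intros x Hx; rewrite Rmin_left, Rmax_right in Hx by easy.
        apply (continuity_2d_pt_ext_loc (fun u v => - snd (d (v, u)))).
        * exists (mkposreal eta Heta); intros u v Hu Hv; simpl in Hu, Hv.
          apply Rabs_def2 in Hu; apply Rabs_def2 in Hv.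
          symmetry; apply is_derive_unique, derive_fst_ver, H; lra.
        * apply continuity_2d_pt_opp; intros eps.
          destruct (H x y ltac:(lra) ltac:(lra)) as [_ L].
          destruct (lipC_near d x y L eps (cond_pos eps)) as (r & Hr & HL).
          exists (mkposreal r Hr); intros u v Hu Hv; simpl in Hu, Hv.
          eapply Rle_lt_trans; [| apply (HL v u Hv Hu)].
          apply (snd_le_Cmod (Cminus (d (v, u)) (d (x, y)))).
      + exists (mkposreal eta Heta); intros y' Hy'.
        unfold ball in Hy'; simpl in Hy'; unfold AbsRing_ball, abs, minus, plus, opp in Hy'; simpl in Hy'.
        apply Rabs_def2 in Hy'.
        apply ex_RInt_cont; [easy |]; intros x Hx.
        apply cont_fst_hor, (holC_lipC _ d), H; lra.
    - rewrite (RInt_ext _ (fun x => opp (snd (d (x, y))))).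
      + rewrite (RInt_opp (V := R_CompleteNormedModule)).
        * unfold opp; simpl; f_equal.
          apply (is_RInt_unique (fun x => snd (d (x, y)))).
          apply (is_RInt_derive (fun x => snd (f (x, y)))); rewrite Rmin_left, Rmax_right by easy;
            intros x Hx; destruct (H x y ltac:(lra) ltac:(lra)) as [Hh Hl].
          -- now apply derive_snd_hor.
          -- now apply cont_snd_hor.
        * apply ex_RInt_cont; [easy |]; intros x Hx; apply cont_snd_hor, H; lra.
      + rewrite Rmin_left, Rmax_right by easy; intros x Hx.
        apply is_derive_unique, derive_fst_ver, H; lra. }
  assert (Hcont : forall x, a <= x <= b -> forall y, c <= y <= e -> continuous (fun y => snd (f (x, y))) y).
  { intros x Hx y Hy; apply cont_snd_ver, (holC_lipC _ d), H; lra. }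
  assert (I : is_RInt (fun y => - (snd (f (b, y)) - snd (f (a, y)))) c e
                (minus (hint f e a b) (hint f c a b))).
  { apply (is_RInt_derive (fun y => hint f y a b)); rewrite Rmin_left, Rmax_right by easy.
    - apply Hder.
    - intros y Hy; apply (continuous_opp (V := R_NormedModule)).
      apply (continuous_minus (V := R_NormedModule)); apply Hcont; lra. }
  apply (is_RInt_unique (V := R_CompleteNormedModule)) in I.
  rewrite (RInt_opp (V := R_CompleteNormedModule)) in I.
  2: { apply (ex_RInt_minus (V := R_NormedModule)); apply ex_RInt_cont; try easy; apply Hcont; lra. }
  rewrite (RInt_minus (V := R_CompleteNormedModule)) in I
    by (apply ex_RInt_cont; try easy; apply Hcont; lra).
  unfold rect, vint; unfold minus, plus, opp in I; simpl in I; lra.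
Qed.

Definition on_rect (a b c e : R) (P : C -> Prop) : Prop :=
  (forall x, a <= x <= b -> P (x, c) /\ P (x, e)) /\
  (forall y, c <= y <= e -> P (a, y) /\ P (b, y)).

Lemma rect_plus a b c e f g : a <= b -> c <= e ->
  on_rect a b c e (lipC f) -> on_rect a b c e (lipC g) ->
  rect a b c e (fun z => Cplus (f z) (g z)) = rect a b c e f + rect a b c e g.
Proof.
  intros Hab Hce [F1 F2] [G1 G2].
  assert (Hh : forall y, (forall x, a <= x <= b -> lipC f (x, y)) ->
     (forall x, a <= x <= b -> lipC g (x, y)) ->
     hint (fun z => Cplus (f z) (g z)) y a b = hint f y a b + hint g y a b).
  { intros y Hf Hg; unfold hint; simpl.
    apply (RInt_plus (V := R_CompleteNormedModule)); apply ex_RInt_cont; auto;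
      intros; apply cont_fst_hor; auto. }
  assert (Hv : forall x, (forall y, c <= y <= e -> lipC f (x, y)) ->
     (forall y, c <= y <= e -> lipC g (x, y)) ->
     vint (fun z => Cplus (f z) (g z)) x c e = vint f x c e + vint g x c e).
  { intros x Hf Hg; unfold vint; simpl.
    apply (RInt_plus (V := R_CompleteNormedModule)); apply ex_RInt_cont; auto;
      intros; apply cont_snd_ver; auto. }
  unfold rect; rewrite !Hh, !Hv; try (intros; now apply F1 || now apply F2 || now apply G1 || now apply G2).
  ring.
Qed.

Lemma rect_scal a b c e (r : R) f : a <= b -> c <= e -> on_rect a b c e (lipC f) ->
  rect a b c e (fun z => Cmult (RtoC r) (f z)) = r * rect a b c e f.
Proof.
  intros Hab Hce [F1 F2].
  assert (Hh : forall y, (forall x, a <= x <= b -> lipC f (x, y)) ->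
     hint (fun z => Cmult (RtoC r) (f z)) y a b = r * hint f y a b).
  { intros y Hf; unfold hint.
    rewrite (RInt_ext _ (fun x => scal r (fst (f (x, y)))))
      by (intros; unfold scal; simpl; unfold mult; simpl; ring).
    apply (RInt_scal (V := R_CompleteNormedModule)); apply ex_RInt_cont; auto;
      intros; apply cont_fst_hor; auto. }
  assert (Hv : forall x, (forall y, c <= y <= e -> lipC f (x, y)) ->
     vint (fun z => Cmult (RtoC r) (f z)) x c e = r * vint f x c e).
  { intros x Hf; unfold vint.
    rewrite (RInt_ext _ (fun y => scal r (snd (f (x, y)))))
      by (intros; unfold scal; simpl; unfold mult; simpl; ring).
    apply (RInt_scal (V := R_CompleteNormedModule)); apply ex_RInt_cont; auto;
      intros; apply cont_snd_ver; auto. }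
  unfold rect; rewrite !Hh, !Hv; try (intros; now apply F1 || now apply F2).
  ring.
Qed.

Lemma rect_ext a b c e f g : a <= b -> c <= e -> on_rect a b c e (fun z => f z = g z) ->
  rect a b c e f = rect a b c e g.
Proof.
  intros Hab Hce [H1 H2]; unfold rect, hint, vint.
  rewrite (RInt_ext (fun x => fst (f (x, c))) (fun x => fst (g (x, c)))),
    (RInt_ext (fun x => fst (f (x, e))) (fun x => fst (g (x, e)))),
    (RInt_ext (fun x => snd (f (a, x))) (fun x => snd (g (a, x)))),
    (RInt_ext (fun x => snd (f (b, x))) (fun x => snd (g (b, x)))); [easy | | | |];
  rewrite Rmin_left, Rmax_right by easy; intros t Ht; f_equal;
  (apply H1 || apply H2); lra.
Qed.

Definition rect_abs (a b c e : R) (f : C -> C) : R :=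
  RInt (fun x => Cmod (f (x, c))) a b + RInt (fun x => Cmod (f (x, e))) a b +
  RInt (fun y => Cmod (f (b, y))) c e + RInt (fun y => Cmod (f (a, y))) c e.

Lemma rect_abs_nonneg a b c e f : a <= b -> c <= e -> on_rect a b c e (lipC f) ->
  0 <= rect_abs a b c e f.
Proof.
  intros Hab Hce [F1 F2].
  assert (Hh : forall y, (forall x, a <= x <= b -> lipC f (x, y)) ->
    0 <= RInt (fun x => Cmod (f (x, y))) a b).
  { intros y Hf; apply RInt_ge_0; [easy | | intros; apply Cmod_ge_0].
    apply ex_RInt_cont; auto; intros; apply cont_Cmod_hor; auto. }
  assert (Hv : forall x, (forall y, c <= y <= e -> lipC f (x, y)) ->
    0 <= RInt (fun y => Cmod (f (x, y))) c e).
  { intros x Hf; apply RInt_ge_0; [easy | | intros; apply Cmod_ge_0].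
    apply ex_RInt_cont; auto; intros; apply cont_Cmod_ver; auto. }
  unfold rect_abs; repeat apply Rplus_le_le_0_compat; (apply Hh || apply Hv); intros;
    now apply F1 || now apply F2.
Qed.

Lemma RInt_abs_le phi psi a b : a <= b -> ex_RInt phi a b -> ex_RInt psi a b ->
  (forall x, a <= x <= b -> Rabs (phi x) <= psi x) -> Rabs (RInt phi a b) <= RInt psi a b.
Proof.
  intros Hab H1 H2 H.
  apply (norm_RInt_le (V := R_NormedModule) phi psi a b); auto;
    now apply (RInt_correct (V := R_CompleteNormedModule)).
Qed.

Lemma RInt_scal_R k phi a b : ex_RInt phi a b -> RInt (fun x => k * phi x) a b = k * RInt phi a b.
Proof. apply (RInt_scal (V := R_CompleteNormedModule)). Qed.

Lemma ex_RInt_scal_R k (phi : R -> R) a b : ex_RInt phi a b -> ex_RInt (fun x => k * phi x) a b.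
Proof. apply (ex_RInt_scal (V := R_NormedModule)). Qed.

Lemma rect_abs_bound a b c e f g M : a <= b -> c <= e ->
  on_rect a b c e (lipC f) -> on_rect a b c e (lipC g) ->
  on_rect a b c e (fun z => Cmod (f z) <= M * Cmod (g z)) ->
  Rabs (rect a b c e f) <= M * rect_abs a b c e g.
Proof.
  intros Hab Hce [F1 F2] [G1 G2] [H1 H2].
  assert (Hh : forall y, (forall x, a <= x <= b -> lipC f (x, y) /\ lipC g (x, y) /\
      Cmod (f (x, y)) <= M * Cmod (g (x, y))) ->
     Rabs (hint f y a b) <= M * RInt (fun x => Cmod (g (x, y))) a b).
  { intros y Hf; unfold hint.
    assert (ex_RInt (fun x => Cmod (g (x, y))) a b).
    { apply ex_RInt_cont; auto; intros; apply cont_Cmod_hor; now apply Hf. }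
    rewrite <- RInt_scal_R by easy.
    apply RInt_abs_le; [easy | | now apply ex_RInt_scal_R |].
    - apply ex_RInt_cont; auto; intros; apply cont_fst_hor; now apply Hf.
    - intros x Hx; eapply Rle_trans; [apply fst_le_Cmod | now apply Hf]. }
  assert (Hv : forall x, (forall y, c <= y <= e -> lipC f (x, y) /\ lipC g (x, y) /\
      Cmod (f (x, y)) <= M * Cmod (g (x, y))) ->
     Rabs (vint f x c e) <= M * RInt (fun y => Cmod (g (x, y))) c e).
  { intros x Hf; unfold vint.
    assert (ex_RInt (fun y => Cmod (g (x, y))) c e).
    { apply ex_RInt_cont; auto; intros; apply cont_Cmod_ver; now apply Hf. }
    rewrite <- RInt_scal_R by easy.
    apply RInt_abs_le; [easy | | now apply ex_RInt_scal_R |].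
    - apply ex_RInt_cont; auto; intros; apply cont_snd_ver; now apply Hf.
    - intros y Hy; eapply Rle_trans; [apply snd_le_Cmod | now apply Hf]. }
  assert (A1 := Hh c ltac:(intros x Hx; repeat split; [apply F1 | apply G1 | apply H1]; easy)).
  assert (A2 := Hh e ltac:(intros x Hx; repeat split; [apply F1 | apply G1 | apply H1]; easy)).
  assert (A3 := Hv a ltac:(intros x Hx; repeat split; [apply F2 | apply G2 | apply H2]; easy)).
  assert (A4 := Hv b ltac:(intros x Hx; repeat split; [apply F2 | apply G2 | apply H2]; easy)).
  unfold rect, rect_abs.
  apply Rabs_le_between in A1, A2, A3, A4; apply Rabs_le; lra.
Qed.

Lemma RInt_split3 (phi : R -> R) a b c d : a <= b -> b <= c -> c <= d ->
  (forall x, a <= x <= d -> continuous phi x) ->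
  RInt phi a d = RInt phi a b + RInt phi b c + RInt phi c d.
Proof.
  intros H1 H2 H3 H.
  assert (X : forall u v, a <= u -> u <= v -> v <= d -> ex_RInt phi u v)
    by (intros; apply ex_RInt_cont; auto; intros; apply H; lra).
  rewrite <- (RInt_Chasles (V := R_CompleteNormedModule) phi a c d),
    <- (RInt_Chasles (V := R_CompleteNormedModule) phi a b c) by (apply X; lra).
  reflexivity.
Qed.

(* Cut [-L,L]^2 minus [-k,k] x [-s,s] into the bands above and below and the
   two rectangles on the sides. *)
Lemma rect_annulus f d L k s eta : 0 < s < L -> 0 < k < L -> 0 < eta -> eta < s -> eta < k ->
  (forall x y, (y <> 0 \/ k - eta < Rabs x) -> holC f d (x, y) /\ lipC d (x, y)) ->
  rect (- L) L (- L) L f = rect (- k) k (- s) s f.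
Proof.
  intros Hs Hk Heta Hes Hek H.
  assert (U : rect (- L) L s L f = 0).
  { apply (rect_cauchy f d _ _ _ _ eta); try lra; intros x y Hx Hy; apply H; left; lra. }
  assert (D : rect (- L) L (- L) (- s) f = 0).
  { apply (rect_cauchy f d _ _ _ _ eta); try lra; intros x y Hx Hy; apply H; left; lra. }
  assert (A : rect (- L) (- k) (- s) s f = 0).
  { apply (rect_cauchy f d _ _ _ _ eta); try lra; intros x y Hx Hy; apply H; right.
    rewrite Rabs_left1; lra. }
  assert (B : rect k L (- s) s f = 0).
  { apply (rect_cauchy f d _ _ _ _ eta); try lra; intros x y Hx Hy; apply H; right.
    rewrite Rabs_pos_eq; lra. }
  assert (Sh : forall y, y <> 0 ->
    hint f y (- L) L = hint f y (- L) (- k) + hint f y (- k) k + hint f y k L).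
  { intros y Hy; apply RInt_split3; try lra; intros x Hx.
    apply cont_fst_hor, (holC_lipC _ d), H; now left. }
  assert (Sv : forall x, k - eta < Rabs x ->
    vint f x (- L) L = vint f x (- L) (- s) + vint f x (- s) s + vint f x s L).
  { intros x Hx; apply RInt_split3; try lra; intros y Hy.
    apply cont_snd_ver, (holC_lipC _ d), H; now right. }
  unfold rect in *.
  rewrite (Sv L) by (rewrite Rabs_pos_eq; lra).
  rewrite (Sv (- L)) by (rewrite Rabs_left1; lra).
  rewrite (Sh s), (Sh (- s)) in * by lra; lra.
Qed.

Lemma rect_entire f a b c e : entire f -> a <= b -> c <= e -> rect a b c e f = 0.
Proof. intros [d H] Hab Hce; apply (rect_cauchy f d a b c e 1); auto; lra. Qed.

Lemma is_RInt_atan L : 0 < L -> is_RInt (fun x => L / (x ^ 2 + L ^ 2)) (- L) L (PI / 2).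
Proof.
  intros HL.
  replace (PI / 2) with (minus (atan (L / L)) (atan (- L / L))).
  - apply (is_RInt_derive (fun x => atan (x / L))); intros x _.
    + auto_derive; [easy |]. field; split; nra.
    + apply (ex_derive_continuous (V := R_NormedModule)); auto_derive.
      pose proof (pow2_ge_0 x); simpl in *; nra.
  - replace (- L / L) with (- (1)) by (field; lra).
    replace (L / L) with 1 by (field; lra).
    rewrite atan_opp, atan_1; unfold minus, plus, opp; simpl; field.
Qed.

(** The residue at 0. On a centred square each pair of opposite sides reduces to the same arctangent
    integral and contributes [- PI * snd kap]. *)
Lemma rect_inverse kap L : 0 < L ->
  rect (- L) L (- L) L (fun z => Cmult kap (Cinv z)) = - (2 * PI) * snd kap.
Proof.
  intros HL; destruct kap as [k1 k2]; unfold rect, hint, vint; simpl snd at 3.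
  assert (I1 := is_RInt_atan L HL).
  assert (P : forall x, 0 < x * x + L * L) by (intros; nra).
  assert (X : forall (u v : R) (den : R -> R) , (forall x, den x = x * x + L * L) ->
    ex_RInt (fun x => (u * x + v) / den x) (- L) L).
  { intros u v den Hden; apply ex_RInt_cont; [lra |]; intros x _.
    apply (continuous_ext (fun x => (u * x + v) / (x * x + L * L))).
    { intros; now rewrite Hden. }
    apply (ex_derive_continuous (V := R_NormedModule)); auto_derive.
    specialize (P x); lra. }
  assert (E : forall phi psi : R -> R, ex_RInt phi (- L) L -> ex_RInt psi (- L) L ->
     (forall x, phi x - psi x = -2 * k2 * (L / (x ^ 2 + L ^ 2))) ->
     RInt phi (- L) L - RInt psi (- L) L = -2 * k2 * (PI / 2)).
  { intros phi psi H1 H2 H3.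
    rewrite <- (RInt_minus (V := R_CompleteNormedModule) phi psi) by easy.
    apply is_RInt_unique.
    apply (is_RInt_ext (fun x => scal (-2 * k2) (L / (x ^ 2 + L ^ 2)))).
    - intros x _; unfold minus, plus, opp, scal; simpl; unfold mult; simpl.
      specialize (H3 x); simpl in H3; lra.
    - apply (is_RInt_scal (V := R_NormedModule)), I1. }
  rewrite E.
  - match goal with |- ?a - ?b + ?c = _ => assert (H : b - c = -2 * (- k2) * (PI / 2)) end.
    { replace (-2 * - k2 * (PI / 2)) with (- (-2 * k2 * (PI / 2))) by ring.
      rewrite <- (E (fun y => snd (Cmult (k1, k2) (Cinv (- L, y)))) (fun y => snd (Cmult (k1, k2) (Cinv (L, y))))).
      - ring.
      - apply (ex_RInt_ext (fun x => ((- k1) * x + (- L * k2)) / (x * x + L * L)));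
          [| now apply X]; intros x _; simpl; specialize (P x); field; nra.
      - apply (ex_RInt_ext (fun x => ((- k1) * x + (L * k2)) / (x * x + L * L)));
          [| now apply X]; intros x _; simpl; specialize (P x); field; nra.
      - intros x; simpl; specialize (P x); field; nra. }
    lra.
  - apply (ex_RInt_ext (fun x => (k1 * x + (- L * k2)) / (x * x + L * L)));
      [| now apply X]; intros x _; simpl; specialize (P x); field; nra.
  - apply (ex_RInt_ext (fun x => (k1 * x + (L * k2)) / (x * x + L * L)));
      [| now apply X]; intros x _; simpl; specialize (P x); field; nra.
  - intros x; simpl; specialize (P x); field; nra.
Qed.

Lemma lipC_inv z : z <> RtoC 0 -> lipC Cinv z.
Proof.
  intros Hz0; assert (P : 0 < Cmod z) by now apply Cmod_gt_0.
  exists (2 / Cmod z ^ 2), (Cmod z / 2).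
  split; [left; apply Rdiv_lt_0_compat; [lra | now apply pow_lt] | split; [lra |]].
  intros w Hw.
  assert (Hlow : Cmod z / 2 <= Cmod w).
  { pose proof (Cmod_diff w z) as H; apply Rabs_le_between in H; lra. }
  assert (Hw0 : w <> RtoC 0) by (apply Cmod_gt_0; lra).
  replace (Cminus (Cinv w) (Cinv z)) with (Cmult (Cmult (RtoC (-1)) (Cminus w z)) (Cinv (Cmult w z)))
    by (field; split; assumption).
  rewrite Cmod_mult, Cmod_neg1, Cmod_inv, Cmod_mult by now apply Cmult_neq_0.
  rewrite Rmult_comm.
  apply Rmult_le_compat_r; [apply Cmod_ge_0 |].
  replace (2 / Cmod z ^ 2) with (/ (Cmod z / 2 * Cmod z)) by (field; lra).
  apply Rinv_le_contravar; [nra |]; apply Rmult_le_compat_r; lra.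
Qed.

Lemma on_rect_imp a b c e (P Q : C -> Prop) :
  (forall z, P z -> Q z) -> on_rect a b c e P -> on_rect a b c e Q.
Proof. intros H [H1 H2]; split; intros t Ht; [destruct (H1 t Ht) | destruct (H2 t Ht)]; auto. Qed.

Lemma on_rect_and a b c e (P Q : C -> Prop) :
  on_rect a b c e P -> on_rect a b c e Q -> on_rect a b c e (fun z => P z /\ Q z).
Proof. intros [H1 H2] [H3 H4]; split; intros t Ht; firstorder. Qed.

Lemma on_rect_all a b c e (P : C -> Prop) : (forall z, P z) -> on_rect a b c e P.
Proof. split; auto. Qed.

Lemma Hop_from_Hz V z u psi : (forall n, Hz V z u n = psi n) ->
  forall n, Cmult z (u n) = Cminus (Hop V u n) (psi n).
Proof. intros H n; rewrite <- H; unfold Hz; ring. Qed.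

(** * Moments of the Green function over the contour *)

Section contour.
Variables (V : Z -> R) (Bv K : R).
Hypothesis HV : bounded_by V Bv.
Hypothesis HK : 1 < K.
Hypothesis Hreg : forall z, snd z <> 0 \/ K - 1 < Rabs (fst z) -> regular V z.

(** Used with [k = K - 1]: an open set of regular points that contains the contour through [K] and
    [- K]. *)
Definition outside (k : R) (z : C) : Prop := snd z <> 0 \/ k < Rabs (fst z).

Lemma outside_open k z : outside k z ->
  exists r, 0 < r /\ forall w, Cmod (Cminus w z) < r -> outside k w.
Proof.
  intros [H | H].
  - exists (Rabs (snd z)); split; [now apply Rabs_pos_lt |].
    intros w Hw; left; intros E.
    pose proof (snd_le_Cmod (Cminus w z)) as P; simpl in P.
    rewrite E, Rplus_0_l, Rabs_Ropp in P; lra.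
  - exists (Rabs (fst z) - k); split; [lra |].
    intros w Hw; right.
    pose proof (fst_le_Cmod (Cminus w z)) as P; simpl in P.
    pose proof (Rabs_triang_inv (fst z) (fst w)).
    rewrite Rabs_minus_sym in H0; unfold Rminus in *; lra.
Qed.

Lemma green_holC z n : outside (K - 1) z ->
  holC (fun w => green V w n) (fun w => green' V w n) z /\ lipC (fun w => green' V w n) z.
Proof. intros H; now apply (green_hol V (outside (K - 1))), outside_open. Qed.

Lemma green_lipC z n : outside (K - 1) z -> lipC (fun w => green V w n) z.
Proof. intros H; destruct (green_holC z n H); eapply holC_lipC; eassumption. Qed.

(** One has [z * green + delta_1 = H green], and [green] is of order [1 / |z|]. Hence [green] equals
    [- delta_1 / z] up to an error of order [1 / |z| ^ 2]. *)
Lemma green_far z n : outside (K - 1) z -> 4 * (8 + 2 * Bv ^ 2) <= Cmod z ^ 2 ->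
  Cmod (Cmult z (Cplus (green V z n) (Cmult (dlt 1 n) (Cinv z)))) ^ 2
    <= (8 + 2 * Bv ^ 2) * (4 / Cmod z ^ 2).
Proof.
  intros Ho Hz0; destruct (green_spec V z (proj2 (Hreg z Ho))) as [L E].
  pose proof (pow2_ge_0 Bv).
  assert (Hz1 : z <> RtoC 0).
  { intros ->; rewrite Cmod_0 in Hz0; simpl in Hz0; nra. }
  replace (Cmult z (Cplus (green V z n) (Cmult (dlt 1 n) (Cinv z))))
    with (Hop V (green V z) n).
  - apply (bdd_term (Hop V (green V z))), bdd_Hop; [easy |].
    replace 4 with (4 * 1) by ring; apply (bdd_far V Bv); try easy.
    apply (bdd_ext (dlt 1)); [intros; now rewrite E | apply bdd_dlt].
  - replace (Cmult z (Cplus (green V z n) (Cmult (dlt 1 n) (Cinv z))))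
      with (Cplus (Cmult z (green V z n)) (dlt 1 n)) by (field; easy).
    rewrite (Hop_from_Hz V z _ _ E); ring.
Qed.

Lemma on_big_rect L : 0 < L -> on_rect (- L) L (- L) L (fun z => L <= Rabs (fst z) \/ L <= Rabs (snd z)).
Proof.
  intros HL; split; intros t Ht; split; simpl;
  try rewrite (Rabs_pos_eq L) by lra; try rewrite (Rabs_left1 (- L)) by lra; lra.
Qed.

(** The contour is pushed out to a square of half-width [L], where [green] is replaced by
    [- delta_1 / z]. The error of order [1 / L ^ 2] on a perimeter [8 * L] vanishes as [L] grows,
    while the integral does not depend on [L]. *)
Lemma rect_green_0 s kap n : 0 < s <= 1 ->
  rect (- K) K (- s) s (fun z => Cmult kap (green V z n)) = 2 * PI * snd kap * delta 1 n.
Proof.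
  intros Hs.
  pose proof (pow2_ge_0 Bv) as HB2; set (C1 := 8 + 2 * Bv ^ 2) in *.
  assert (HC1 : 8 <= C1) by (unfold C1; lra).
  pose (A := Cmod kap * sqrt (C1 * 4) * 8).
  assert (HA : 0 <= A).
  { unfold A; pose proof (Cmod_ge_0 kap); pose proof (sqrt_pos (C1 * 4)).
    apply Rmult_le_pos; [apply Rmult_le_pos; easy | lra]. }
  assert (main : forall L, K < L -> 4 * C1 < L ->
    Rabs (rect (- K) K (- s) s (fun z => Cmult kap (green V z n)) - 2 * PI * snd kap * delta 1 n) <= A / L).
  { intros L HL1 HL2.
    assert (HL : 1 < L) by lra.
    (* The margin [s / 2] is at most one half, so [K - s / 2] stays beyond [K - 1]. *)
    rewrite <- (rect_annulus _ (fun w => Cplus (Cmult (RtoC 0) (green V w n)) (Cmult kap (green' V w n))) L K s (s / 2));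
      try lra.
    2: { intros x y Hxy.
      assert (Ho : outside (K - 1) (x, y)) by (destruct Hxy; [left | right]; simpl; lra).
      destruct (green_holC (x, y) n Ho) as [H1 H2]; split.
      - apply (holC_mult (fun _ => kap) (fun _ => RtoC 0)); [apply holC_const | easy].
      - apply lipC_plus; (apply lipC_mult; [apply lipC_const |]); [| easy].
        now apply (holC_lipC _ (fun w => green' V w n)). }
    assert (big : on_rect (- L) L (- L) L (fun z => outside (K - 1) z /\ L <= Cmod z)).
    { apply (on_rect_imp _ _ _ _ (fun z => L <= Rabs (fst z) \/ L <= Rabs (snd z)));
        [| apply on_big_rect; lra].
      intros z [H | H]; split.
      - right; lra.
      - eapply Rle_trans; [exact H | apply fst_le_Cmod].
      - left; intros E; rewrite E, Rabs_R0 in H; lra.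
      - eapply Rle_trans; [exact H | apply snd_le_Cmod]. }
    pose (r := fun z => Cmult kap (Cplus (green V z n) (Cmult (dlt 1 n) (Cinv z)))).
    assert (Lr : on_rect (- L) L (- L) L (lipC r)).
    { revert big; apply on_rect_imp; intros z [Ho Hz].
      assert (z <> RtoC 0) by (apply Cmod_gt_0; lra).
      apply lipC_mult; [apply lipC_const |]; apply lipC_plus; [now apply green_lipC |].
      apply lipC_mult; [apply lipC_const | now apply lipC_inv]. }
    assert (Li : on_rect (- L) L (- L) L (lipC (fun z => Cmult kap (Cinv z)))).
    { revert big; apply on_rect_imp; intros z [Ho Hz].
      assert (z <> RtoC 0) by (apply Cmod_gt_0; lra).
      apply lipC_mult; [apply lipC_const | now apply lipC_inv]. }
    rewrite (rect_ext _ _ _ _ _ (fun z => Cplus (r z) (Cmult (RtoC (- delta 1 n)) (Cmult kap (Cinv z))))); try lra.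
    2: { apply on_rect_all; intros z; unfold r, dlt; rewrite RtoC_opp; ring. }
    rewrite rect_plus, rect_scal, rect_inverse; try lra; auto.
    2: { revert Li; apply on_rect_imp; intros z H; apply lipC_mult; [apply lipC_const | exact H]. }
    replace (_ + _ - _) with (rect (- L) L (- L) L r) by ring.
    assert (B := rect_abs_bound (- L) L (- L) L r (fun _ => RtoC 1) (Cmod kap * sqrt (C1 * 4) / L ^ 2)
      ltac:(lra) ltac:(lra) Lr ltac:(apply on_rect_all; intros; apply lipC_const)).
    eapply Rle_trans; [apply B |].
    - revert big; apply on_rect_imp; intros z [Ho Hz].
      assert (z0 : z <> RtoC 0) by (apply Cmod_gt_0; lra).
      assert (P : 0 < Cmod z) by lra.
      unfold r; rewrite Cmod_mult, ?Cmod_1, Rmult_1_r.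
      unfold Rdiv; rewrite Rmult_assoc; apply Rmult_le_compat_l; [apply Cmod_ge_0 |].
      assert (Pz : 4 * C1 <= Cmod z ^ 2).
      { simpl; rewrite Rmult_1_r; apply Rle_trans with (1 * Cmod z); [lra |].
        apply Rmult_le_compat_r; lra. }
      assert (G := green_far z n Ho Pz); fold C1 in G.
      rewrite Cmod_mult, Rpow_mult_distr in G.
      apply pow2_le_inv.
      { apply Rmult_le_pos; [apply sqrt_pos | left; apply Rinv_0_lt_compat, pow_lt; lra]. }
      rewrite Rpow_mult_distr, pow2_sqrt by lra.
      apply Rmult_le_reg_l with (Cmod z ^ 2); [now apply pow_lt |].
      apply Rle_trans with (1 := G).
      apply Rmult_le_reg_l with (Cmod z ^ 2 * L ^ 4); [apply Rmult_lt_0_compat; apply pow_lt; lra |].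
      replace (Cmod z ^ 2 * L ^ 4 * (C1 * (4 / Cmod z ^ 2))) with (4 * C1 * L ^ 4) by (field; lra).
      replace (Cmod z ^ 2 * L ^ 4 * (Cmod z ^ 2 * (C1 * 4 * (/ L ^ 2) ^ 2)))
        with (4 * C1 * Cmod z ^ 4) by (field; lra).
      apply Rmult_le_compat_l; [lra | apply pow_incr; lra].
    - unfold rect_abs; rewrite Cmod_1, !RInt_const; unfold scal, A; simpl; unfold mult; simpl.
      right; field; lra. }
  set (x := rect _ _ _ _ _ - _) in main.
  enough (x = 0) by (unfold x in *; lra).
  destruct (Req_dec x 0) as [| Hx]; [easy | exfalso].
  assert (Px := Rabs_pos_lt _ Hx).
  (* The last summand makes [A < Rabs x * L], which contradicts [main]. *)
  pose (L := K + 4 * C1 + 1 + A / Rabs x).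
  assert (0 <= A / Rabs x) by (apply Rmult_le_pos; [easy | left; now apply Rinv_0_lt_compat]).
  specialize (main L ltac:(unfold L; lra) ltac:(unfold L; lra)).
  assert (HL : 0 < L) by (unfold L; lra).
  apply (Rmult_le_compat_r L) in main; [| lra].
  replace (A / L * L) with A in main by (field; lra).
  assert (A < Rabs x * L).
  { unfold L; replace (Rabs x * (K + 4 * C1 + 1 + A / Rabs x))
      with (Rabs x * (K + 4 * C1 + 1) + A) by (field; lra); nra. }
  lra.
Qed.

Lemma on_small_rect s : 0 < s -> on_rect (- K) K (- s) s (outside (K - 1)).
Proof.
  intros Hs; split; intros t Ht; split; unfold outside; simpl.
  - left; lra.
  - left; lra.
  - right; rewrite Rabs_left1; lra.
  - right; rewrite Rabs_pos_eq; lra.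
Qed.

(** From [z * green = H green - delta_1]: each factor [z] turns into an application of [H], and the
    [delta_1] term leaves a polynomial in [z], whose integral vanishes. *)
Lemma rect_green_pow s k : 0 < s <= 1 -> forall kap n,
  rect (- K) K (- s) s (fun z => Cmult (Cmult kap (Cpow z k)) (green V z n))
  = 2 * PI * snd kap * Hpow V k n.
Proof.
  intros Hs; induction k; intros kap n.
  - simpl Hpow; rewrite <- (rect_green_0 s) by easy.
    apply rect_ext; try lra; apply on_rect_all; intros z; cbn beta; change (Cpow z 0) with (RtoC 1); now rewrite Cmult_1_r.
  - assert (Hsm := on_small_rect s ltac:(lra)).
    assert (Lp : forall m, on_rect (- K) K (- s) s (lipC (fun z => Cmult (Cmult kap (Cpow z k)) (green V z m)))).
    { intros m; revert Hsm; apply on_rect_imp; intros z Ho.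
      apply lipC_mult; [| now apply green_lipC].
      apply lipC_mult; [apply lipC_const | apply lipC_pow]. }
    assert (Lz : on_rect (- K) K (- s) s (lipC (fun z => Cmult kap (Cpow z k)))).
    { apply on_rect_all; intros z; apply lipC_mult; [apply lipC_const | apply lipC_pow]. }
    assert (Ls : forall (c : R) f, on_rect (- K) K (- s) s (lipC f) -> on_rect (- K) K (- s) s (lipC (fun z => Cmult (RtoC c) (f z)))).
    { intros c f; apply on_rect_imp; intros; apply lipC_mult; [apply lipC_const | easy]. }
    assert (La : forall f g, on_rect (- K) K (- s) s (lipC f) -> on_rect (- K) K (- s) s (lipC g) ->
      on_rect (- K) K (- s) s (lipC (fun z => Cplus (f z) (g z)))).
    { intros f g H1 H2; generalize (on_rect_and _ _ _ _ _ _ H1 H2); apply on_rect_imp.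
      intros z [A B]; now apply lipC_plus. }
    pose (F := fun m z => Cmult (Cmult kap (Cpow z k)) (green V z m)).
    assert (LF : forall m, on_rect (- K) K (- s) s (lipC (F m))) by exact Lp.
    assert (LV := Ls (V n) _ (LF n)).
    assert (L2 := La _ _ (LF (n + 1)%Z) (LF (n - 1)%Z)).
    assert (L3 := La _ _ L2 LV).
    assert (L4 := Ls (- delta 1 n) _ Lz).
    rewrite (rect_ext _ _ _ _ _ (fun z =>
      Cplus (Cplus (Cplus (F (n + 1)%Z z) (F (n - 1)%Z z)) (Cmult (RtoC (V n)) (F n z)))
        (Cmult (RtoC (- delta 1 n)) (Cmult kap (Cpow z k))))); try lra.
    + rewrite !rect_plus, !rect_scal, (rect_entire (fun z => Cmult kap (Cpow z k))); try lra; auto.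
      * unfold F; rewrite !IHk; simpl Hpow; unfold Hr; ring.
      * apply entire_monomial.
    + revert Hsm; apply on_rect_imp; intros z Ho.
      destruct (green_spec V z (proj2 (Hreg z Ho))) as [_ E].
      assert (E' := Hop_from_Hz _ _ _ _ E n); unfold Hop, dlt in E'.
      unfold F; rewrite RtoC_opp; cbn beta; rewrite Cpow_S.
      transitivity (Cmult (Cmult kap (Cpow z k)) (Cmult z (green V z n))); [ring |].
      rewrite E'; ring.
Qed.

End contour.

(** * Partial sums of the exponential and the Dunford representation *)

(** The Taylor polynomial of [exp (s * w)]. As a polynomial in [w] it can be integrated against
    [green] by [rect_green_pow]; [s] is a separate argument because [esum_bound] differentiates in
    it. *)
Fixpoint esum (w : C) (s : R) (M : nat) : C :=
  match M with
  | O => RtoC 1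
  | S k => Cplus (esum w s k) (Cmult (RtoC (s ^ S k / INR (fact (S k)))) (Cpow w (S k)))
  end.

Definition eterm (w : C) (s : R) (k : nat) : C :=
  Cmult (RtoC (s ^ k / INR (fact k))) (Cpow w k).

Lemma esum_S w s k : esum w s (S k) = Cplus (esum w s k) (eterm w s (S k)).
Proof. reflexivity. Qed.

Lemma INR_fact_pos k : 0 < INR (fact k).
Proof. apply lt_0_INR, lt_O_fact. Qed.

Lemma exp_mono x y : x <= y -> exp x <= exp y.
Proof. intros [H | ->]; [left; now apply exp_increasing | lra]. Qed.

Lemma pow_fact_nonneg x k : 0 <= x -> 0 <= x ^ k / INR (fact k).
Proof.
  intros Hx; apply Rmult_le_pos; [now apply pow_le | left; apply Rinv_0_lt_compat, INR_fact_pos].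
Qed.

Lemma derive_pow_fact k s :
  is_derive (fun s => s ^ S k / INR (fact (S k))) s (s ^ k / INR (fact k)).
Proof.
  assert (P := INR_fact_pos k).
  replace (s ^ k / INR (fact k)) with (/ INR (fact (S k)) * (INR (S k) * 1 * s ^ k)).
  - apply (is_derive_ext (fun s => / INR (fact (S k)) * s ^ S k)).
    + intros t; apply Rmult_comm.
    + apply is_derive_scal; apply (is_derive_pow (fun s => s) (S k) s 1), (@is_derive_id R_AbsRing).
  - rewrite fact_simpl, mult_INR; field; split; [lra | apply not_0_INR; lia].
Qed.

Lemma derive_eterm w k s (p : C -> R) : (forall (r : R) z, p (Cmult (RtoC r) z) = r * p z) ->
  is_derive (fun s => p (eterm w s (S k))) s (p (Cmult w (eterm w s k))).
Proof.
  intros Hp; unfold eterm.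
  apply (is_derive_ext (fun s => p (Cpow w (S k)) * (s ^ S k / INR (fact (S k))))).
  - intros t; rewrite Hp; apply Rmult_comm.
  - replace (p (Cmult w (Cmult (RtoC (s ^ k / INR (fact k))) (Cpow w k)))) with (p (Cpow w (S k)) * (s ^ k / INR (fact k))).
    + apply is_derive_scal, derive_pow_fact.
    + rewrite Rmult_comm, <- Hp; f_equal; rewrite Cpow_S; ring.
Qed.

Lemma derive_esum w M (p : C -> R) :
  (forall (r : R) z, p (Cmult (RtoC r) z) = r * p z) ->
  (forall y z, p (Cplus y z) = p y + p z) -> forall s,
  is_derive (fun s => p (esum w s M)) s (p (Cmult w (Cminus (esum w s M) (eterm w s M)))).
Proof.
  intros Hp Hq s; induction M.
  - replace (Cmult w _) with (Cmult (RtoC 0) w).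
    + rewrite Hp, Rmult_0_l; simpl esum; apply @is_derive_const.
    + unfold eterm; simpl esum; simpl Cpow; replace (s ^ 0 / INR (fact 0)) with 1
        by (simpl; field); ring.
  - replace (Cmult w (Cminus (esum w s (S M)) (eterm w s (S M))))
      with (Cplus (Cmult w (Cminus (esum w s M) (eterm w s M))) (Cmult w (eterm w s M)))
      by (rewrite esum_S; ring).
    rewrite Hq.
    apply (is_derive_ext (fun s => p (esum w s M) + p (eterm w s (S M)))).
    + intros t; now rewrite esum_S, Hq.
    + apply (is_derive_plus (V := R_NormedModule)); [easy | now apply derive_eterm].
Qed.

Lemma Cmod_eterm w s k : 0 <= s -> Cmod (eterm w s k) = (s * Cmod w) ^ k / INR (fact k).
Proof.
  intros Hs; unfold eterm; rewrite Cmod_mult, Cmod_R, Cmod_pow, Rabs_pos_eq, Rpow_mult_distr.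
  - unfold Rdiv; ring.
  - now apply pow_fact_nonneg.
Qed.

Lemma Cmod_esum w s M : 0 <= s -> Cmod (esum w s M) <= exp (s * Cmod w).
Proof.
  intros Hs.
  apply Rle_trans with (sum_f_R0 (fun k => (s * Cmod w) ^ k / INR (fact k)) M).
  - induction M.
    + simpl; rewrite Cmod_1; lra.
    + rewrite esum_S, tech5; eapply Rle_trans; [apply Cmod_triangle |].
      rewrite Cmod_eterm by easy; lra.
  - apply exp_ge_taylor, Rmult_le_pos; [easy | apply Cmod_ge_0].
Qed.

Definition erem (x : R) (M : nat) : R := 2 * exp (3 * x) * x * (x ^ M / INR (fact M)).

(** With [w = - i z] the bound [exp (t * |w|)] is too weak, since [|z|] is not small on the contour
    while [Re w = Im z] is. For the full exponential [|E(s)| ^ 2 * exp (- 2 * s * Re w)] is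
    constantly 1. For the Taylor polynomial its derivative contains only the top term, and the mean
    value theorem gives the correction [erem], which tends to 0 with the degree. *)
Lemma esum_bound w t M : 0 <= t ->
  Cmod (esum w t M) ^ 2 <= exp (2 * fst w * t) * (1 + erem (t * Cmod w) M).
Proof.
  intros Ht; pose proof (Cmod_ge_0 w) as Pw.
  pose (X := fun s => fst (esum w s M) ^ 2 + snd (esum w s M) ^ 2).
  pose (Y := fun s => X s * exp (- (2 * fst w) * s)).
  pose (dE := fun s => Cmult w (Cminus (esum w s M) (eterm w s M))).
  pose (dY := fun s => - 2 * exp (- (2 * fst w) * s) *
     fst (Cmult (Cconj (esum w s M)) (Cmult w (eterm w s M)))).
  assert (HY : forall s, is_derive Y s (dY s)).
  { intros s; unfold Y, X.
    assert (D1 := derive_esum w M fst ltac:(intros; simpl; ring) ltac:(easy) s).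
    assert (D2 := derive_esum w M snd ltac:(intros; simpl; ring) ltac:(easy) s).
    evar_last.
    - apply (is_derive_mult (fun s => fst (esum w s M) ^ 2 + snd (esum w s M) ^ 2)
        (fun s => exp (- (2 * fst w) * s))).
      + apply (is_derive_plus (V := R_NormedModule)).
        * apply is_derive_pow, D1.
        * apply is_derive_pow, D2.
      + apply (is_derive_comp exp).
        * apply is_derive_exp.
        * apply is_derive_scal, (@is_derive_id R_AbsRing).
      + intros; apply Rmult_comm.
    - unfold dY; destruct (esum w s M) as [e1 e2], (eterm w s M) as [t1 t2], w as [a b].
      unfold plus, scal, mult, one; simpl; unfold mult; simpl; ring. }
  assert (HdY : forall s, 0 <= s <= t -> Rabs (dY s) * t <= erem (t * Cmod w) M).
  { intros s Hs; unfold dY, erem.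
    set (x := t * Cmod w).
    assert (Hx : 0 <= x) by now apply Rmult_le_pos.
    assert (Hsx : s * Cmod w <= x) by (apply Rmult_le_compat_r; lra).
    assert (Hsx0 : 0 <= s * Cmod w) by (apply Rmult_le_pos; lra).
    rewrite !Rabs_mult, Rabs_left, (Rabs_pos_eq (exp _)) by (try (left; apply exp_pos); lra).
    (* [exp (2 * x)] pays for the weight and [exp x] for the factor [esum] in the derivative. *)
    replace (exp (3 * x)) with (exp (2 * x) * exp x) by (rewrite <- exp_plus; f_equal; ring).
    assert (A1 : exp (- (2 * fst w) * s) <= exp (2 * x)).
    { assert (Hw := fst_le_Cmod w); apply Rabs_le_between in Hw.
      apply exp_mono; nra. }
    assert (A2 : Rabs (fst (Cmult (Cconj (esum w s M)) (Cmult w (eterm w s M))))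
       <= exp x * (Cmod w * (x ^ M / INR (fact M)))).
    { eapply Rle_trans; [apply fst_le_Cmod |].
      rewrite !Cmod_mult, Cmod_conj, Cmod_eterm by lra.
      apply Rmult_le_compat.
      - apply Cmod_ge_0.
      - apply Rmult_le_pos; [easy | now apply pow_fact_nonneg].
      - eapply Rle_trans; [apply Cmod_esum; lra |].
        now apply exp_mono.
      - apply Rmult_le_compat_l; [easy |]; apply Rmult_le_compat_r.
        + left; apply Rinv_0_lt_compat, INR_fact_pos.
        + now apply pow_incr. }
    apply Rle_trans with (2 * exp (2 * x) * (exp x * (Cmod w * (x ^ M / INR (fact M)))) * t).
    - apply Rmult_le_compat_r; [easy |].
      apply Rmult_le_compat; [| apply Rabs_pos | | easy].
      + pose proof (exp_pos (- (2 * fst w) * s)); lra.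
      + lra.
    - right; unfold x; ring. }
  assert (Y0 : Y 0 = 1).
  { unfold Y, X.
    replace (esum w 0 M) with (RtoC 1).
    - simpl; rewrite Rmult_0_r, exp_0; ring.
    - clear; induction M; [easy |]; rewrite esum_S, <- IHM; unfold eterm.
      simpl; apply injective_projections; simpl; unfold Rdiv; ring. }
  destruct (MVT_gen Y 0 t dY) as (c & Hc & E).
  { intros; apply HY. }
  { intros x _; apply continuity_pt_filterlim, (ex_derive_continuous (V := R_NormedModule)).
    exists (dY x); apply HY. }
  rewrite Rmin_left, Rmax_right in Hc by easy.
  assert (B : Y t <= 1 + erem (t * Cmod w) M).
  { specialize (HdY c Hc); rewrite Y0, Rminus_0_r in E.
    assert (dY c * t <= Rabs (dY c) * t) by (apply Rmult_le_compat_r; [easy | apply Rle_abs]).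
    lra. }
  rewrite Cmod_sq; fold (X t).
  replace (X t) with (exp (2 * fst w * t) * Y t).
  - apply Rmult_le_compat_l; [left; apply exp_pos | easy].
  - unfold Y; rewrite Rmult_comm, Rmult_assoc, <- exp_plus.
    replace (- (2 * fst w) * t + 2 * fst w * t) with 0 by ring; rewrite exp_0; ring.
Qed.

Lemma erem_nonneg x M : 0 <= x -> 0 <= erem x M.
Proof.
  intros Hx; unfold erem; pose proof (exp_pos (3 * x)).
  repeat apply Rmult_le_pos; try lra; [now apply pow_le |].
  left; apply Rinv_0_lt_compat, INR_fact_pos.
Qed.

Lemma erem_incr x y M : 0 <= x <= y -> erem x M <= erem y M.
Proof.
  intros Hx; unfold erem.
  assert (P := Rinv_0_lt_compat _ (INR_fact_pos M)).
  assert (exp (3 * x) <= exp (3 * y)).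
  { apply exp_mono; lra. }
  pose proof (exp_pos (3 * x)).
  assert (0 <= x ^ M) by (apply pow_le; lra).
  repeat apply Rmult_le_compat; try apply Rmult_le_pos; try apply Rmult_le_pos; try lra.
  apply pow_incr; lra.
Qed.

Lemma erem_lim x : is_lim_seq (erem x) 0.
Proof.
  assert (H := is_lim_seq_scal_l _ (2 * exp (3 * x) * x) _
    (proj2 (is_lim_seq_Reals _ _) (cv_speed_pow_fact x))).
  unfold Rbar_mult, Rbar_mult' in H; simpl in H; rewrite Rmult_0_r in H; exact H.
Qed.

Lemma lipC_esum (t : R) z M : lipC (fun z => esum (Cmult (Copp Ci) z) t M) z.
Proof.
  induction M; cbn [esum]; [apply lipC_const |].
  apply lipC_plus; [easy |]; apply lipC_mult; [apply lipC_const |].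
  apply (lipC_ext (fun w => Cmult (Cpow (Copp Ci) (S M)) (Cpow w (S M)))).
  - intros w; now rewrite Cpow_mult_l.
  - apply lipC_mult; [apply lipC_const | apply lipC_pow].
Qed.

Lemma pow_n_Cpow z k : pow_n (K := C_Ring) z k = Cpow z k.
Proof. induction k; simpl; [easy | now rewrite IHk]. Qed.

Lemma amp_term_alt V t n k :
  amp_term V t n k = Cmult (RtoC (t ^ k * (Hpow V k n / INR (fact k)))) (Cpow (Copp Ci) k).
Proof.
  unfold amp_term; rewrite pow_n_Cpow.
  replace (Cmult (RtoC (- t)) Ci) with (Cmult (RtoC t) (Copp Ci)) by (rewrite RtoC_opp; ring).
  rewrite Cpow_mult_l, <- RtoC_pow, RtoC_mult; ring.
Qed.

Lemma Hpow_bound V Bv : bounded_by V Bv -> forall k n, Rabs (Hpow V k n) <= (Bv + 2) ^ k.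
Proof.
  intros HV; assert (HB : 0 <= Bv) by (eapply Rle_trans; [apply Rabs_pos | apply (HV 0%Z)]).
  induction k; intros n.
  - simpl; unfold delta; destruct (Z.eq_dec n 1); rewrite ?Rabs_R0, ?Rabs_R1; lra.
  - simpl; unfold Hr.
    eapply Rle_trans; [apply Rabs_triang |].
    eapply Rle_trans; [apply Rplus_le_compat_r, Rabs_triang |].
    rewrite Rabs_mult.
    assert (Rabs (V n) * Rabs (Hpow V k n) <= Bv * (Bv + 2) ^ k).
    { apply Rmult_le_compat; auto using Rabs_pos. }
    pose proof (IHk (n + 1)%Z); pose proof (IHk (n - 1)%Z); lra.
Qed.

Lemma Cmod_pow_Ci k : Cmod (Cpow (Copp Ci) k) = 1.
Proof. now rewrite Cmod_pow, Cmod_opp, Cmod_Ci, pow1. Qed.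

(** Taylor coefficients in [t] of the real coordinate [p] of the amplitude. *)
Definition acoef (p : C -> R) (V : Z -> R) (n : Z) (k : nat) : R :=
  p (Cpow (Copp Ci) k) * (Hpow V k n / INR (fact k)).

Lemma acoef_bound p V Bv n k : bounded_by V Bv -> (forall z, Rabs (p z) <= Cmod z) ->
  Rabs (acoef p V n k) <= (Bv + 2) ^ k / INR (fact k).
Proof.
  intros HV Hp; unfold acoef, Rdiv; rewrite !Rabs_mult.
  assert (P := Rinv_0_lt_compat _ (INR_fact_pos k)).
  rewrite (Rabs_pos_eq (/ _)) by lra.
  specialize (Hp (Cpow (Copp Ci) k)); rewrite Cmod_pow_Ci in Hp.
  pose proof (Hpow_bound V Bv HV k n); pose proof (Rabs_pos (Hpow V k n)).
  pose proof (Rabs_pos (p (Cpow (Copp Ci) k))).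
  rewrite <- (Rmult_1_l ((Bv + 2) ^ k * _)).
  apply Rmult_le_compat; [easy | apply Rmult_le_pos; lra | easy |].
  apply Rmult_le_compat_r; lra.
Qed.

Lemma acoef_radius p V Bv n : bounded_by V Bv -> (forall z, Rabs (p z) <= Cmod z) ->
  CV_radius (acoef p V n) = p_infty.
Proof.
  intros HV Hp.
  assert (HB : 0 <= Bv) by (eapply Rle_trans; [apply Rabs_pos | apply (HV 0%Z)]).
  destruct (CV_radius_bounded (acoef p V n)) as [Hub _].
  assert (H : forall r : R, Rbar_le r (CV_radius (acoef p V n))).
  { intros r; apply Hub; exists (exp (Rabs r * (Bv + 2))); intros k.
    rewrite Rabs_mult, <- RPow_abs.
    apply Rle_trans with ((Rabs r * (Bv + 2)) ^ k / INR (fact k)).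
    - rewrite Rpow_mult_distr.
      replace (Rabs r ^ k * (Bv + 2) ^ k / INR (fact k))
        with ((Bv + 2) ^ k / INR (fact k) * Rabs r ^ k) by (unfold Rdiv; ring).
      apply Rmult_le_compat_r; [apply pow_le, Rabs_pos | now apply acoef_bound].
    - assert (Px : 0 <= Rabs r * (Bv + 2)) by (apply Rmult_le_pos; [apply Rabs_pos | lra]).
      eapply Rle_trans; [| apply (exp_ge_taylor _ k Px)].
      destruct k; [simpl; lra |]; rewrite tech5.
      enough (0 <= sum_f_R0 (fun k => (Rabs r * (Bv + 2)) ^ k / INR (fact k)) k) by lra.
      apply cond_pos_sum; intros i; now apply pow_fact_nonneg. }
  destruct (CV_radius _) as [r | |] eqn:E; [| easy | exfalso; exact (H 0)].
  specialize (H (r + 1)); simpl in H; lra.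
Qed.

Definition ampR V t n := PSeries (acoef fst V n) t.
Definition ampI V t n := PSeries (acoef snd V n) t.

Lemma amp_PSeries V t n : amp V t n = (ampR V t n, ampI V t n).
Proof.
  unfold amp, ampR, ampI, PSeries; f_equal; apply Series_ext; intros k;
    rewrite amp_term_alt; unfold acoef; simpl; ring.
Qed.

Lemma acoef_lim p V Bv n t : bounded_by V Bv -> (forall z, Rabs (p z) <= Cmod z) ->
  is_lim_seq (fun M => sum_f_R0 (fun k => acoef p V n k * t ^ k) M) (PSeries (acoef p V n) t).
Proof.
  intros HV Hp; unfold PSeries.
  apply (is_lim_seq_ext (sum_n (fun k => acoef p V n k * t ^ k))).
  { intros; apply sum_n_Reals. }
  apply (Series_correct (fun k => acoef p V n k * t ^ k)).
  apply ex_series_Rabs, CV_disk_inside; rewrite (acoef_radius p V Bv); easy.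
Qed.

(** * The amplitude as a contour integral *)

Section amplitude.
Variables (V : Z -> R) (Bv K : R).
Hypothesis HV : bounded_by V Bv.
Hypothesis HK : 1 < K.
Hypothesis Hreg : forall z, snd z <> 0 \/ K - 1 < Rabs (fst z) -> regular V z.

Definition contour_mass (s : R) (n : Z) : R := rect_abs (- K) K (- s) s (fun z => green V z n).

Lemma green_lip_on s n : 0 < s -> on_rect (- K) K (- s) s (lipC (fun z => green V z n)).
Proof.
  intros Hs; generalize (on_small_rect K HK s Hs); apply on_rect_imp.
  intros z Hz; now apply (green_lipC V K Hreg).
Qed.

Lemma contour_mass_nonneg s n : 0 < s -> 0 <= contour_mass s n.
Proof.
  intros Hs; unfold contour_mass.
  apply rect_abs_nonneg; [lra | lra |]; exact (green_lip_on s n Hs).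
Qed.

Lemma rect_esum s kap t M n : 0 < s <= 1 ->
  rect (- K) K (- s) s (fun z => Cmult (Cmult kap (esum (Cmult (Copp Ci) z) t M)) (green V z n))
  = 2 * PI * sum_f_R0 (fun k => acoef (fun w => snd (Cmult kap w)) V n k * t ^ k) M.
Proof.
  intros Hs.
  assert (T : forall k, rect (- K) K (- s) s
     (fun z => Cmult (Cmult kap (eterm (Cmult (Copp Ci) z) t k)) (green V z n))
     = 2 * PI * (acoef (fun w => snd (Cmult kap w)) V n k * t ^ k)).
  { intros k.
    rewrite (rect_ext _ _ _ _ _ (fun z => Cmult (Cmult
      (Cmult (RtoC (t ^ k / INR (fact k))) (Cmult kap (Cpow (Copp Ci) k))) (Cpow z k)) (green V z n)));
      try lra.
    - rewrite (rect_green_pow V Bv K HV HK Hreg) by easy; unfold acoef, Rdiv; simpl; ring.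
    - apply on_rect_all; intros z; cbn beta; unfold eterm; rewrite Cpow_mult_l; ring. }
  assert (Lt : forall k, on_rect (- K) K (- s) s
     (lipC (fun z => Cmult (Cmult kap (eterm (Cmult (Copp Ci) z) t k)) (green V z n)))).
  { intros k; generalize (green_lip_on s n ltac:(lra)); apply on_rect_imp; intros z Hz.
    apply lipC_mult; [| easy]; apply lipC_mult; [apply lipC_const |].
    apply lipC_mult; [apply lipC_const |].
    apply (lipC_ext (fun w => Cmult (Cpow (Copp Ci) k) (Cpow w k))).
    - intros w; now rewrite Cpow_mult_l.
    - apply lipC_mult; [apply lipC_const | apply lipC_pow]. }
  induction M.
  - cbn [sum_f_R0]; rewrite <- (T 0%nat); apply rect_ext; try lra; apply on_rect_all; intros z; cbn beta.
    unfold eterm; simpl Cpow; simpl esum.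
    replace (t ^ 0 / INR (fact 0)) with 1 by (simpl; field); ring.
  - assert (Le' : on_rect (- K) K (- s) s
     (lipC (fun z => Cmult (Cmult kap (esum (Cmult (Copp Ci) z) t M)) (green V z n)))).
    { generalize (green_lip_on s n ltac:(lra)); apply on_rect_imp; intros z Hz.
      apply lipC_mult; [| easy]; apply lipC_mult; [apply lipC_const | apply lipC_esum]. }
    rewrite tech5, Rmult_plus_distr_l, <- T, <- IHM by easy.
    rewrite <- rect_plus by (easy || lra).
    apply rect_ext; try lra; apply on_rect_all; intros z; cbn beta; rewrite esum_S; ring.
Qed.

Lemma on_rect_size s : 0 < s <= 1 ->
  on_rect (- K) K (- s) s (fun z => Rabs (snd z) <= s /\ Cmod z <= K + 1).
Proof.
  intros Hs.
  assert (H : forall x y, - K <= x <= K -> - s <= y <= s ->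
     Rabs (snd (x, y)) <= s /\ Cmod (x, y) <= K + 1).
  { intros x y Hx Hy; split; [simpl; now apply Rabs_le |].
    replace (x, y) with (Cplus (RtoC x) (Cmult Ci (RtoC y)))
      by (apply injective_projections; simpl; ring).
    eapply Rle_trans; [apply Cmod_triangle |].
    rewrite Cmod_mult, Cmod_Ci, !Cmod_R.
    pose proof (Rabs_le x K Hx); pose proof (Rabs_le y s Hy); lra. }
  split; intros t Ht; split; apply H; lra.
Qed.

(** The estimate holds for every Taylor polynomial with an extra factor [1 + erem], which tends to 1
    with the degree. The unit [kap] selects the coordinate: [Ci] the real part of the amplitude, 1
    the imaginary part. *)
Lemma coefficient_bound p s t n kap : 0 < s <= 1 -> 0 <= t -> Cmod kap = 1 ->
  (forall z, p z = snd (Cmult kap z)) ->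
  2 * PI * Rabs (PSeries (acoef p V n) t) <= exp (t * s) * contour_mass s n.
Proof.
  intros Hs Ht Hk Hp.
  assert (Hpm : forall z, Rabs (p z) <= Cmod z).
  { intros z; rewrite Hp; eapply Rle_trans; [apply snd_le_Cmod |].
    rewrite Cmod_mult, Hk; lra. }
  assert (HQ := contour_mass_nonneg s n ltac:(lra)).
  assert (fin : forall M, 2 * PI * Rabs (sum_f_R0 (fun k => acoef p V n k * t ^ k) M)
     <= exp (t * s) * contour_mass s n * (1 + erem (t * (K + 1)) M)).
  { intros M.
    rewrite <- (Rabs_pos_eq (2 * PI)) by (pose proof PI_RGT_0; lra).
    rewrite <- Rabs_mult.
    replace (2 * PI * sum_f_R0 (fun k => acoef p V n k * t ^ k) M) with
      (rect (- K) K (- s) s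
         (fun z => Cmult (Cmult kap (esum (Cmult (Copp Ci) z) t M)) (green V z n))).
    2: { rewrite rect_esum by easy; f_equal; apply sum_eq; intros; unfold acoef; now rewrite Hp. }
    replace (exp (t * s) * contour_mass s n * (1 + erem (t * (K + 1)) M))
      with ((exp (t * s) * (1 + erem (t * (K + 1)) M)) * contour_mass s n) by ring.
    assert (HE : 0 <= erem (t * (K + 1)) M) by (apply erem_nonneg, Rmult_le_pos; lra).
    apply rect_abs_bound; try lra.
    - generalize (green_lip_on s n ltac:(lra)); apply on_rect_imp; intros z Hz.
      apply lipC_mult; [| easy]; apply lipC_mult; [apply lipC_const | apply lipC_esum].
    - apply green_lip_on; lra.
    - generalize (on_rect_size s Hs); apply on_rect_imp; intros z [Hz1 Hz2].
      rewrite !Cmod_mult, Hk, Rmult_1_l.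
      apply Rmult_le_compat_r; [apply Cmod_ge_0 |].
      apply pow2_le_inv; [apply Rmult_le_pos; [left; apply exp_pos | lra] |].
      eapply Rle_trans; [apply esum_bound, Ht |].
      rewrite Cmod_mult, Cmod_opp, Cmod_Ci, Rmult_1_l, Rpow_mult_distr.
      assert (E1 : erem (t * Cmod z) M <= erem (t * (K + 1)) M).
      { apply erem_incr; split; [apply Rmult_le_pos; [easy | apply Cmod_ge_0] |].
        now apply Rmult_le_compat_l. }
      assert (E0 : 0 <= erem (t * Cmod z) M)
        by (apply erem_nonneg, Rmult_le_pos; [easy | apply Cmod_ge_0]).
      apply Rmult_le_compat; [left; apply exp_pos | lra | |].
      + replace (exp (t * s) ^ 2) with (exp (2 * s * t))
          by (simpl; rewrite Rmult_1_r, <- exp_plus; f_equal; ring).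
        simpl fst; apply Rabs_le_between in Hz1.
        (* The real part of [- i z] is [Im z], so the growth rate is the height of the contour. *)
        assert (Hle : 2 * (- (0) * fst z - - (1) * snd z) * t <= 2 * s * t)
          by (apply Rmult_le_compat_r; lra).
        now apply exp_mono.
      + simpl; nra. }
  assert (L1 : is_lim_seq (fun M => 2 * PI * Rabs (sum_f_R0 (fun k => acoef p V n k * t ^ k) M))
     (Rbar_mult (2 * PI) (Rabs (PSeries (acoef p V n) t)))).
  { apply is_lim_seq_scal_l, (is_lim_seq_abs _ (Finite _)), (acoef_lim p V Bv); easy. }
  assert (L2 : is_lim_seq (fun M => exp (t * s) * contour_mass s n * (1 + erem (t * (K + 1)) M))
     (Rbar_mult (exp (t * s) * contour_mass s n) (Rbar_plus 1 0))).
  { apply is_lim_seq_scal_l, is_lim_seq_plus'; [apply is_lim_seq_const | apply erem_lim]. }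
  assert (L := is_lim_seq_le _ _ _ _ fin L1 L2); simpl in L; lra.
Qed.

Lemma amp_bound s t n : 0 < s <= 1 -> 0 <= t ->
  Cmod (amp V t n) ^ 2 <= exp (2 * s * t) * contour_mass s n ^ 2.
Proof.
  intros Hs Ht; rewrite amp_PSeries, Cmod_sq; unfold ampR, ampI, fst at 1, snd at 1.
  assert (B1 := coefficient_bound fst s t n Ci Hs Ht Cmod_Ci ltac:(intros; simpl; ring)).
  assert (B2 := coefficient_bound snd s t n (RtoC 1) Hs Ht Cmod_1 ltac:(intros; simpl; ring)).
  rewrite <- (pow2_abs (PSeries (acoef fst V n) t)), <- (pow2_abs (PSeries (acoef snd V n) t)).
  replace (exp (2 * s * t)) with (exp (t * s) ^ 2)
    by (simpl; rewrite Rmult_1_r, <- exp_plus; f_equal; ring).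
  rewrite <- Rpow_mult_distr.
  set (q := exp (t * s) * contour_mass s n) in *.
  set (u := Rabs (PSeries (acoef fst V n) t)) in *; set (v := Rabs (PSeries (acoef snd V n) t)) in *.
  assert (0 <= u) by apply Rabs_pos; assert (0 <= v) by apply Rabs_pos.
  assert (P : 2 < PI) by (pose proof PI2_1; lra).
  assert (2 * u <= q) by nra; assert (2 * v <= q) by nra; simpl; nra.
Qed.

End amplitude.

(** * Time averages *)

Lemma amp_continuous p V Bv n t : bounded_by V Bv -> (forall z, Rabs (p z) <= Cmod z) ->
  continuous (PSeries (acoef p V n)) t.
Proof.
  intros HV Hp; apply continuity_pt_filterlim, PSeries_continuity.
  now rewrite (acoef_radius p V Bv).
Qed.

Lemma amp_sq_continuous V Bv n t : bounded_by V Bv ->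
  continuous (fun t => Cmod (amp V t n) ^ 2) t.
Proof.
  intros HV.
  apply (continuous_ext (fun t => plus (mult (ampR V t n) (ampR V t n)) (mult (ampI V t n) (ampI V t n)))).
  { intros x; rewrite amp_PSeries, Cmod_sq; unfold plus, mult; simpl; ring. }
  apply (continuous_plus (V := R_NormedModule)); apply (continuous_mult (K := R_AbsRing));
    apply (amp_continuous _ V Bv); auto using fst_le_Cmod, snd_le_Cmod.
Qed.

(** The integral over [[0, b]] increases with [b], so boundedness gives convergence. The limit along
    integers is recorded in order to pass finite sums through the improper integral later. *)
Lemma RInt_gen_bounded f A : (forall t, continuous f t) -> (forall t, 0 <= t -> 0 <= f t) ->
  (forall b, 0 <= b -> RInt f 0 b <= A) ->
  0 <= RInt_gen f (at_point 0) (Rbar_locally p_infty) <= A /\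
  is_lim_seq (fun N => RInt f 0 (INR N)) (RInt_gen f (at_point 0) (Rbar_locally p_infty)).
Proof.
  intros Hc Hpos HA.
  assert (EX : forall a b, ex_RInt f a b).
  { intros; apply (ex_RInt_continuous (V := R_CompleteNormedModule)); auto. }
  assert (mono : forall a b, 0 <= a <= b -> RInt f 0 a <= RInt f 0 b).
  { intros a b Hab; rewrite <- (RInt_Chasles (V := R_CompleteNormedModule) f 0 a b) by apply EX.
    assert (0 <= RInt f a b) by (apply RInt_ge_0; [lra | apply EX | intros; apply Hpos; lra]).
    unfold plus; simpl; lra. }
  destruct (ex_finite_lim_seq_incr (fun N => RInt f 0 (INR N)) A) as [l Hl].
  { intros n; apply mono; split; [apply pos_INR | rewrite S_INR; lra]. }
  { intros n; apply HA, pos_INR. }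
  assert (Hup : forall b, 0 <= b -> RInt f 0 b <= l).
  { intros b Hb; destruct (INR_unbounded b) as [N HN].
    apply Rle_trans with (RInt f 0 (INR N)); [apply mono; lra |].
    apply (is_lim_seq_incr_compare (fun N => RInt f 0 (INR N))); [easy |].
    intros n; apply mono; split; [apply pos_INR | rewrite S_INR; lra]. }
  assert (I : is_RInt_gen f (at_point 0) (Rbar_locally p_infty) l).
  { intros P [eps HP].
    pose proof Hl as Hl'; apply is_lim_seq_spec in Hl'; destruct (Hl' eps) as [N HN].
    specialize (HN N (Nat.le_refl N)); apply Rabs_def2 in HN.
    apply (Filter_prod _ _ _ (fun a => a = 0) (fun b => INR N < b)).
    - easy.
    - now exists (INR N).
    - intros a b -> Hb; exists (RInt f 0 b); split.
      + apply (RInt_correct (V := R_CompleteNormedModule)), EX.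
      + apply HP; unfold ball; simpl; unfold AbsRing_ball, abs, minus, plus, opp; simpl.
        pose proof (pos_INR N).
        assert (RInt f 0 b <= l) by (apply Hup; lra).
        assert (RInt f 0 (INR N) <= RInt f 0 b) by (apply mono; lra).
        apply Rabs_def1; lra. }
  assert (PF : ProperFilter' (at_point 0)) by apply Proper_StrongProper, at_point_filter.
  assert (PF2 : ProperFilter' (Rbar_locally p_infty)) by apply Proper_StrongProper, Rbar_locally_filter.
  assert (E : RInt_gen f (at_point 0) (Rbar_locally p_infty) = l)
    by (apply is_RInt_gen_unique; easy).
  rewrite E; split; [split | easy].
  - specialize (Hup 0 ltac:(lra)); rewrite RInt_point in Hup; exact Hup.
  - apply (is_lim_seq_le (fun N => RInt f 0 (INR N)) (fun _ => A) l A); auto.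
    + intros; apply HA, pos_INR.
    + apply is_lim_seq_const.
Qed.

Lemma RInt_exp_bound c b : 0 < c -> 0 <= b -> RInt (fun t => exp (- c * t)) 0 b <= / c.
Proof.
  intros Hc Hb.
  assert (I : is_RInt (fun t => exp (- c * t)) 0 b (minus (- exp (- c * b) / c) (- exp (- c * 0) / c))).
  { apply (is_RInt_derive (fun t => - exp (- c * t) / c)).
    - intros x _; auto_derive; [easy | field; lra].
    - intros x _; apply (ex_derive_continuous (V := R_NormedModule)); now auto_derive. }
  apply (is_RInt_unique (V := R_CompleteNormedModule)) in I; rewrite I.
  rewrite Rmult_0_r, exp_0; unfold minus, plus, opp; simpl.
  pose proof (exp_pos (- c * b)); pose proof (Rinv_0_lt_compat c Hc).
  unfold Rdiv; nra.
Qed.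

Definition dens V n T t : R := exp (- 2 * t / T) * Cmod (amp V t n) ^ 2.

Lemma dens_continuous V Bv n T t : bounded_by V Bv -> continuous (dens V n T) t.
Proof.
  intros HV; apply (continuous_mult (K := R_AbsRing)); [| now apply (amp_sq_continuous V Bv)].
  apply (ex_derive_continuous (V := R_NormedModule)); now auto_derive.
Qed.

Lemma dens_nonneg V n T t : 0 <= dens V n T t.
Proof. apply Rmult_le_pos; [left; apply exp_pos | apply pow2_ge_0]. Qed.

Lemma a_nT_facts V Bv n T (c A : R) : bounded_by V Bv -> 0 < T -> 0 < c -> 0 <= A ->
  (forall t, 0 <= t -> dens V n T t <= A * exp (- c * t)) ->
  0 <= a_nT V n T <= 2 / T * (A * / c) /\
  is_lim_seq (fun N => 2 / T * RInt (dens V n T) 0 (INR N)) (a_nT V n T).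
Proof.
  intros HV HT Hc HA Hd.
  assert (P : 0 < 2 / T) by (apply Rdiv_lt_0_compat; lra).
  destruct (RInt_gen_bounded (dens V n T) (A * / c)) as [B L].
  - intros t; now apply (dens_continuous V Bv).
  - intros t _; apply dens_nonneg.
  - intros b Hb.
    assert (Xe : ex_RInt (fun t => exp (- c * t)) 0 b).
    { apply ex_RInt_cont; [easy |]; intros x _.
      apply (ex_derive_continuous (V := R_NormedModule)); now auto_derive. }
    apply Rle_trans with (A * RInt (fun t => exp (- c * t)) 0 b).
    + rewrite <- RInt_scal_R by easy; apply RInt_le; [easy | | now apply ex_RInt_scal_R |].
      * apply ex_RInt_cont; [easy |]; intros; now apply (dens_continuous V Bv).
      * intros; apply Hd; lra.
    + apply Rmult_le_compat_l; [easy | now apply RInt_exp_bound].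
  - unfold a_nT; fold (dens V n T); split.
    + split; [apply Rmult_le_pos; lra | apply Rmult_le_compat_l; lra].
    + assert (L' := is_lim_seq_scal_l _ (2 / T) _ L); exact L'.
Qed.

(** After the growth of the amplitude is taken off, the weight left is [exp (- t / T)], with
    integral [T]; the prefactor [2 / T] turns this into 2. *)
Lemma a_nT_contour V Bv K n T : bounded_by V Bv -> 1 < K ->
  (forall z, snd z <> 0 \/ K - 1 < Rabs (fst z) -> regular V z) -> 1 <= T ->
  0 <= a_nT V n T <= 2 * contour_mass V K (/ (2 * T)) n ^ 2.
Proof.
  intros HV HK Hreg HT.
  assert (Hs := inv_unit (2 * T) ltac:(lra)).
  destruct (a_nT_facts V Bv n T (/ T) (contour_mass V K (/ (2 * T)) n ^ 2)) as [B _];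
    try lra; try easy.
  - apply Rinv_0_lt_compat; lra.
  - apply pow2_ge_0.
  - intros t Ht; unfold dens.
    apply Rle_trans with (exp (- 2 * t / T) *
      (exp (2 * / (2 * T) * t) * contour_mass V K (/ (2 * T)) n ^ 2)).
    + apply Rmult_le_compat_l; [left; apply exp_pos |].
      now apply (amp_bound V Bv).
    + rewrite <- Rmult_assoc, <- exp_plus, Rmult_comm; right; f_equal; f_equal; field; lra.
  - split; [apply B |]; eapply Rle_trans; [apply B |]; right; field; lra.
Qed.

(** * Unitarity *)

Lemma Hpow_support V k n : (Z.of_nat k < Z.abs (n - 1))%Z -> Hpow V k n = 0.
Proof.
  revert n; induction k; intros n Hn; simpl.
  - apply delta_neq; lia.
  - unfold Hr; rewrite !IHk by lia; ring.
Qed.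

Section unitarity.
Variables (V : Z -> R) (Bv : R).
Hypothesis HV : bounded_by V Bv.

Lemma Bv_nonneg : 0 <= Bv.
Proof. eapply Rle_trans; [apply Rabs_pos | apply (HV 0%Z)]. Qed.

(** [H ^ k] moves mass by at most [k] sites, so the terms with [k < m] vanish; into the others the
    factor [2 ^ k * (1 / 2) ^ m], at least 1, may be inserted. With [m = 0] the bound is uniform in
    [n]. *)
Lemma amp_far p n m t : (forall z, Rabs (p z) <= Cmod z) -> 0 <= t ->
  (Z.of_nat m <= Z.abs (n - 1))%Z ->
  Rabs (PSeries (acoef p V n) t) <= exp (2 * ((Bv + 2) * t)) * (1 / 2) ^ m.
Proof.
  intros Hp Ht Hm; pose proof Bv_nonneg as HB.
  set (x := (Bv + 2) * t); assert (Hx : 0 <= x) by (apply Rmult_le_pos; lra).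
  assert (fin : forall M, Rabs (sum_f_R0 (fun k => acoef p V n k * t ^ k) M)
     <= exp (2 * x) * (1 / 2) ^ m).
  { intros M.
    eapply Rle_trans; [apply Rsum_abs |].
    apply Rle_trans with (sum_f_R0 (fun k => (2 * x) ^ k / INR (fact k) * (1 / 2) ^ m) M).
    - apply sum_Rle; intros k _.
      assert (P := Rinv_0_lt_compat _ (INR_fact_pos k)).
      destruct (Z_lt_dec (Z.of_nat k) (Z.abs (n - 1))) as [L | L].
      + unfold acoef; rewrite Hpow_support by easy.
        replace (p (Cpow (Copp Ci) k) * (0 / INR (fact k)) * t ^ k) with 0 by (unfold Rdiv; ring).
        rewrite Rabs_R0; repeat apply Rmult_le_pos; try lra; apply pow_le; lra.
      + rewrite Rabs_mult, (Rabs_pos_eq (t ^ k)) by now apply pow_le.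
        apply Rle_trans with ((Bv + 2) ^ k / INR (fact k) * t ^ k).
        { apply Rmult_le_compat_r; [now apply pow_le | now apply acoef_bound]. }
        replace ((Bv + 2) ^ k / INR (fact k) * t ^ k) with (x ^ k / INR (fact k))
          by (unfold x; rewrite Rpow_mult_distr; unfold Rdiv; ring).
        assert (H2 : 1 <= 2 ^ k * (1 / 2) ^ m).
        { replace (2 ^ k) with (2 ^ (k - m) * 2 ^ m) by (rewrite <- pow_add; f_equal; lia).
          rewrite Rmult_assoc, <- Rpow_mult_distr.
          replace (2 * (1 / 2)) with 1 by field; rewrite pow1, Rmult_1_r.
          apply pow_R1_Rle; lra. }
        rewrite Rpow_mult_distr; set (xk := x ^ k); set (ik := INR (fact k)) in *.
        replace (2 ^ k * xk / ik * (1 / 2) ^ m) with (xk / ik * (2 ^ k * (1 / 2) ^ m))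
          by (unfold Rdiv; ring).
        rewrite <- (Rmult_1_r (xk / ik)) at 1; apply Rmult_le_compat_l; [| easy].
        apply Rmult_le_pos; [now apply pow_le | lra].
    - rewrite <- scal_sum, Rmult_comm.
      apply Rmult_le_compat_r; [apply pow_le; lra | apply exp_ge_taylor; lra]. }
  assert (L := is_lim_seq_le _ (fun _ => exp (2 * x) * (1 / 2) ^ m) _ _ fin
    (is_lim_seq_abs _ (Finite _) (acoef_lim p V Bv n t HV Hp)) (is_lim_seq_const _)).
  exact L.
Qed.

Lemma acoef_ex p n t : (forall z, Rabs (p z) <= Cmod z) -> ex_pseries (acoef p V n) t.
Proof. intros Hp; apply CV_radius_inside; now rewrite (acoef_radius p V Bv). Qed.

(** The Schroedinger equation in real coordinates: [q] is [p] after multiplication by [- i]. *)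
Lemma amp_derive p q n t : (forall z, Rabs (p z) <= Cmod z) -> (forall z, Rabs (q z) <= Cmod z) ->
  (forall z, p (Cmult (Copp Ci) z) = q z) ->
  is_derive (PSeries (acoef p V n)) t
    (PSeries (acoef q V (n + 1)) t + PSeries (acoef q V (n - 1)) t + V n * PSeries (acoef q V n) t).
Proof.
  intros Hp Hq Hpq.
  replace (_ + _ + _) with (PSeries (PS_derive (acoef p V n)) t).
  - apply is_derive_PSeries; now rewrite (acoef_radius p V Bv).
  - rewrite <- PSeries_scal, <- !PSeries_plus.
    + apply PSeries_ext; intros k.
      unfold PS_derive, PS_plus, PS_scal, acoef, plus, scal; simpl; unfold mult; simpl.
      rewrite Hpq; unfold Hr.
      change (fact k + k * fact k)%nat with (fact (S k)).
      rewrite fact_simpl, mult_INR.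
      change (match k with 0%nat => 1 | S _ => INR k + 1 end) with (INR (S k)).
      field; split; [apply INR_fact_neq_0 | apply not_0_INR; lia].
    + apply ex_pseries_plus; now apply acoef_ex.
    + apply ex_pseries_scal; [apply Rmult_comm | now apply acoef_ex].
    + now apply acoef_ex.
    + now apply acoef_ex.
Qed.

Lemma ampR_derive n t : is_derive (fun t => ampR V t n) t
  (ampI V t (n + 1) + ampI V t (n - 1) + V n * ampI V t n).
Proof.
  apply (amp_derive fst snd); [apply fst_le_Cmod | apply snd_le_Cmod |].
  intros; simpl; ring.
Qed.

Lemma ampI_derive n t : is_derive (fun t => ampI V t n) t
  (- (ampR V t (n + 1) + ampR V t (n - 1) + V n * ampR V t n)).
Proof.
  replace (- _) with (PSeries (acoef (fun z => - fst z) V (n + 1)) t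
    + PSeries (acoef (fun z => - fst z) V (n - 1)) t
    + V n * PSeries (acoef (fun z => - fst z) V n) t).
  - apply (amp_derive snd (fun z => - fst z)); [apply snd_le_Cmod | |].
    + intros; rewrite Rabs_Ropp; apply fst_le_Cmod.
    + intros; simpl; ring.
  - assert (E : forall m, PSeries (acoef (fun z => - fst z) V m) t = - ampR V t m).
    { intros m; unfold ampR; rewrite <- PSeries_opp; apply PSeries_ext; intros k.
      unfold PS_opp, acoef, opp; simpl; ring. }
    rewrite !E; ring.
Qed.

Definition prob t n := Cmod (amp V t n) ^ 2.
Definition current t n := ampR V t n * ampI V t (n + 1) - ampI V t n * ampR V t (n + 1).

Lemma prob_alt t n : prob t n = ampR V t n * ampR V t n + ampI V t n * ampI V t n.
Proof. unfold prob; rewrite amp_PSeries, Cmod_sq; simpl; ring. Qed.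

(** The continuity equation; the real potential cancels. *)
Lemma prob_derive n t : is_derive (fun t => prob t n) t (2 * (current t n - current t (n - 1))).
Proof.
  apply (is_derive_ext (fun t => ampR V t n * ampR V t n + ampI V t n * ampI V t n)).
  { intros; symmetry; apply prob_alt. }
  evar_last.
  - apply (is_derive_plus (V := R_NormedModule)).
    + apply (is_derive_mult (fun t => ampR V t n) (fun t => ampR V t n));
        [apply ampR_derive | apply ampR_derive | intros; apply Rmult_comm].
    + apply (is_derive_mult (fun t => ampI V t n) (fun t => ampI V t n));
        [apply ampI_derive | apply ampI_derive | intros; apply Rmult_comm].
  - unfold current; replace (n - 1 + 1)%Z with n by lia.
    unfold plus, mult; simpl; ring.
Qed.

Lemma zsum_derive (F : R -> Z -> R) (dF : R -> Z -> R) a m t :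
  (forall n, is_derive (fun t => F t n) t (dF t n)) ->
  is_derive (fun t => zsum (F t) a m) t (zsum (dF t) a m).
Proof.
  intros H; induction m; cbn [zsum]; [apply @is_derive_const |].
  now apply (is_derive_plus (V := R_NormedModule)).
Qed.

Lemma current_bound N t n : 0 <= t -> (Z.of_nat N + 1 <= Z.abs n)%Z ->
  Rabs (current t n) <= 2 * (exp (4 * ((Bv + 2) * t)) * (1 / 2) ^ N).
Proof.
  intros Ht Hn; unfold current, ampR, ampI.
  assert (F1 := amp_far fst n N t fst_le_Cmod Ht ltac:(lia)).
  assert (F2 := amp_far snd n N t snd_le_Cmod Ht ltac:(lia)).
  assert (F3 := amp_far fst (n + 1) 0 t fst_le_Cmod Ht ltac:(lia)).
  assert (F4 := amp_far snd (n + 1) 0 t snd_le_Cmod Ht ltac:(lia)).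
  rewrite pow_O, Rmult_1_r in F3, F4.
  set (e := exp (2 * ((Bv + 2) * t))) in *.
  replace (exp (4 * ((Bv + 2) * t))) with (e * e)
    by (unfold e; rewrite <- exp_plus; f_equal; ring).
  unfold Rminus; eapply Rle_trans; [apply Rabs_triang |].
  rewrite Rabs_Ropp, !Rabs_mult.
  assert (G1 := Rmult_le_compat _ _ _ _ (Rabs_pos _) (Rabs_pos _) F1 F4).
  assert (G2 := Rmult_le_compat _ _ _ _ (Rabs_pos _) (Rabs_pos _) F2 F3).
  lra.
Qed.

(** The mass in a window changes only through the two boundary currents, which [current_bound] makes
    arbitrarily small when the window is wide; at time 0 the mass is at most that of [delta_1]. *)
Lemma prob_sum_le_1 t a m : 0 <= t -> zsum (prob t) a m <= 1.
Proof.
  intros Ht; apply le_epsilon; intros eps Heps.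
  pose proof Bv_nonneg as HB.
  (* The 8 is the 2 of [prob_derive], times two boundary currents, times the 2 of
     [current_bound]. *)
  set (c := 8 * exp (4 * ((Bv + 2) * t)) * t).
  assert (L := is_lim_seq_scal_l _ c _ (is_lim_seq_geom (1 / 2) ltac:(rewrite Rabs_pos_eq; lra))).
  simpl in L; rewrite Rmult_0_r in L; apply is_lim_seq_spec in L.
  destruct (L (mkposreal eps Heps)) as [N1 HN1].
  pose (N := (N1 + Z.to_nat (Z.abs a) + m)%nat).
  specialize (HN1 N ltac:(unfold N; lia)); simpl in HN1.
  rewrite Rminus_0_r in HN1; apply Rabs_def2 in HN1; destruct HN1 as [HN1 _].
  pose (b := (- Z.of_nat N - 1)%Z); pose (k := (2 * N + 3)%nat).
  apply Rle_trans with (zsum (prob t) b k).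
  { apply zsum_subset; [intros; apply pow2_ge_0 | unfold b, N; lia | unfold b, k, N; lia]. }
  destruct (MVT_gen (fun t => zsum (prob t) b k) 0 t
     (fun t => zsum (fun n => 2 * (current t n - current t (n - 1))) b k)) as (x & Hx & E).
  { intros x _; apply (zsum_derive prob (fun t n => 2 * (current t n - current t (n - 1)))); intros; apply prob_derive. }
  { intros x _; apply continuity_pt_filterlim, (ex_derive_continuous (V := R_NormedModule)).
    eexists; apply (zsum_derive prob (fun t n => 2 * (current t n - current t (n - 1)))); intros; apply prob_derive. }
  rewrite Rmin_left, Rmax_right in Hx by easy.
  rewrite zsum_scal, zsum_telescope, Rminus_0_r in E.
  assert (Hxe : exp (4 * ((Bv + 2) * x)) <= exp (4 * ((Bv + 2) * t))).
  { apply exp_mono; nra. }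
  assert (C1 := current_bound N x (b + Z.of_nat k - 1) ltac:(lra) ltac:(unfold b, k; lia)).
  assert (C2 := current_bound N x (b - 1) ltac:(lra) ltac:(unfold b, k; lia)).
  assert (Hp : 0 < (1 / 2) ^ N) by (apply pow_lt; lra).
  assert (exp (4 * ((Bv + 2) * x)) * (1 / 2) ^ N <= exp (4 * ((Bv + 2) * t)) * (1 / 2) ^ N)
    by (apply Rmult_le_compat_r; lra).
  apply Rabs_le_between in C1; apply Rabs_le_between in C2.
  assert (B : 2 * (current x (b + Z.of_nat k - 1) - current x (b - 1)) * t
     <= 8 * (exp (4 * ((Bv + 2) * t)) * (1 / 2) ^ N) * t)
    by (apply Rmult_le_compat_r; lra).
  assert (I0 : zsum (prob 0) b k <= 1).
  { eapply Rle_trans; [| apply (bdd_dlt 1 b k)]; right; apply zsum_ext; intros n.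
    rewrite prob_alt; unfold ampR, ampI; rewrite !PSeries_0; unfold acoef, dlt.
    rewrite Cmod_R, pow2_abs; simpl; field. }
  unfold c in HN1; unfold Rdiv in *; simpl in *; lra.
Qed.

(** Sum and time integral are exchanged on [[0, M]], where the integrals are proper, before [M]
    tends to infinity. *)
Lemma a_nT_sum_le_1 T : 0 < T -> forall N, zsum (fun n => a_nT V n T) (- Z.of_nat N) (2 * N + 1) <= 1.
Proof.
  intros HT N.
  assert (P : 0 < 2 / T) by (apply Rdiv_lt_0_compat; lra).
  assert (D1 : forall n t, 0 <= t -> dens V n T t <= 1 * exp (- (2 / T) * t)).
  { intros n t Ht; unfold dens; rewrite Rmult_1_l.
    replace (- 2 * t / T) with (- (2 / T) * t) by (field; lra).
    rewrite <- (Rmult_1_r (exp (- (2 / T) * t))) at 2.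
    apply Rmult_le_compat_l; [left; apply exp_pos |].
    assert (H := prob_sum_le_1 t n 1 Ht); cbn [zsum] in H; rewrite Z.add_0_r in H.
    unfold prob in H; lra. }
  assert (lim : forall a m, is_lim_seq (fun M => zsum (fun n => 2 / T * RInt (dens V n T) 0 (INR M)) a m)
     (zsum (fun n => a_nT V n T) a m)).
  { intros a m; induction m; cbn [zsum]; [apply is_lim_seq_const |].
    apply is_lim_seq_plus'; [easy |].
    apply (a_nT_facts V Bv _ T (2 / T) 1); auto; lra. }
  assert (EX : forall n b, ex_RInt (dens V n T) 0 b).
  { intros; apply (ex_RInt_continuous (V := R_CompleteNormedModule)); intros.
    now apply (dens_continuous V Bv). }
  assert (sumint : forall a m b, ex_RInt (fun t => zsum (fun n => dens V n T t) a m) 0 b /\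
     zsum (fun n => 2 / T * RInt (dens V n T) 0 b) a m
     = 2 / T * RInt (fun t => zsum (fun n => dens V n T t) a m) 0 b).
  { intros a m b; induction m; cbn [zsum].
    - split; [apply ex_RInt_const |]; rewrite RInt_const; unfold scal; simpl; unfold mult; simpl; ring.
    - destruct IHm as [X E]; split; [now apply (ex_RInt_plus (V := R_NormedModule)) |].
      rewrite E, (RInt_plus (V := R_CompleteNormedModule)) by easy.
      unfold plus; simpl; ring. }
  assert (bnd : forall M, zsum (fun n => 2 / T * RInt (dens V n T) 0 (INR M)) (- Z.of_nat N) (2 * N + 1) <= 1).
  { intros M; destruct (sumint (- Z.of_nat N)%Z (2 * N + 1)%nat (INR M)) as [X ->].
    apply Rle_trans with (2 / T * / (2 / T)); [| right; field; lra].
    apply Rmult_le_compat_l; [lra |].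
    eapply Rle_trans; [| apply RInt_exp_bound; [exact P | apply (pos_INR M)]].
    apply RInt_le; [apply pos_INR | easy | |].
    - apply ex_RInt_cont; [apply pos_INR |]; intros x _.
      apply (ex_derive_continuous (V := R_NormedModule)); now auto_derive.
    - intros t Ht; unfold dens; rewrite zsum_scal.
      replace (- 2 * t / T) with (- (2 / T) * t) by (field; lra).
      rewrite <- (Rmult_1_r (exp (- (2 / T) * t))) at 2.
      apply Rmult_le_compat_l; [left; apply exp_pos | apply prob_sum_le_1; lra]. }
  exact (is_lim_seq_le _ (fun _ => 1) _ _ bnd (lim _ _) (is_lim_seq_const 1)).
Qed.

End unitarity.

(** * Green function decay and transfer matrices *)

Lemma Hz_step V z f n : Hz V z f n = RtoC 0 ->
  f (n + 1)%Z = Cminus (Cmult (Cminus z (RtoC (V n))) (f n)) (f (n - 1)%Z).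
Proof.
  unfold Hz, Hop; intros H.
  replace (f (n + 1)%Z) with (Cplus (Cminus (Cplus (Cplus (f (n + 1)%Z) (f (n - 1)%Z))
    (Cmult (RtoC (V n)) (f n))) (Cmult z (f n)))
    (Cminus (Cmult (Cminus z (RtoC (V n))) (f n)) (f (n - 1)%Z))) by ring.
  rewrite H; ring.
Qed.

Definition truncate (n : Z) (u : Z -> C) (k : Z) : C := if Z_le_dec k n then RtoC 0 else u k.

(** Applying [H - z] to the truncation leaves [u (n + 1)] at site [n] and [- u n] at site [n + 1], a
    source to which the resolvent bound applies. *)
Lemma tail_bdd V z D u n : good V z D -> l2 u -> (forall k, (2 <= k)%Z -> Hz V z u k = RtoC 0) ->
  (1 <= n)%Z -> bdd (truncate n u) (D * (Cmod (u n) ^ 2 + Cmod (u (n + 1)%Z) ^ 2)).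
Proof.
  intros [_ G] Lu E Hn; apply G.
  - apply (l2_eventually_dominated _ u 1 0 0 Lu); intros k _; unfold truncate.
    destruct (Z_le_dec k n); [rewrite Cmod_0; pose proof (Cmod_ge_0 (u k)); lra | lra].
  - apply (bdd_two _ n).
    + intros k H1 H2; unfold Hz, Hop, truncate.
      destruct (Z_le_dec (k + 1) n), (Z_le_dec (k - 1) n), (Z_le_dec k n); try lia.
      * ring.
      * apply (E k); lia.
    + unfold Hz, Hop, truncate.
      replace (n + 1 - 1)%Z with n by lia.
      destruct (Z_le_dec (n + 1) n), (Z_le_dec (n - 1) n), (Z_le_dec n n),
        (Z_le_dec (n + 1 + 1) n); try lia.
      assert (S := Hz_step V z u (n + 1) (E (n + 1)%Z ltac:(lia))).
      replace (n + 1 - 1)%Z with n in S by lia; rewrite S.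
      right; rewrite Rplus_comm; f_equal; f_equal.
      * rewrite <- (Cmod_opp (u n)); f_equal; ring.
      * f_equal; ring.
Qed.

Lemma tail_term V z D u n m : good V z D -> l2 u ->
  (forall k, (2 <= k)%Z -> Hz V z u k = RtoC 0) -> (1 <= n < m)%Z ->
  Cmod (u m) ^ 2 <= D * (Cmod (u n) ^ 2 + Cmod (u (n + 1)%Z) ^ 2).
Proof.
  intros G Lu E Hn; assert (B := bdd_term _ _ m (tail_bdd V z D u n G Lu E ltac:(lia))).
  unfold truncate in B; destruct (Z_le_dec m n); [lia | exact B].
Qed.

(** If [S n] is the mass on [[n, oo)], then [tail_bdd] gives [S (n + 2) <= D * (S n - S (n + 2))];
    solving for [S (n + 2)] yields a fixed contraction factor per two sites. *)
Lemma tail_sum_step V z D u n B : good V z D -> l2 u ->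
  (forall k, (2 <= k)%Z -> Hz V z u k = RtoC 0) -> (1 <= n)%Z ->
  (forall len, zsum (fun k => Cmod (u k) ^ 2) n len <= B) ->
  forall len, zsum (fun k => Cmod (u k) ^ 2) (n + 2) len <= D / (1 + D) * B.
Proof.
  intros G Lu E Hn HB len.
  assert (HD := proj1 G).
  specialize (HB (2 + len)%nat); rewrite zsum_split in HB; cbn [zsum] in HB.
  replace (n + Z.of_nat 0)%Z with n in HB by lia.
  replace (n + Z.of_nat 1)%Z with (n + 1)%Z in HB by lia.
  replace (n + Z.of_nat 2)%Z with (n + 2)%Z in HB by lia.
  assert (T := tail_bdd V z D u n G Lu E Hn (n + 2)%Z len).
  assert (Q : zsum (fun k => Cmod (u k) ^ 2) (n + 2) len
     <= zsum (fun k => Cmod (truncate n u k) ^ 2) (n + 2) len).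
  { apply zsum_le_in; intros k Hk; unfold truncate; destruct (Z_le_dec k n); [lia | lra]. }
  set (s := zsum (fun k => Cmod (u k) ^ 2) (n + 2) len) in *.
  apply Rmult_le_reg_l with (1 + D); [lra |].
  replace ((1 + D) * (D / (1 + D) * B)) with (D * B) by (field; lra).
  nra.
Qed.

Lemma exp_pow x n : exp x ^ n = exp (x * INR n).
Proof.
  induction n; [simpl; now rewrite Rmult_0_r, exp_0 |].
  simpl pow; rewrite IHn, <- exp_plus, S_INR; f_equal; ring.
Qed.

Lemma exp_poly q y : 0 < y -> exp (- y) * y ^ q <= INR q ^ q.
Proof.
  intros Hy; destruct q as [| q'].
  - simpl; rewrite !Rmult_1_r, <- exp_0; left; apply exp_increasing; lra.
  - set (q := S q'); assert (Pq : 0 < INR q) by (apply lt_0_INR; unfold q; lia).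
    assert (H : (y / INR q) ^ q <= exp y).
    { replace (exp y) with (exp (y / INR q) ^ q).
      - apply pow_incr; split; [apply Rmult_le_pos; [lra | left; now apply Rinv_0_lt_compat] |].
        pose proof (exp_ineq1_le (y / INR q)); lra.
      - rewrite exp_pow; f_equal; field; lra. }
    rewrite exp_Ropp.
    apply Rmult_le_reg_l with (exp y); [apply exp_pos |].
    rewrite <- Rmult_assoc, Rinv_r, Rmult_1_l by (pose proof (exp_pos y); lra).
    replace (y ^ q) with ((y / INR q) ^ q * INR q ^ q)
      by (rewrite <- Rpow_mult_distr; f_equal; field; lra).
    apply Rmult_le_compat_r; [apply pow_le; lra | easy].
Qed.

(** [D / (1 + D)] is at most [exp (- / (1 + D))], so decay sets in at distance [1 + D]. What matters
    is a constant polynomial in [D], since [D] is a power of [T] on the horizontal sides. *)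
Lemma geom_poly D j q : 0 <= D -> (0 < j)%nat ->
  (D / (1 + D)) ^ j * INR j ^ q <= (INR q * (1 + D)) ^ q.
Proof.
  intros HD Hj; assert (Pj : 0 < INR j) by now apply lt_0_INR.
  pose (y := INR j / (1 + D)).
  assert (Hy : 0 < y) by (apply Rdiv_lt_0_compat; lra).
  assert (H1 : (D / (1 + D)) ^ j <= exp (- y)).
  { replace (exp (- y)) with (exp (- / (1 + D)) ^ j).
    - apply pow_incr; split; [apply Rmult_le_pos; [lra | left; apply Rinv_0_lt_compat; lra] |].
      replace (D / (1 + D)) with (1 + - / (1 + D)) by (field; lra).
      apply exp_ineq1_le.
    - rewrite exp_pow; f_equal; unfold y; field; lra. }
  assert (H2 := exp_poly q y Hy).
  replace (INR j ^ q) with (y ^ q * (1 + D) ^ q)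
    by (rewrite <- Rpow_mult_distr; f_equal; unfold y; field; lra).
  rewrite Rpow_mult_distr, <- Rmult_assoc.
  apply Rmult_le_compat_r; [apply pow_le; lra |].
  apply Rle_trans with (2 := H2); apply Rmult_le_compat_r; [apply pow_le; lra | easy].
Qed.

Lemma decay V z D u q : good V z D -> l2 u -> (forall n, Hz V z u n = dlt 1 n) ->
  forall n, (6 <= n)%Z -> Cmod (u n) ^ 2 * IZR n ^ q <= D * (4 * INR q * (1 + D)) ^ q.
Proof.
  intros G Lu E n Hn.
  assert (HD := proj1 G).
  assert (E2 : forall k, (2 <= k)%Z -> Hz V z u k = RtoC 0).
  { intros k Hk; rewrite E; unfold dlt; now rewrite delta_neq by lia. }
  assert (B0 : bdd u (D * 1)).
  { apply (proj2 G); [easy |]; apply (bdd_ext (dlt 1)); [intros; now rewrite E | apply bdd_dlt]. }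
  assert (It : forall j len, zsum (fun k => Cmod (u k) ^ 2) (2 + 2 * Z.of_nat j) len
     <= (D / (1 + D)) ^ j * D).
  { induction j; intros len.
    - rewrite pow_O, Rmult_1_l; specialize (B0 (2 + 2 * Z.of_nat 0)%Z len); lra.
    - replace (2 + 2 * Z.of_nat (S j))%Z with (2 + 2 * Z.of_nat j + 2)%Z by lia.
      simpl pow; rewrite Rmult_assoc.
      apply (tail_sum_step V z D u _ _ G Lu E2); [lia | exact IHj]. }
  (* From site 2, [j] double steps do not pass beyond [n], and [6 <= n] makes [n <= 4 * j]. *)
  pose (j := Z.to_nat ((n - 2) / 2)).
  assert (Hdm := Z_div_mod_eq_full (n - 2) 2); assert (Hm := Z.mod_pos_bound (n - 2) 2 ltac:(lia)).
  assert (Hj1 : (2 + 2 * Z.of_nat j <= n)%Z) by (unfold j; lia).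
  assert (Hj2 : (n <= 4 * Z.of_nat j)%Z) by (unfold j; lia).
  assert (T : Cmod (u n) ^ 2 <= (D / (1 + D)) ^ j * D).
  { eapply Rle_trans; [| apply (It j (S (Z.to_nat (n - (2 + 2 * Z.of_nat j)))))].
    apply (zsum_ge_term (fun k => Cmod (u k) ^ 2)); [intros; apply pow2_ge_0 | lia]. }
  assert (N : IZR n <= 4 * INR j).
  { rewrite INR_IZR_INZ; change 4 with (IZR 4); rewrite <- mult_IZR; now apply IZR_le. }
  assert (N0 : 0 <= IZR n) by (apply (IZR_le 0); lia).
  assert (P : 0 <= (D / (1 + D)) ^ j * D).
  { apply Rmult_le_pos; [apply pow_le, Rmult_le_pos; [lra | left; apply Rinv_0_lt_compat; lra] | lra]. }
  apply Rle_trans with ((D / (1 + D)) ^ j * D * (4 * INR j) ^ q).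
  - apply Rmult_le_compat; [apply pow2_ge_0 | now apply pow_le | easy | now apply pow_incr].
  - assert (Gp := geom_poly D j q HD ltac:(lia)).
    replace (4 * INR q * (1 + D)) with (4 * (INR q * (1 + D))) by ring.
    rewrite !(Rpow_mult_distr 4).
    assert (0 <= 4 ^ q) by (apply pow_le; lra).
    replace ((D / (1 + D)) ^ j * D * (4 ^ q * INR j ^ q))
      with (D * 4 ^ q * ((D / (1 + D)) ^ j * INR j ^ q)) by ring.
    replace (D * (4 ^ q * (INR q * (1 + D)) ^ q)) with (D * 4 ^ q * (INR q * (1 + D)) ^ q) by ring.
    apply Rmult_le_compat_l; [now apply Rmult_le_pos | easy].
Qed.

(** * Solutions on the right half-line *)

Section halfline.
Variables (V : Z -> R) (Bv K : R) (z : C) (u : Z -> C).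
Hypothesis HV : bounded_by V Bv.
Hypothesis HK : 1 <= K.
Hypothesis Hz1 : 0 < snd z <= 1.
Hypothesis Hz2 : Rabs (fst z) <= K.
Hypothesis Lu : l2 u.
Hypothesis Eu : forall n, Hz V z u n = dlt 1 n.

Let e := / snd z.
Let G := Bv + K + 1.

Lemma e_ge_1 : 1 <= e.
Proof. unfold e; rewrite <- Rinv_1; apply Rinv_le_contravar; lra. Qed.

Lemma good_e : good V z (e ^ 2).
Proof. unfold e; rewrite pow_inv; apply good_nonreal; lra. Qed.

Lemma Cmod_z_le : Cmod z <= K + 1.
Proof.
  replace z with (Cplus (RtoC (fst z)) (Cmult Ci (RtoC (snd z))))
    by (apply injective_projections; simpl; ring).
  eapply Rle_trans; [apply Cmod_triangle |].
  rewrite Cmod_mult, Cmod_Ci, !Cmod_R, (Rabs_pos_eq (snd z)); lra.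
Qed.

Lemma G_ge : 0 <= Bv /\ 2 <= G.
Proof.
  assert (0 <= Bv) by (eapply Rle_trans; [apply Rabs_pos | apply (HV 0%Z)]).
  unfold G; lra.
Qed.

Lemma u_hom k : (2 <= k)%Z -> Hz V z u k = RtoC 0.
Proof. intros Hk; rewrite Eu; unfold dlt; now rewrite delta_neq by lia. Qed.

Lemma u_le n : Cmod (u n) <= e.
Proof.
  pose proof e_ge_1; apply pow2_le_inv; [lra |].
  apply (bdd_term u); rewrite <- (Rmult_1_r (e ^ 2)); apply good_e; [easy |].
  apply (bdd_ext (dlt 1)); [intros; now rewrite Eu | apply bdd_dlt].
Qed.

(** Comes from the identity between [Im u(1)] and [Im z] times the squared norm of [u]: this is
    [green_sum] with source [delta_1] and vanishing flux at infinity. *)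
Lemma Im_u1 a m : snd z * zsum (fun n => Cmod (u n) ^ 2) a m <= snd (u 1%Z).
Proof.
  apply le_epsilon; intros eta Heta.
  destruct (flux_tendsto_0 u (eta / 2) Lu ltac:(lra)) as [N HN].
  pose (b := (Z.min a 0 - Z.of_nat N - 1)%Z).
  pose (k := Z.to_nat (Z.max (a + Z.of_nat m) 2 + Z.of_nat N + 1 - b)).
  apply Rle_trans with (snd z * zsum (fun n => Cmod (u n) ^ 2) b k).
  { apply Rmult_le_compat_l; [lra |].
    apply zsum_subset; [intros; apply pow2_ge_0 | unfold b; lia | unfold k, b; lia]. }
  assert (H := green_sum V z u b k).
  rewrite (zsum_single _ 1%Z) in H.
  - rewrite Eu in H; unfold dlt in H; rewrite delta_eq in H.
    pose proof (HN (b + Z.of_nat k - 1)%Z ltac:(unfold k, b; lia)) as F1.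
    pose proof (HN (b - 1)%Z ltac:(unfold b; lia)) as F2.
    apply Rabs_le_between in F1; apply Rabs_le_between in F2.
    set (s := zsum _ b k) in *.
    unfold Im in H; simpl in H; lra.
  - intros n Hn; rewrite Eu; unfold dlt; rewrite delta_neq by easy; unfold Im; simpl; ring.
  - unfold b, k; lia.
Qed.

(** The equation at site 1 has right-hand side 1, so [u] cannot be small at 0, 1 and 2 at once;
    [Im_u1] converts this mass into a lower bound for [u 1], which makes division by [u 1]
    affordable. *)
Lemma u1_lower : 1 <= 3 * G ^ 2 * e * Cmod (u 1%Z).
Proof.
  destruct G_ge as [HB HG].
  assert (H := Im_u1 0 3); cbn [zsum] in H; simpl Z.add in H.
  assert (E := Eu 1); unfold dlt in E; rewrite delta_eq in E.
  assert (S1 : 1 <= Cmod (u 2%Z) + Cmod (u 0%Z) + G * Cmod (u 1%Z)).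
  { rewrite <- Cmod_1, <- E; unfold Hz, Hop; simpl Z.add; simpl Z.sub.
    replace (Cminus _ _) with (Cplus (Cplus (u 2%Z) (u 0%Z))
      (Cmult (Cminus (RtoC (V 1%Z)) z) (u 1%Z))) by ring.
    eapply Rle_trans; [apply Cmod_triangle |].
    apply Rplus_le_compat; [apply Cmod_triangle |].
    rewrite Cmod_mult; apply Rmult_le_compat_r; [apply Cmod_ge_0 |].
    eapply Rle_trans; [apply Cmod_triangle |].
    rewrite Cmod_opp, Cmod_R; specialize (HV 1%Z); pose proof Cmod_z_le; unfold G; lra. }
  pose proof (Cmod_ge_0 (u 0%Z)); pose proof (Cmod_ge_0 (u 1%Z)); pose proof (Cmod_ge_0 (u 2%Z)).
  set (x := Cmod (u 0%Z)) in *; set (y := Cmod (u 1%Z)) in *; set (w := Cmod (u 2%Z)) in *.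
  assert (S2 : 1 <= G * (x + y + w)).
  { assert (0 <= (G - 1) * (x + w)) by (apply Rmult_le_pos; lra); lra. }
  assert (S3 : 1 <= 3 * G ^ 2 * (x ^ 2 + y ^ 2 + w ^ 2)).
  { assert ((x + y + w) ^ 2 <= 3 * (x ^ 2 + y ^ 2 + w ^ 2)).
    { pose proof (pow2_ge_0 (x - y)); pose proof (pow2_ge_0 (y - w)); pose proof (pow2_ge_0 (x - w)); lra. }
    assert (1 <= (G * (x + y + w)) ^ 2) by (simpl; nra).
    rewrite Rpow_mult_distr in H4.
    assert (Q := Rmult_le_compat_l _ _ _ (pow2_ge_0 G) H3); lra. }
  assert (Hs : snd z * (x ^ 2 + y ^ 2 + w ^ 2) <= y).
  { assert (B := snd_le_Cmod (u 1%Z)); apply Rabs_le_between in B.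
    fold x y w in H; fold y in B; lra. }
  apply Rle_trans with (1 := S3).
  replace (3 * G ^ 2 * e * y) with (3 * G ^ 2 * (e * y)) by ring.
  apply Rmult_le_compat_l; [pose proof (pow2_ge_0 G); lra |].
  apply Rmult_le_reg_l with (snd z); [lra |].
  replace (snd z * (e * y)) with y by (unfold e; field; lra); easy.
Qed.

(** The state [(f (k + 1), f (k + 2))] of the recurrence started with [f 1 = 0] and [f 2 = 1]; hence
    the shift by 2 in the argument of [V]. *)
Fixpoint fwd_pair (k : nat) : C * C :=
  match k with
  | O => (RtoC 0, RtoC 1)
  | S k' => let p := fwd_pair k' in
      (snd p, Cminus (Cmult (Cminus z (RtoC (V (Z.of_nat k' + 2)))) (snd p)) (fst p))
  end.

(* The solution of [(H-z) f = delta_1] vanishing on (-oo, 1]. *)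
Definition fwd (n : Z) : C := if Z_le_dec n 1 then RtoC 0 else fst (fwd_pair (Z.to_nat (n - 1))).

Lemma fwd_2 : fwd 2 = RtoC 1.
Proof. reflexivity. Qed.

Lemma fwd_le n : (n <= 1)%Z -> fwd n = RtoC 0.
Proof. unfold fwd; destruct (Z_le_dec n 1); [easy | lia]. Qed.

Lemma fwd_fst k : fwd (1 + Z.of_nat k) = fst (fwd_pair k).
Proof.
  unfold fwd; destruct (Z_le_dec (1 + Z.of_nat k) 1).
  - replace k with 0%nat by lia; easy.
  - do 2 f_equal; lia.
Qed.

Lemma fwd_Hz n : Hz V z fwd n = dlt 1 n.
Proof.
  unfold Hz, Hop, dlt; destruct (Z_lt_le_dec n 1) as [H | H].
  - rewrite !fwd_le, delta_neq by lia; ring.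
  - destruct (Z.eq_dec n 1) as [-> | H1].
    + simpl Z.add; simpl Z.sub; rewrite fwd_2, !fwd_le, delta_eq by lia; ring.
    + rewrite delta_neq by easy; pose (k := Z.to_nat (n - 2)).
      replace (n - 1)%Z with (1 + Z.of_nat k)%Z by (unfold k; lia).
      replace (n + 1)%Z with (1 + Z.of_nat (S (S k)))%Z by (unfold k; lia).
      replace (fwd n) with (fwd (1 + Z.of_nat (S k))) by (f_equal; unfold k; lia).
      rewrite !fwd_fst; cbn [fwd_pair fst snd].
      replace (Z.of_nat k + 2)%Z with n by (unfold k; lia); ring.
Qed.

(* The solution of [(H-z) f = 0] that is square-summable at [-oo]. *)
Definition left_sol (n : Z) : C := Cminus (u n) (fwd n).

Lemma left_sol_Hz n : Hz V z left_sol n = RtoC 0.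
Proof.
  transitivity (Cminus (Hz V z u n) (Hz V z fwd n)).
  - unfold Hz, Hop, left_sol; ring.
  - rewrite Eu, fwd_Hz; ring.
Qed.

Lemma left_sol_le n : (n <= 1)%Z -> left_sol n = u n.
Proof. intros H; unfold left_sol; rewrite fwd_le by easy; ring. Qed.

(** Two solutions of the same recurrence have a constant Wronskian. It is read off at [n = 1], where
    [left_sol] agrees with [u] at site 1 and with [u - 1] at site 2. *)
Lemma wronskian n : (1 <= n)%Z ->
  Cminus (Cmult (left_sol n) (u (n + 1)%Z)) (Cmult (u n) (left_sol (n + 1))) = u 1%Z.
Proof.
  intros Hn; replace n with (1 + Z.of_nat (Z.to_nat (n - 1)))%Z by lia.
  induction (Z.to_nat (n - 1)) as [| k IH].
  - simpl Z.add; rewrite left_sol_le by lia; unfold left_sol; rewrite fwd_2; ring.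
  - set (m := (1 + Z.of_nat k)%Z) in *.
    replace (1 + Z.of_nat (S k))%Z with (m + 1)%Z by (unfold m; lia).
    rewrite (Hz_step V z u (m + 1)), (Hz_step V z left_sol (m + 1)).
    + replace (m + 1 - 1)%Z with m by lia; rewrite <- IH; ring.
    + apply left_sol_Hz.
    + apply u_hom; unfold m; lia.
Qed.

(** For [1 <= m] and as a function of [k], this is [u 1] times the Green function with source
    [m]. *)
Definition glue (m k : Z) : C :=
  if Z_le_dec k m then Cmult (left_sol k) (u m) else Cmult (u k) (left_sol m).

Lemma glue_Hz m k : (1 <= m)%Z -> Hz V z (glue m) k = Cmult (u 1%Z) (dlt m k).
Proof.
  intros Hm; unfold dlt; destruct (Z.eq_dec k m) as [-> | Hk].
  - rewrite delta_eq; unfold Hz, Hop, glue.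
    destruct (Z_le_dec (m + 1) m), (Z_le_dec (m - 1) m), (Z_le_dec m m); try lia.
    rewrite Cmult_1_r, <- (wronskian m Hm), (Hz_step V z left_sol m (left_sol_Hz m)); ring.
  - rewrite delta_neq by easy; unfold Hz, Hop, glue.
    destruct (Z_le_dec (k + 1) m), (Z_le_dec (k - 1) m), (Z_le_dec k m); try lia.
    + transitivity (Cmult (Hz V z left_sol k) (u m)); [unfold Hz, Hop; ring |].
      rewrite left_sol_Hz; ring.
    + replace (k - 1)%Z with m by lia.
      rewrite (Hz_step V z u k (u_hom k ltac:(lia))).
      replace (k - 1)%Z with m by lia; ring.
    + transitivity (Cmult (Hz V z u k) (left_sol m)); [unfold Hz, Hop; ring |].
      rewrite u_hom by lia; ring.
Qed.

Lemma glue_bound m k : (1 <= m)%Z -> Cmod (glue m k) <= e * Cmod (u 1%Z).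
Proof.
  intros Hm; pose proof e_ge_1; pose proof (Cmod_ge_0 (u 1%Z)).
  apply pow2_le_inv; [apply Rmult_le_pos; lra |].
  rewrite Rpow_mult_distr; apply (bdd_term (glue m)), good_e.
  - apply (l2_eventually_dominated _ u (Cmod (u m) + Cmod (left_sol m)) 1 m Lu).
    intros n [Hn | Hn]; unfold glue; destruct (Z_le_dec n m); try lia;
      rewrite Cmod_mult, ?left_sol_le by lia;
      pose proof (Cmod_ge_0 (u m)); pose proof (Cmod_ge_0 (left_sol m));
      pose proof (Cmod_ge_0 (u n)); nra.
  - apply (bdd_ext (fun n => Cmult (u 1%Z) (dlt m n))).
    + intros n; symmetry; now apply glue_Hz.
    + rewrite <- (Rmult_1_r (Cmod (u 1%Z) ^ 2)); apply bdd_scal, bdd_dlt.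
Qed.

(** [glue_bound] covers the products with [j <= i]. The remaining one, [u n * left_sol (n + 1)],
    differs from a covered one by the Wronskian [u 1], whence the factor 2. *)
Lemma product_bound n i j : (1 <= n)%Z -> (n <= i <= n + 1)%Z -> (n <= j <= n + 1)%Z ->
  Cmod (u i) * Cmod (left_sol j) <= 2 * e * Cmod (u 1%Z).
Proof.
  intros Hn Hi Hj; pose proof e_ge_1; pose proof (Cmod_ge_0 (u 1%Z)).
  rewrite <- Cmod_mult.
  destruct (Z_le_dec j i) as [L | L].
  - assert (B := glue_bound i j ltac:(lia)); unfold glue in B.
    destruct (Z_le_dec j i); [| lia]; rewrite Cmult_comm; nra.
  - replace i with n by lia; replace j with (n + 1)%Z by lia.
    assert (B := glue_bound (n + 1) n ltac:(lia)); unfold glue in B.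
    destruct (Z_le_dec n (n + 1)); [| lia].
    replace (Cmult (u n) (left_sol (n + 1))) with
      (Cplus (Cmult (left_sol n) (u (n + 1)%Z)) (Copp (u 1%Z)))
      by (rewrite <- (wronskian n Hn); ring).
    eapply Rle_trans; [apply Cmod_triangle |]; rewrite Cmod_opp; nra.
Qed.

(** [fwd] vanishes at site 1 and [left_sol] equals [u 1] there, so the two form a basis whose
    coefficients are read off at sites 1 and 2. *)
Lemma solution_decomposition psi : u 1%Z <> RtoC 0 ->
  (forall n, (2 <= n)%Z -> Hz V z psi n = RtoC 0) ->
  exists al be, Cmult be (u 1%Z) = psi 1%Z /\ al = Cminus (psi 2%Z) (Cmult be (left_sol 2)) /\
    forall n, (1 <= n)%Z -> psi n = Cplus (Cmult al (fwd n)) (Cmult be (left_sol n)).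
Proof.
  intros Hu Hpsi; pose (be := Cdiv (psi 1%Z) (u 1%Z)).
  exists (Cminus (psi 2%Z) (Cmult be (left_sol 2))), be.
  assert (Hbe : Cmult be (u 1%Z) = psi 1%Z) by (unfold be; field; easy).
  split; [easy | split; [easy |]].
  set (al := Cminus (psi 2%Z) (Cmult be (left_sol 2))).
  assert (H : forall k, psi (1 + Z.of_nat k)%Z = Cplus (Cmult al (fwd (1 + Z.of_nat k))) (Cmult be (left_sol (1 + Z.of_nat k)))
    /\ psi (1 + Z.of_nat k + 1)%Z = Cplus (Cmult al (fwd (1 + Z.of_nat k + 1))) (Cmult be (left_sol (1 + Z.of_nat k + 1)))).
  { induction k as [| k [IH1 IH2]].
    - simpl Z.add; rewrite fwd_2, fwd_le, (left_sol_le 1), Hbe by lia; unfold al; split; ring.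
    - set (m := (1 + Z.of_nat k)%Z) in *.
      replace (1 + Z.of_nat (S k))%Z with (m + 1)%Z by (unfold m; lia).
      split; [exact IH2 |].
      rewrite (Hz_step V z psi (m + 1)) by (apply Hpsi; unfold m; lia).
      rewrite (Hz_step V z left_sol (m + 1)) by apply left_sol_Hz.
      rewrite (Hz_step V z fwd (m + 1))
        by (rewrite fwd_Hz; unfold dlt; rewrite delta_neq by (unfold m; lia); easy).
      replace (m + 1 - 1)%Z with m by lia; rewrite IH1, IH2; ring. }
  intros n Hn; replace n with (1 + Z.of_nat (Z.to_nat (n - 1)))%Z by lia; apply H.
Qed.

(** Since [fwd = u - left_sol], also [psi = al * u + (be - al) * left_sol]. Against [u i] the first
    part is controlled by the a priori bound on [u], the second by [product_bound]. *)
Lemma solution_green_bound psi M n i j :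
  (forall n, (2 <= n)%Z -> Hz V z psi n = RtoC 0) ->
  Cmod (psi 1%Z) <= M -> Cmod (psi 2%Z) <= M ->
  (1 <= n)%Z -> (n <= i <= n + 1)%Z -> (n <= j <= n + 1)%Z ->
  Cmod (u i) * Cmod (psi j) <= 50 * G ^ 2 * M * e ^ 4.
Proof.
  intros Hpsi HM1 HM2 Hn Hi Hj.
  destruct G_ge as [HB HG]; pose proof e_ge_1 as He.
  assert (H1 := u1_lower); assert (Pu := Cmod_ge_0 (u 1%Z)).
  assert (Hu : u 1%Z <> RtoC 0).
  { intros E; rewrite E, Cmod_0, Rmult_0_r in H1; lra. }
  destruct (solution_decomposition psi Hu Hpsi) as (al & be & Hbe & Hal & E).
  assert (HM : 0 <= M) by (eapply Rle_trans; [apply Cmod_ge_0 | exact HM1]).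
  set (g := 3 * G ^ 2) in *.
  assert (Hg : 1 <= g) by (unfold g; nra).
  assert (Pbe := Cmod_ge_0 be).
  assert (B1 : Cmod be <= g * e * M).
  { rewrite <- Hbe, Cmod_mult in HM1.
    apply Rle_trans with (g * e * Cmod (u 1%Z) * Cmod be); [nra |].
    replace (g * e * Cmod (u 1%Z) * Cmod be) with (g * e * (Cmod be * Cmod (u 1%Z))) by ring.
    apply Rmult_le_compat_l; [nra | easy]. }
  assert (B2 : Cmod (left_sol 2) <= 2 * e).
  { unfold left_sol; rewrite fwd_2; eapply Rle_trans; [apply Cmod_triangle |].
    rewrite Cmod_opp, Cmod_1; pose proof (u_le 2); lra. }
  assert (Hge : 1 <= g * e) by nra.
  assert (Hgee : M <= g * e ^ 2 * M) by (simpl; nra).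
  assert (B3 : Cmod al <= 3 * (g * e ^ 2 * M)).
  { rewrite Hal; eapply Rle_trans; [apply Cmod_triangle |].
    rewrite Cmod_opp, Cmod_mult.
    assert (Cmod be * Cmod (left_sol 2) <= g * e * M * (2 * e))
      by (apply Rmult_le_compat; auto using Cmod_ge_0).
    simpl in *; lra. }
  assert (B4 : Cmod (Cminus be al) <= 4 * (g * e ^ 2 * M)).
  { eapply Rle_trans; [apply Cmod_triangle |]; rewrite Cmod_opp.
    assert (g * e * M <= g * e ^ 2 * M) by (simpl; nra). lra. }
  assert (Ui := u_le i); assert (Uj := u_le j); assert (U1 := u_le 1).
  assert (Pi := Cmod_ge_0 (u i)); assert (Pj := Cmod_ge_0 (u j)).
  assert (PB := product_bound n i j Hn Hi Hj).
  replace (psi j) with (Cplus (Cmult al (u j)) (Cmult (Cminus be al) (left_sol j)))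
    by (rewrite (E j) by lia; unfold left_sol; ring).
  set (X := g * e ^ 2 * M) in *.
  assert (PX : 0 <= X) by lra.
  apply Rle_trans with (Cmod (u i) * (Cmod al * Cmod (u j) + Cmod (Cminus be al) * Cmod (left_sol j))).
  { apply Rmult_le_compat_l; [easy |].
    eapply Rle_trans; [apply Cmod_triangle |]; rewrite !Cmod_mult; lra. }
  assert (T1 : Cmod al * (Cmod (u i) * Cmod (u j)) <= 3 * X * (e * e)).
  { apply Rmult_le_compat; auto using Cmod_ge_0; [now apply Rmult_le_pos |].
    now apply Rmult_le_compat. }
  assert (T2 : Cmod (Cminus be al) * (Cmod (u i) * Cmod (left_sol j)) <= 4 * X * (2 * e * e)).
  { apply Rmult_le_compat; auto using Cmod_ge_0; [apply Rmult_le_pos; auto using Cmod_ge_0 |].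
    apply Rle_trans with (1 := PB); apply Rmult_le_compat_l; lra. }
  (* 3 from the [u] part and 8 from the [left_sol] part; with [g = 3 * G ^ 2] this makes 33, below
     50. *)
  apply Rle_trans with (11 * X * (e * e)); [lra |].
  unfold X, g; simpl.
  assert (0 <= G * G * M * (e * e) * (e * e)) by (repeat apply Rmult_le_pos; lra).
  lra.
Qed.

End halfline.

(** * Transfer matrices and their operator norms *)

Lemma M2app_mul A B v : M2app (M2mul A B) v = M2app A (M2app B v).
Proof.
  destruct A as [[a b] [c d]], B as [[a' b'] [c' d']], v as [x y]; simpl.
  f_equal; ring.
Qed.

Lemma RtoC_m1 : RtoC (-1) = Copp (RtoC 1).
Proof. apply injective_projections; simpl; ring. Qed.

Lemma vnorm_sq v : vnorm v ^ 2 = Cmod (fst v) ^ 2 + Cmod (snd v) ^ 2.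
Proof.
  unfold vnorm; apply pow2_sqrt; apply Rplus_le_le_0_compat; apply pow2_ge_0.
Qed.

Lemma vnorm_nonneg v : 0 <= vnorm v.
Proof. apply sqrt_pos. Qed.

Lemma fst_le_vnorm v : Cmod (fst v) <= vnorm v.
Proof.
  apply pow2_le_inv; [apply vnorm_nonneg |]; rewrite vnorm_sq.
  pose proof (pow2_ge_0 (Cmod (snd v))); lra.
Qed.

Lemma snd_le_vnorm v : Cmod (snd v) <= vnorm v.
Proof.
  apply pow2_le_inv; [apply vnorm_nonneg |]; rewrite vnorm_sq.
  pose proof (pow2_ge_0 (Cmod (fst v))); lra.
Qed.

Lemma vnorm_le_sum v : vnorm v <= Cmod (fst v) + Cmod (snd v).
Proof.
  pose proof (Cmod_ge_0 (fst v)); pose proof (Cmod_ge_0 (snd v)).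
  apply pow2_le_inv; [lra |]; rewrite vnorm_sq; nra.
Qed.

Lemma vnorm_triangle p q :
  vnorm (Cplus (fst p) (fst q), Cplus (snd p) (snd q)) <= vnorm p + vnorm q.
Proof.
  pose proof (vnorm_nonneg p) as P; pose proof (vnorm_nonneg q) as Q.
  apply pow2_le_inv; [lra |]; rewrite vnorm_sq; simpl fst; simpl snd.
  pose proof (Cmod_triangle (fst p) (fst q)) as T1; pose proof (Cmod_triangle (snd p) (snd q)) as T2.
  pose proof (vnorm_sq p) as Sp; pose proof (vnorm_sq q) as Sq.
  pose proof (Cmod_ge_0 (fst p)); pose proof (Cmod_ge_0 (snd p)).
  pose proof (Cmod_ge_0 (fst q)); pose proof (Cmod_ge_0 (snd q)).
  set (a := Cmod (fst p)) in *; set (b := Cmod (snd p)) in *.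
  set (c := Cmod (fst q)) in *; set (d := Cmod (snd q)) in *.
  assert (CS : a * c + b * d <= vnorm p * vnorm q).
  { apply pow2_le_inv; [now apply Rmult_le_pos |].
    rewrite Rpow_mult_distr, Sp, Sq; pose proof (pow2_ge_0 (a * d - b * c)); nra. }
  assert (U1 : Cmod (Cplus (fst p) (fst q)) ^ 2 <= (a + c) ^ 2) by (apply pow_incr; split; [apply Cmod_ge_0 | easy]).
  assert (U2 : Cmod (Cplus (snd p) (snd q)) ^ 2 <= (b + d) ^ 2) by (apply pow_incr; split; [apply Cmod_ge_0 | easy]).
  nra.
Qed.

Definition entry_sum (A : M2) : R :=
  Cmod (fst (fst A)) + Cmod (snd (fst A)) + Cmod (fst (snd A)) + Cmod (snd (snd A)).

Lemma M2app_entry_bound A v : vnorm v = 1 -> vnorm (M2app A v) <= entry_sum A.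
Proof.
  intros Hv; destruct A as [[a b] [c d]]; unfold entry_sum; simpl.
  pose proof (fst_le_vnorm v) as F; pose proof (snd_le_vnorm v) as S; rewrite Hv in F, S.
  eapply Rle_trans; [apply vnorm_le_sum |]; simpl.
  eapply Rle_trans; [apply Rplus_le_compat; apply Cmod_triangle |].
  rewrite !Cmod_mult.
  pose proof (Cmod_ge_0 a); pose proof (Cmod_ge_0 b); pose proof (Cmod_ge_0 c); pose proof (Cmod_ge_0 d).
  nra.
Qed.

Definition e1 : C * C := (RtoC 1, RtoC 0).
Definition e2 : C * C := (RtoC 0, RtoC 1).

Lemma vnorm_e1 : vnorm e1 = 1.
Proof.
  unfold vnorm, e1; simpl fst; simpl snd; rewrite Cmod_1, Cmod_0.
  replace (1 ^ 2 + 0 ^ 2) with 1 by ring; apply sqrt_1.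
Qed.

Lemma vnorm_e2 : vnorm e2 = 1.
Proof.
  unfold vnorm, e2; simpl fst; simpl snd; rewrite Cmod_1, Cmod_0.
  replace (0 ^ 2 + 1 ^ 2) with 1 by ring; apply sqrt_1.
Qed.

(** The supremum is finite, so taking [real] loses nothing: [entry_sum] bounds it above and the
    value at [e1] bounds it below. *)
Lemma opnorm_spec A :
  (forall v, vnorm v = 1 -> vnorm (M2app A v) <= opnorm A) /\
  (forall b, (forall v, vnorm v = 1 -> vnorm (M2app A v) <= b) -> opnorm A <= b).
Proof.
  unfold opnorm.
  destruct (Lub_Rbar_correct (fun x => exists v, vnorm v = 1 /\ x = vnorm (M2app A v))) as [Hub Hlub].
  set (l := Lub_Rbar _) in *.
  assert (H1 : forall b, (forall v, vnorm v = 1 -> vnorm (M2app A v) <= b) -> Rbar_le l b).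
  { intros b Hb; apply Hlub; intros x (v & Hv & ->); now apply Hb. }
  assert (H2 : forall v, vnorm v = 1 -> Rbar_le (vnorm (M2app A v)) l).
  { intros v Hv; apply Hub; now exists v. }
  assert (H3 := H1 _ (M2app_entry_bound A)); assert (H4 := H2 e1 vnorm_e1).
  destruct l as [r | |]; simpl in *; easy.
Qed.

Definition M2diff (A B : M2) : M2 :=
  ((Cminus (fst (fst A)) (fst (fst B)), Cminus (snd (fst A)) (snd (fst B))),
   (Cminus (fst (snd A)) (fst (snd B)), Cminus (snd (snd A)) (snd (snd B)))).

Lemma opnorm_lipschitz_le A B : opnorm A <= opnorm B + entry_sum (M2diff A B).
Proof.
  apply (proj2 (opnorm_spec A)); intros v Hv.
  replace (M2app A v) with (Cplus (fst (M2app B v)) (fst (M2app (M2diff A B) v)),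
      Cplus (snd (M2app B v)) (snd (M2app (M2diff A B) v))).
  - eapply Rle_trans; [apply vnorm_triangle |]; apply Rplus_le_compat.
    + now apply opnorm_spec.
    + now apply M2app_entry_bound.
  - destruct A as [[a b] [c d]], B as [[a' b'] [c' d']], v as [x y]; simpl; f_equal; ring.
Qed.

Lemma entry_sum_diff_sym A B : entry_sum (M2diff A B) = entry_sum (M2diff B A).
Proof.
  assert (H : forall x y, Cmod (Cminus x y) = Cmod (Cminus y x)).
  { intros x y; rewrite <- Cmod_opp; f_equal; ring. }
  unfold entry_sum, M2diff; simpl; now rewrite (H (fst (fst A))), (H (snd (fst A))),
    (H (fst (snd A))), (H (snd (snd A))).
Qed.

(** Gives continuity in the energy, and with it integrability of the integrands in the
    hypotheses. *)
Lemma opnorm_lipschitz A B : Rabs (opnorm A - opnorm B) <= entry_sum (M2diff A B).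
Proof.
  pose proof (opnorm_lipschitz_le A B); pose proof (opnorm_lipschitz_le B A) as H'.
  rewrite entry_sum_diff_sym in H'; apply Rabs_le; lra.
Qed.

Definition M2det (A : M2) : C :=
  Cminus (Cmult (fst (fst A)) (snd (snd A))) (Cmult (snd (fst A)) (fst (snd A))).

Lemma M2det_mul A B : M2det (M2mul A B) = Cmult (M2det A) (M2det B).
Proof. destruct A as [[a b] [c d]], B as [[a' b'] [c' d']]; unfold M2det; simpl; ring. Qed.

(** Each column has norm at most [opnorm A], and the determinant is at most half the sum of the
    squared entries. *)
Lemma opnorm_det A : Cmod (M2det A) <= opnorm A ^ 2.
Proof.
  destruct (opnorm_spec A) as [H _].
  pose proof (H e1 vnorm_e1) as H1; pose proof (H e2 vnorm_e2) as H2.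
  apply (fun h => pow_incr _ _ 2 (conj (vnorm_nonneg _) h)) in H1, H2.
  rewrite vnorm_sq in H1, H2.
  destruct A as [[a b] [c d]]; unfold M2det; cbn [M2app e1 e2 fst snd] in *.
  rewrite !Cmult_1_r, !Cmult_0_r in H1, H2; rewrite !Cplus_0_r in H1; rewrite !Cplus_0_l in H2.
  eapply Rle_trans; [apply Cmod_triangle |]; rewrite Cmod_opp, !Cmod_mult.
  pose proof (pow2_ge_0 (Cmod a - Cmod d)); pose proof (pow2_ge_0 (Cmod b - Cmod c)).
  set (o := opnorm _) in *; lra.
Qed.

Lemma Phi_pos_det V k z : M2det (Phi_pos V k z) = RtoC 1.
Proof.
  induction k; cbn [Phi_pos].
  - unfold M2det, M2id; simpl; ring.
  - rewrite M2det_mul, IHk; unfold M2det, Tm; simpl fst; simpl snd; ring.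
Qed.

Lemma Phi_neg_det V k z : M2det (Phi_neg V k z) = RtoC 1.
Proof.
  induction k; cbn [Phi_neg].
  - unfold M2det, M2id; simpl; ring.
  - rewrite M2det_mul, IHk; unfold M2det, Tminv; simpl fst; simpl snd; ring.
Qed.

(** Transfer matrices have determinant 1. This keeps the maxima in the hypotheses away from 0, so
    that their reciprocals are continuous. *)
Lemma Phi_opnorm_ge_1 V n z : 1 <= opnorm (Phi V n z) ^ 2.
Proof.
  eapply Rle_trans; [| apply opnorm_det]; unfold Phi.
  destruct (Z.leb 0 n); rewrite ?Phi_pos_det, ?Phi_neg_det, Cmod_1; lra.
Qed.

Lemma Phi_of_nat V k z : Phi V (Z.of_nat k) z = Phi_pos V k z.
Proof.
  unfold Phi; replace (0 <=? Z.of_nat k)%Z with true by (symmetry; apply Z.leb_le; lia).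
  now rewrite Nat2Z.id.
Qed.

Lemma Phi_opp_of_nat V k z : (0 < k)%nat -> Phi V (- Z.of_nat k) z = Phi_neg V k z.
Proof.
  intros Hk; unfold Phi; replace (0 <=? - Z.of_nat k)%Z with false by (symmetry; apply Z.leb_gt; lia).
  f_equal; lia.
Qed.

Definition lipM (F : C -> M2) (z : C) : Prop :=
  lipC (fun w => fst (fst (F w))) z /\ lipC (fun w => snd (fst (F w))) z /\
  lipC (fun w => fst (snd (F w))) z /\ lipC (fun w => snd (snd (F w))) z.

Lemma lipM_mul F G z : lipM F z -> lipM G z -> lipM (fun w => M2mul (F w) (G w)) z.
Proof.
  intros (F1 & F2 & F3 & F4) (G1 & G2 & G3 & G4).
  assert (E : forall w, M2mul (F w) (G w) =
    ((Cplus (Cmult (fst (fst (F w))) (fst (fst (G w)))) (Cmult (snd (fst (F w))) (fst (snd (G w)))),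
      Cplus (Cmult (fst (fst (F w))) (snd (fst (G w)))) (Cmult (snd (fst (F w))) (snd (snd (G w))))),
     (Cplus (Cmult (fst (snd (F w))) (fst (fst (G w)))) (Cmult (snd (snd (F w))) (fst (snd (G w)))),
      Cplus (Cmult (fst (snd (F w))) (snd (fst (G w)))) (Cmult (snd (snd (F w))) (snd (snd (G w))))))).
  { intros w; destruct (F w) as [[a b] [c d]], (G w) as [[a' b'] [c' d']]; reflexivity. }
  repeat split; (eapply lipC_ext; [intros w; rewrite E; simpl; reflexivity |]);
    apply lipC_plus; now apply lipC_mult.
Qed.

Lemma lipC_shift c z : lipC (fun w => Cminus w c) z.
Proof. apply (lipC_plus (fun w => w) (fun _ => Copp c)); [apply lipC_id | apply lipC_const]. Qed.

Lemma lipM_Phi_pos V k z : lipM (Phi_pos V k) z.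
Proof.
  induction k; cbn [Phi_pos].
  - repeat split; apply lipC_const.
  - apply lipM_mul; [| exact IHk].
    unfold lipM, Tm, Tminv; cbn [fst snd]; repeat split;
      first [apply lipC_const | apply lipC_shift].
Qed.

Lemma lipM_Phi_neg V k z : lipM (Phi_neg V k) z.
Proof.
  induction k; cbn [Phi_neg].
  - repeat split; apply lipC_const.
  - apply lipM_mul; [| exact IHk].
    unfold lipM, Tm, Tminv; cbn [fst snd]; repeat split;
      first [apply lipC_const | apply lipC_shift].
Qed.

Lemma lipM_Phi V n z : lipM (Phi V n) z.
Proof. unfold Phi; destruct (Z.leb 0 n); [apply lipM_Phi_pos | apply lipM_Phi_neg]. Qed.

Lemma Phi_opnorm_continuous V n y x : continuous (fun E => opnorm (Phi V n (E, y)) ^ 2) x.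
Proof.
  assert (H : continuous (fun E => opnorm (Phi V n (E, y))) x).
  { destruct (lipM_Phi V n (x, y)) as (H1 & H2 & H3 & H4).
    destruct (lipC_hor_ball _ _ _ H1) as (c1 & r1 & C1 & R1 & B1).
    destruct (lipC_hor_ball _ _ _ H2) as (c2 & r2 & C2 & R2 & B2).
    destruct (lipC_hor_ball _ _ _ H3) as (c3 & r3 & C3 & R3 & B3).
    destruct (lipC_hor_ball _ _ _ H4) as (c4 & r4 & C4 & R4 & B4).
    apply (continuous_of_lip _ _ (c1 + c2 + c3 + c4) (Rmin (Rmin r1 r2) (Rmin r3 r4))).
    - lra.
    - repeat apply Rmin_pos; easy.
    - intros t Ht.
      assert (Ht1 := Rlt_le_trans _ _ _ Ht (Rmin_l _ _)).
      assert (Ht2 := Rlt_le_trans _ _ _ Ht (Rmin_r _ _)).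
      specialize (B1 t (Rlt_le_trans _ _ _ Ht1 (Rmin_l _ _))).
      specialize (B2 t (Rlt_le_trans _ _ _ Ht1 (Rmin_r _ _))).
      specialize (B3 t (Rlt_le_trans _ _ _ Ht2 (Rmin_l _ _))).
      specialize (B4 t (Rlt_le_trans _ _ _ Ht2 (Rmin_r _ _))).
      eapply Rle_trans; [apply opnorm_lipschitz |].
      unfold entry_sum, M2diff; simpl fst; simpl snd; lra. }
  apply (continuous_ext (fun E => mult (opnorm (Phi V n (E, y))) (opnorm (Phi V n (E, y))))).
  - intros; unfold mult; simpl; ring.
  - now apply (continuous_mult (K := R_AbsRing)).
Qed.

Lemma continuous_Rmax (f g : R -> R) x : continuous f x -> continuous g x ->
  continuous (fun t => Rmax (f t) (g t)) x.
Proof.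
  intros Hf Hg.
  apply (continuous_ext (fun t => scal (1 / 2) (plus (plus (f t) (g t)) (Rabs (minus (f t) (g t)))))).
  - intros t; unfold scal, plus, minus, opp; simpl; unfold mult, plus, opp; simpl.
    unfold Rmax, Rabs; destruct (Rle_dec (f t) (g t)), (Rcase_abs (f t + - g t)); lra.
  - apply (continuous_scal_r (V := R_NormedModule)), (continuous_plus (V := R_NormedModule)).
    + now apply (continuous_plus (V := R_NormedModule)).
    + apply continuous_comp; [now apply (continuous_minus (V := R_NormedModule)) | apply continuous_Rabs].
Qed.

Lemma max_range_continuous (f : Z -> R -> R) y x : (forall n, continuous (f n) x) ->
  continuous (fun E => max_range (fun n => f n E) y) x.
Proof.
  intros H; unfold max_range; induction (seq 3 _) as [| k l IH]; simpl.
  - apply continuous_const.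
  - now apply continuous_Rmax.
Qed.

(** The list starts at 3 and has [Int_part y - 2] entries, so it ends at [Int_part y]; it is empty
    for [y < 3]. *)
Lemma in_range k y : In k (seq 3 (Z.to_nat (Int_part y) - 2)) <-> (3 <= k)%nat /\ INR k <= y.
Proof.
  rewrite in_seq; destruct (base_Int_part y) as [B1 B2].
  assert (forall m : Z, IZR m <= y <-> (m <= Int_part y)%Z).
  { intros m; split; intros Hm.
    - assert (IZR m < IZR (Int_part y + 1)) by (rewrite plus_IZR; lra).
      apply lt_IZR in H; lia.
    - apply IZR_le in Hm; lra. }
  rewrite INR_IZR_INZ, H; lia.
Qed.

Lemma max_range_ge f y k : (3 <= k)%nat -> INR k <= y -> f (Z.of_nat k) <= max_range f y.
Proof.
  intros H1 H2; assert (I := proj2 (in_range k y) (conj H1 H2)); unfold max_range.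
  induction (seq 3 _) as [| j l IH]; [easy |]; simpl in *.
  destruct I as [-> | I]; [apply Rmax_l | eapply Rle_trans; [now apply IH | apply Rmax_r]].
Qed.

Lemma max_range_le f y b : 0 <= b -> (forall k, (3 <= k)%nat -> INR k <= y -> f (Z.of_nat k) <= b) ->
  max_range f y <= b.
Proof.
  intros Hb H.
  assert (H' : forall k, In k (seq 3 (Z.to_nat (Int_part y) - 2)) -> f (Z.of_nat k) <= b)
    by (intros k Hk; apply in_range in Hk; now apply H).
  unfold max_range; induction (seq 3 _) as [| j l IH]; simpl; [easy |].
  apply Rmax_lub; [apply H'; now left | apply IH; intros; apply H'; now right].
Qed.

Lemma max_range_mult_le f y w b : 0 <= w -> 0 <= b ->
  (forall k, (3 <= k)%nat -> INR k <= y -> f (Z.of_nat k) * w <= b) -> max_range f y * w <= b.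
Proof.
  intros [Hw | <-] Hb H; [| now rewrite Rmult_0_r].
  apply Rmult_le_reg_r with (/ w); [now apply Rinv_0_lt_compat |].
  rewrite Rmult_assoc, Rinv_r, Rmult_1_r by lra.
  apply max_range_le; [apply Rmult_le_pos; [easy | left; now apply Rinv_0_lt_compat] |].
  intros k H1 H2; apply Rmult_le_reg_r with w; [easy |].
  rewrite (Rmult_assoc b), Rinv_l, Rmult_1_r by lra; auto.
Qed.

(** * Green function decay against transfer matrix growth *)

Section transfer.
Variables (V : Z -> R) (Bv K : R) (z : C) (u : Z -> C).
Hypothesis HV : bounded_by V Bv.
Hypothesis HK : 1 <= K.
Hypothesis Hz1 : 0 < snd z <= 1.
Hypothesis Hz2 : Rabs (fst z) <= K.
Hypothesis Lu : l2 u.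
Hypothesis Eu : forall n, Hz V z u n = dlt 1 n.

Let e := / snd z.
Let G := Bv + K + 1.
Let Cst := 100 * (50 * G ^ 2 * (G + 1) * e ^ 4) ^ 2.

Lemma pair_bound (ui uj : C) v B : 0 <= B ->
  Cmod ui * Cmod (fst v) <= B -> Cmod ui * Cmod (snd v) <= B ->
  Cmod uj * Cmod (fst v) <= B -> Cmod uj * Cmod (snd v) <= B ->
  sqrt (Cmod ui ^ 2 + Cmod uj ^ 2) * vnorm v <= 4 * B.
Proof.
  intros HB H1 H2 H3 H4.
  apply pow2_le_inv; [lra |].
  rewrite Rpow_mult_distr, vnorm_sq, pow2_sqrt by (apply Rplus_le_le_0_compat; apply pow2_ge_0).
  pose proof (Cmod_ge_0 ui); pose proof (Cmod_ge_0 uj).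
  pose proof (Cmod_ge_0 (fst v)); pose proof (Cmod_ge_0 (snd v)).
  assert (Q : forall a b, 0 <= a -> 0 <= b -> a * b <= B -> a ^ 2 * b ^ 2 <= B ^ 2).
  { intros a b Ha Hb Hab; rewrite <- Rpow_mult_distr; apply pow_incr; split; [now apply Rmult_le_pos | easy]. }
  pose proof (Q _ _ H H5 H1); pose proof (Q _ _ H H6 H2).
  pose proof (Q _ _ H0 H5 H3); pose proof (Q _ _ H0 H6 H4).
  pose proof (pow2_ge_0 B); lra.
Qed.

Lemma opnorm_product A (ui uj : C) B : 0 <= B ->
  (forall w, vnorm w = 1 -> sqrt (Cmod ui ^ 2 + Cmod uj ^ 2) * vnorm (M2app A w) <= B) ->
  opnorm A ^ 2 * (Cmod ui ^ 2 + Cmod uj ^ 2) <= B ^ 2.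
Proof.
  intros HB H; pose proof (pow2_ge_0 (Cmod ui)); pose proof (pow2_ge_0 (Cmod uj)).
  set (s := Cmod ui ^ 2 + Cmod uj ^ 2) in *.
  destruct (Req_dec s 0) as [-> | Hs]; [rewrite Rmult_0_r; apply pow2_ge_0 |].
  assert (Ps : 0 < sqrt s) by (apply sqrt_lt_R0; unfold s in *; lra).
  assert (O : opnorm A <= B / sqrt s).
  { apply opnorm_spec; intros w Hw; specialize (H w Hw).
    apply Rmult_le_reg_l with (sqrt s); [easy |].
    replace (sqrt s * (B / sqrt s)) with B by (field; lra); easy. }
  assert (O0 : 0 <= opnorm A).
  { eapply Rle_trans; [apply vnorm_nonneg | apply opnorm_spec, vnorm_e1]. }
  apply Rle_trans with ((B / sqrt s) ^ 2 * s).
  - apply Rmult_le_compat_r; [unfold s; lra | now apply pow_incr].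
  - right; rewrite <- (pow2_sqrt s) at 2 by (unfold s; lra); field; lra.
Qed.

Lemma G_pos : 2 <= G /\ Cmod z + Bv <= G.
Proof.
  destruct (G_ge V Bv K HV HK) as [HB HG].
  pose proof (Cmod_z_le K z Hz1 Hz2); unfold G; split; [easy | lra].
Qed.

Lemma e_pos : 1 <= e.
Proof. exact (e_ge_1 z Hz1). Qed.

(** A unit vector is mapped to two neighbouring values of a solution, so [solution_green_bound]
    bounds each product. The potential is a parameter in order to insert the reflected one. With
    data at sites 0 and 1, [G + 1] bounds the value at site 2. *)
Lemma transfer_bound V' u' A n : bounded_by V' Bv -> l2 u' ->
  (forall m, Hz V' z u' m = dlt 1 m) -> (1 <= n)%Z ->
  (forall w, vnorm w = 1 -> exists psi i j, (forall m, (2 <= m)%Z -> Hz V' z psi m = RtoC 0) /\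
     Cmod (psi 1%Z) <= G + 1 /\ Cmod (psi 2%Z) <= G + 1 /\
     (n <= i <= n + 1)%Z /\ (n <= j <= n + 1)%Z /\ M2app A w = (psi i, psi j)) ->
  opnorm A ^ 2 * (Cmod (u' n) ^ 2 + Cmod (u' (n + 1)%Z) ^ 2) <= Cst.
Proof.
  intros HV' Lu' Eu' Hn H; destruct G_pos as [HG _]; pose proof e_pos as He.
  set (B := 50 * G ^ 2 * (G + 1) * e ^ 4).
  assert (HB : 0 <= B).
  { unfold B; repeat apply Rmult_le_pos; try lra; apply pow_le; lra. }
  (* The 4 is that of [pair_bound]; the 100 in [Cst] leaves slack over 16. *)
  apply Rle_trans with ((4 * B) ^ 2); [| unfold Cst; fold B; pose proof (pow2_ge_0 B); nra].
  apply opnorm_product; [lra |]; intros w Hw.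
  destruct (H w Hw) as (psi & i & j & Hpsi & P1 & P2 & Hi & Hj & ->).
  assert (Bd : forall a b, (n <= a <= n + 1)%Z -> (n <= b <= n + 1)%Z -> Cmod (u' a) * Cmod (psi b) <= B).
  { intros a b Ha Hb.
    now apply (solution_green_bound V' Bv K z u' HV' HK Hz1 Hz2 Lu' Eu' psi (G + 1) n). }
  apply pair_bound; cbn [fst snd]; try easy; apply Bd; lia.
Qed.

Lemma right_bound k : (1 <= k)%nat ->
  opnorm (Phi_pos V k z) ^ 2 * (Cmod (u (Z.of_nat k)) ^ 2 + Cmod (u (Z.of_nat k + 1)%Z) ^ 2) <= Cst.
Proof.
  intros Hk; destruct G_pos as [HG HzG].
  apply (transfer_bound V); try easy; [lia |]; intros w Hw.
  (* [Phi_pos V k z] sends [(psi 1, psi 0)] to [(psi (k + 1), psi k)], so the second component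
     defines the solution. *)
  pose (psi := fun n : Z => snd (M2app (Phi_pos V (Z.to_nat n) z) w)).
  assert (St : forall j, M2app (Phi_pos V (S j) z) w =
    (Cminus (Cmult (Cminus z (RtoC (V (Z.of_nat (S j))))) (fst (M2app (Phi_pos V j z) w)))
       (snd (M2app (Phi_pos V j z) w)), fst (M2app (Phi_pos V j z) w))).
  { intros j; cbn [Phi_pos]; rewrite M2app_mul; unfold Tm; cbn [M2app].
    rewrite RtoC_m1; f_equal; ring. }
  assert (Ps : forall j, psi (Z.of_nat j) = snd (M2app (Phi_pos V j z) w))
    by (intros; unfold psi; now rewrite Nat2Z.id).
  assert (Ps1 : forall j, psi (Z.of_nat j + 1)%Z = fst (M2app (Phi_pos V j z) w)).
  { intros j; replace (Z.of_nat j + 1)%Z with (Z.of_nat (S j)) by lia; now rewrite Ps, St. }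
  assert (Hpsi : forall n, (1 <= n)%Z -> Hz V z psi n = RtoC 0).
  { intros n Hn; pose (j := Z.to_nat (n - 1)).
    replace n with (Z.of_nat j + 1)%Z by (unfold j; lia).
    unfold Hz, Hop; rewrite Ps1.
    replace (Z.of_nat j + 1 + 1)%Z with (Z.of_nat (S j) + 1)%Z by lia; rewrite Ps1, St.
    replace (Z.of_nat j + 1 - 1)%Z with (Z.of_nat j) by lia; rewrite Ps.
    replace (Z.of_nat j + 1)%Z with (Z.of_nat (S j)) by lia; cbn [fst]; ring. }
  assert (W1 := fst_le_vnorm w); assert (W2 := snd_le_vnorm w); rewrite Hw in W1, W2.
  assert (P1 : psi 1%Z = fst w).
  { replace 1%Z with (Z.of_nat 0 + 1)%Z by lia; rewrite Ps1; simpl; ring. }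
  assert (P0 : psi 0%Z = snd w).
  { replace 0%Z with (Z.of_nat 0) by lia; rewrite Ps; simpl; ring. }
  exists psi, (Z.of_nat k + 1)%Z, (Z.of_nat k); repeat split; try lia.
  - intros m Hm; apply Hpsi; lia.
  - rewrite P1; lra.
  - change 2%Z with (1 + 1)%Z; rewrite (Hz_step V z psi 1 (Hpsi 1%Z ltac:(lia))).
    simpl Z.sub; rewrite P0, P1.
    eapply Rle_trans; [apply Cmod_triangle |]; rewrite Cmod_opp, Cmod_mult.
    assert (Cmod (Cminus z (RtoC (V 1%Z))) <= G).
    { eapply Rle_trans; [apply Cmod_triangle |]; rewrite Cmod_opp, Cmod_R.
      specialize (HV 1%Z); lra. }
    pose proof (Cmod_ge_0 (Cminus z (RtoC (V 1%Z)))); pose proof (Cmod_ge_0 (fst w)); nra.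
  - rewrite Ps1, Ps; apply surjective_pairing.
Qed.

Lemma left_bound k : (1 <= k)%nat ->
  opnorm (Phi_neg V k z) ^ 2 * (Cmod (u (1 - Z.of_nat k)%Z) ^ 2 + Cmod (u (- Z.of_nat k)%Z) ^ 2) <= Cst.
Proof.
  intros Hk; destruct G_pos as [HG _].
  (* The reflection sends the sites [1 - k] and [- k] to [k + 1] and [k + 2], and turns [Phi_neg]
     into forward propagation from data at sites 1 and 2. *)
  pose (V' := fun j => V (2 - j)%Z); pose (u' := fun j => u (2 - j)%Z).
  replace (u (1 - Z.of_nat k)%Z) with (u' (Z.of_nat k + 1)%Z) by (unfold u'; f_equal; lia).
  replace (u (- Z.of_nat k)%Z) with (u' (Z.of_nat k + 1 + 1)%Z) by (unfold u'; f_equal; lia).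
  apply (transfer_bound V');
    [intros j; apply HV | now apply l2_reflect | now apply Hz_reflect_delta | lia |].
  intros w Hw.
  pose (psi := fun n : Z => fst (M2app (Phi_neg V (Z.to_nat (n - 1)) z) w)).
  assert (St : forall j, M2app (Phi_neg V (S j) z) w =
    (snd (M2app (Phi_neg V j z) w),
     Cminus (Cmult (Cminus z (RtoC (V (- Z.of_nat j)%Z))) (snd (M2app (Phi_neg V j z) w)))
       (fst (M2app (Phi_neg V j z) w)))).
  { intros j; cbn [Phi_neg]; rewrite M2app_mul; unfold Tminv; cbn [M2app].
    rewrite RtoC_m1; f_equal; ring. }
  assert (Ps : forall j, psi (1 + Z.of_nat j)%Z = fst (M2app (Phi_neg V j z) w)).
  { intros; unfold psi; repeat f_equal; lia. }
  assert (Ps1 : forall j, psi (2 + Z.of_nat j)%Z = snd (M2app (Phi_neg V j z) w)).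
  { intros j; replace (2 + Z.of_nat j)%Z with (1 + Z.of_nat (S j))%Z by lia; now rewrite Ps, St. }
  assert (W1 := fst_le_vnorm w); assert (W2 := snd_le_vnorm w); rewrite Hw in W1, W2.
  assert (P1 : psi 1%Z = fst w).
  { replace 1%Z with (1 + Z.of_nat 0)%Z by lia; rewrite Ps; simpl; ring. }
  assert (P2 : psi 2%Z = snd w).
  { replace 2%Z with (2 + Z.of_nat 0)%Z by lia; rewrite Ps1; simpl; ring. }
  exists psi, (1 + Z.of_nat k)%Z, (2 + Z.of_nat k)%Z; repeat split; try lia.
  - intros n Hn; pose (j := Z.to_nat (n - 2)).
    replace n with (2 + Z.of_nat j)%Z by (unfold j; lia).
    unfold Hz, Hop, V'; rewrite Ps1.
    replace (2 + Z.of_nat j + 1)%Z with (2 + Z.of_nat (S j))%Z by lia; rewrite Ps1, St.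
    replace (2 + Z.of_nat j - 1)%Z with (1 + Z.of_nat j)%Z by lia; rewrite Ps.
    replace (2 - (2 + Z.of_nat j))%Z with (- Z.of_nat j)%Z by lia; cbn [snd]; ring.
  - rewrite P1; lra.
  - rewrite P2; lra.
  - rewrite Ps1, Ps; apply surjective_pairing.
Qed.

Lemma Cst_nonneg : 0 <= e ^ 2 * Cst.
Proof.
  unfold Cst; apply Rmult_le_pos; [apply pow2_ge_0 |].
  apply Rmult_le_pos; [lra | apply pow2_ge_0].
Qed.

(** Every [k <= y] lies to the left of [n], so [tail_term] bounds [u n] by the values at [k] and
    [k + 1], which [right_bound] plays against [Phi] at the same [k]. The result is uniform in [k]
    and passes to the maximum. *)
Lemma max_right_bound y n : y < IZR n ->
  max_range (fun k => opnorm (Phi V k z) ^ 2) y * Cmod (u n) ^ 2 <= e ^ 2 * Cst.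
Proof.
  intros Hy; apply max_range_mult_le; [apply pow2_ge_0 | apply Cst_nonneg |].
  intros k Hk1 Hk2; rewrite Phi_of_nat.
  assert (Hkn : (Z.of_nat k < n)%Z) by (apply lt_IZR; rewrite <- INR_IZR_INZ; lra).
  assert (T := tail_term V z (e ^ 2) u (Z.of_nat k) n (good_e V z Hz1) Lu
     (u_hom V z u Eu) ltac:(lia)).
  assert (R := right_bound k ltac:(lia)).
  pose proof (pow2_ge_0 (opnorm (Phi_pos V k z))); pose proof (pow2_ge_0 e).
  eapply Rle_trans; [apply Rmult_le_compat_l; [easy | exact T] |].
  rewrite <- Rmult_assoc, (Rmult_comm _ (e ^ 2)), Rmult_assoc; now apply Rmult_le_compat_l.
Qed.

Lemma max_left_bound y n : y < IZR n ->
  max_range (fun k => opnorm (Phi V (- k) z) ^ 2) y * Cmod (u (- n)%Z) ^ 2 <= e ^ 2 * Cst.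
Proof.
  intros Hy; apply max_range_mult_le; [apply pow2_ge_0 | apply Cst_nonneg |].
  intros k Hk1 Hk2; rewrite Phi_opp_of_nat by lia.
  assert (Hkn : (Z.of_nat k < n)%Z) by (apply lt_IZR; rewrite <- INR_IZR_INZ; lra).
  assert (T := tail_term _ z (e ^ 2) _ (Z.of_nat k + 1) (n + 2) (good_e _ z Hz1)
     (l2_reflect u 2 Lu) (u_hom _ z _ (Hz_reflect_delta V z u Eu)) ltac:(lia)).
  cbn beta in T.
  replace (2 - (n + 2))%Z with (- n)%Z in T by lia.
  replace (2 - (Z.of_nat k + 1))%Z with (1 - Z.of_nat k)%Z in T by lia.
  replace (2 - (Z.of_nat k + 1 + 1))%Z with (- Z.of_nat k)%Z in T by lia.
  assert (R := left_bound k ltac:(lia)).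
  pose proof (pow2_ge_0 (opnorm (Phi_neg V k z))); pose proof (pow2_ge_0 e).
  eapply Rle_trans; [apply Rmult_le_compat_l; [easy | exact T] |].
  rewrite <- Rmult_assoc, (Rmult_comm _ (e ^ 2)), Rmult_assoc; now apply Rmult_le_compat_l.
Qed.

End transfer.

(** * Decay of the time-averaged probabilities *)

(** Openness of the resolvent set in quantitative form; it carries the bounds at the real points [K]
    and [- K] to nearby heights. *)
Lemma good_near V z0 D z : good V z0 D -> 4 * D * Cmod (Cminus z z0) ^ 2 <= 1 -> good V z (4 * D).
Proof.
  intros [HD H0] Hsm; split; [lra |]; intros f B Lf HB.
  set (h := Cminus z z0) in *.
  pose proof (bdd_nonneg _ _ HB) as PB.
  replace (4 * D * B) with (2 * (2 * D * B)) by ring.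
  apply bdd_contract; [easy | nra |]; intros b Hb.
  pose proof (bdd_nonneg _ _ Hb) as Pb.
  apply (bdd_le _ (D * (2 * B + 2 * (Cmod h ^ 2 * b)))).
  - apply H0; [easy |].
    apply (bdd_ext (fun n => Cplus (Hz V z f n) (Cmult h (f n)))).
    + intros n; unfold Hz, h; ring.
    + apply bdd_plus; [easy | now apply bdd_scal].
  - assert (4 * D * Cmod h ^ 2 * b <= 1 * b) by (now apply Rmult_le_compat_r). lra.
Qed.

(** [decay] with exponent [2 * r], after a square root; for negative [n] the reflected site [2 - n]
    is even farther out. *)
Lemma decay_abs V z D u r : good V z D -> l2 u -> (forall n, Hz V z u n = dlt 1 n) ->
  forall n, (6 <= Z.abs n)%Z ->
  Cmod (u n) * IZR (Z.abs n) ^ r <= sqrt D * (4 * INR (2 * r) * (1 + D)) ^ r.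
Proof.
  intros G Lu E n Hn.
  assert (HD := proj1 G).
  assert (P0 : 0 <= IZR (Z.abs n)) by (apply (IZR_le 0); lia).
  assert (P1 : 0 <= 4 * INR (2 * r) * (1 + D)).
  { pose proof (pos_INR (2 * r)); apply Rmult_le_pos; lra. }
  apply pow2_le_inv; [apply Rmult_le_pos; [apply sqrt_pos | now apply pow_le] |].
  set (W := 4 * INR (2 * r) * (1 + D)) in *.
  rewrite !Rpow_mult_distr, pow2_sqrt, <- !pow_mult, (Nat.mul_comm r 2) by easy; unfold W.
  destruct (Z_le_dec 0 n) as [H | H].
  - rewrite Z.abs_eq in * by easy; now apply (decay V z).
  - assert (E' := Hz_reflect_delta V z u E).
    assert (Q := decay _ z D _ (2 * r) (good_reflect V 2 z D G) (l2_reflect u 2 Lu) E' (2 - n)%Z ltac:(lia)).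
    cbn beta in Q; replace (2 - (2 - n))%Z with n in Q by lia.
    eapply Rle_trans; [| exact Q]; apply Rmult_le_compat_l; [apply pow2_ge_0 |].
    apply pow_incr; split; [easy | apply IZR_le; lia].
Qed.

(** The potential is real, so conjugating a solution at [z] gives the solution at the conjugate
    point. Hence the lower side of the contour has the mass of the upper one, where the hypotheses
    apply. *)
Lemma green_conj V E s n : s <> 0 -> solvable V (E, s) -> solvable V (E, - s) ->
  Cmod (green V (E, - s) n) = Cmod (green V (E, s) n).
Proof.
  intros Hs S1 S2.
  destruct (green_spec V _ S1) as [L1 E1]; destruct (green_spec V _ S2) as [L2 E2].
  set (f := green V (E, s)) in *; set (g := green V (E, - s)) in *.
  pose (f' := fun n => Cconj (f n)).
  assert (L1' : l2 f').
  { apply l2_bdd in L1; destruct L1 as [B HB]; apply l2_bdd; exists B; intros a m.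
    rewrite (zsum_ext _ (fun n => Cmod (f n) ^ 2)); [apply HB |].
    intros; unfold f'; now rewrite Cmod_conj. }
  assert (E1' : forall n, Hz V (E, - s) f' n = dlt 1 n).
  { intros k; transitivity (Cconj (Hz V (E, s) f k)).
    - unfold Hz, Hop, f'; rewrite Cminus_conj, !Cplus_conj, !Cmult_conj.
      f_equal; f_equal; f_equal; apply injective_projections; simpl; ring.
    - rewrite E1; unfold dlt; apply injective_projections; simpl; ring. }
  assert (Z0 := good_unique V (E, - s) _ (fun k => Cminus (g k) (f' k))
    (good_nonreal V (E, - s) ltac:(simpl; lra)) (l2_minus _ _ L2 L1')
    ltac:(intros k; transitivity (Cminus (Hz V (E, - s) g k) (Hz V (E, - s) f' k));
          [unfold Hz, Hop; ring | rewrite E1', E2; ring]) n).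
  replace (g n) with (f' n); [apply Cmod_conj |].
  replace (g n) with (Cplus (Cminus (g n) (f' n)) (f' n)) by ring.
  cbn beta in Z0; rewrite Z0; ring.
Qed.

Lemma RInt_le_const (f : R -> R) a b M : a <= b -> (forall x, a <= x <= b -> continuous f x) ->
  (forall x, a <= x <= b -> f x <= M) -> RInt f a b <= (b - a) * M.
Proof.
  intros Hab Hc HM.
  assert (E := RInt_const (V := R_CompleteNormedModule) a b M); unfold scal in E; simpl in E; unfold mult in E; simpl in E.
  rewrite <- E; apply RInt_le; [easy | now apply ex_RInt_cont | apply ex_RInt_const |].
  intros; apply HM; lra.
Qed.

Lemma Rpower_unbounded b B : 0 < b -> exists T0, 1 <= T0 /\ forall T, T0 <= T -> B <= Rpower T b.
Proof.
  intros Hb; pose (M := Rabs B + 1); pose proof (Rabs_pos B).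
  exists (Rpower M (/ b)).
  assert (P : 0 < / b) by now apply Rinv_0_lt_compat.
  split.
  - rewrite <- (Rpower_O M) by (unfold M; lra); apply Rle_Rpower; unfold M; lra.
  - intros T HT; apply Rle_trans with M; [unfold M; pose proof (Rle_abs B); lra |].
    replace M with (Rpower (Rpower M (/ b)) b).
    + apply Rle_Rpower_l; [lra | split; [apply exp_pos | easy]].
    + rewrite Rpower_mult, Rinv_l, Rpower_1 by (unfold M; lra); easy.
Qed.

Lemma Rpower_dominates a b A B : 0 <= a < b -> exists T0, 1 <= T0 /\
  forall T, T0 <= T -> A * Rpower T a + B <= Rpower T b.
Proof.
  intros Hab; destruct (Rpower_unbounded (b - a) (Rabs A + Rabs B)) as (T0 & H1 & H2); [lra |].
  exists T0; split; [easy |]; intros T HT; specialize (H2 T HT).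
  replace b with (a + (b - a)) by ring; rewrite Rpower_plus.
  assert (P : 1 <= Rpower T a) by (rewrite <- (Rpower_O T) by lra; apply Rle_Rpower; lra).
  pose proof (Rle_abs A); pose proof (Rle_abs B); pose proof (Rabs_pos B).
  apply Rle_trans with (Rpower T a * (Rabs A + Rabs B)); [nra |].
  apply Rmult_le_compat_l; lra.
Qed.

Lemma Rpower_opp_nat T m : 0 < T -> Rpower T (- INR m) = / T ^ m.
Proof. intros HT; rewrite Rpower_Ropp, Rpower_pow; easy. Qed.

Section decay.
Variables (V : Z -> R) (Bv K c0 alpha : R).
Hypothesis HV : bounded_by V Bv.
Hypothesis HK : 4 <= K.
Hypothesis Hreg : forall z, snd z <> 0 \/ K - 1 < Rabs (fst z) -> regular V z.
Hypothesis Hc0 : 0 < c0.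
Hypothesis Hal : 0 < alpha < 1.
Hypothesis Hpos : forall m, 1 <= m -> bigO_neg_pow (Ipos V K c0 alpha) m.
Hypothesis Hneg : forall m, 1 <= m -> bigO_neg_pow (Ineg V K c0 alpha) m.

Definition hmass (y : R) (n : Z) : R := RInt (fun x => Cmod (green V (x, y) n)) (- K) K.
Definition vmass (x s : R) (n : Z) : R := RInt (fun y => Cmod (green V (x, y) n)) (- s) s.

Lemma regular_nonreal x y : y <> 0 -> regular V (x, y).
Proof. intros; apply Hreg; now left. Qed.

Lemma regular_side x y : Rabs x = K -> regular V (x, y).
Proof. intros E; apply Hreg; right; simpl; lra. Qed.

Lemma green_cont_hor y n x : y <> 0 -> continuous (fun x => Cmod (green V (x, y) n)) x.
Proof.
  intros Hy; apply (cont_Cmod_hor (fun z => green V z n)), (green_lipC V K Hreg); now left.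
Qed.

Lemma green_cont_ver x n y : Rabs x = K -> continuous (fun y => Cmod (green V (x, y) n)) y.
Proof.
  intros E; apply (cont_Cmod_ver (fun z => green V z n)), (green_lipC V K Hreg); right; simpl; lra.
Qed.

Lemma contour_mass_split s n : 0 < s ->
  contour_mass V K s n = 2 * hmass s n + vmass K s n + vmass (- K) s n.
Proof.
  intros Hs; unfold contour_mass, rect_abs, hmass, vmass.
  rewrite (RInt_ext (fun x => Cmod (green V (x, - s) n)) (fun x => Cmod (green V (x, s) n))); [ring |].
  intros x _; apply green_conj; [lra | |]; apply regular_nonreal; lra.
Qed.

(** [K] and [- K] are regular points, and their bounds spread to a neighbourhood independent of [T],
    whereas [good_nonreal] degenerates at the real axis. *)
Lemma good_sides : exists D y0, 1 <= D /\ 0 < y0 /\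
  forall x y, Rabs x = K -> Rabs y <= y0 -> good V (x, y) D.
Proof.
  assert (H : forall x, Rabs x = K -> exists D y0, 1 <= D /\ 0 < y0 /\ forall y, Rabs y <= y0 -> good V (x, y) D).
  { intros x Hx; destruct (proj1 (regular_side x 0 Hx)) as [D HD].
    pose proof (proj1 HD) as PD.
    exists (4 * D + 1), (/ (4 * D + 1)).
    assert (Pi : 0 < / (4 * D + 1)) by (apply Rinv_0_lt_compat; lra).
    split; [lra | split; [easy |]]; intros y Hy.
    assert (N : good V (x, y) (4 * D)).
    { apply (good_near V (x, 0)); [easy |].
      replace (x, y) with (x, 0 + y) by (f_equal; ring); rewrite Cmod_ver.
      pose proof (Rabs_pos y).
      assert (B : (4 * D + 1) * Rabs y <= 1).
      { apply Rle_trans with ((4 * D + 1) * / (4 * D + 1)); [apply Rmult_le_compat_l; lra |].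
        right; field; lra. }
      assert (Rabs y <= 1) by nra.
      simpl; nra. }
    apply (good_mono _ _ _ _ N); lra. }
  destruct (H K) as (D1 & y1 & A1 & B1 & C1); [rewrite Rabs_pos_eq; lra |].
  destruct (H (- K)) as (D2 & y2 & A2 & B2 & C2); [rewrite Rabs_left; lra |].
  exists (D1 + D2), (Rmin y1 y2); split; [lra | split; [now apply Rmin_pos |]].
  intros x y Hx Hy.
  assert (Hy1 := Rle_trans _ _ _ Hy (Rmin_l _ _)); assert (Hy2 := Rle_trans _ _ _ Hy (Rmin_r _ _)).
  destruct (Rle_dec 0 x).
  - rewrite Rabs_pos_eq in Hx by easy; subst x.
    apply (good_mono _ _ D1); [now apply C1 | lra].
  - rewrite Rabs_left in Hx by lra; replace x with (- K) by lra.
    apply (good_mono _ _ D2); [now apply C2 | lra].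
Qed.

(** The resolvent bound on these sides does not depend on the height, so the constant is uniform as
    [s] tends to 0. *)
Lemma vmass_decay r : exists A s0, 0 <= A /\ 0 < s0 <= 1 /\
  forall x s n, Rabs x = K -> 0 < s <= s0 -> (6 <= Z.abs n)%Z ->
  vmass x s n * IZR (Z.abs n) ^ r <= A.
Proof.
  destruct good_sides as (D & y0 & HD & Hy0 & HG).
  set (A := sqrt D * (4 * INR (2 * r) * (1 + D)) ^ r).
  assert (PA : 0 <= A).
  { apply Rmult_le_pos; [apply sqrt_pos | apply pow_le; pose proof (pos_INR (2 * r)); apply Rmult_le_pos; lra]. }
  exists (2 * A), (Rmin 1 y0); split; [lra | split; [split; [apply Rmin_pos; lra | apply Rmin_l] |]].
  intros x s n Hx Hs Hn.
  assert (Hs1 := Rle_trans _ _ _ (proj2 Hs) (Rmin_l _ _)).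
  assert (Hs2 := Rle_trans _ _ _ (proj2 Hs) (Rmin_r _ _)).
  assert (Pn : 0 < IZR (Z.abs n) ^ r) by (apply pow_lt, (IZR_lt 0); lia).
  apply Rle_trans with ((s - - s) * (A / IZR (Z.abs n) ^ r) * IZR (Z.abs n) ^ r).
  - apply Rmult_le_compat_r; [lra |].
    apply RInt_le_const; [lra | intros; now apply green_cont_ver |].
    intros y Hy; apply Rmult_le_reg_r with (IZR (Z.abs n) ^ r); [easy |].
    unfold Rdiv; rewrite Rmult_assoc, Rinv_l, Rmult_1_r by lra.
    destruct (green_spec V (x, y) (proj2 (regular_side x y Hx))) as [L E].
    apply (decay_abs V (x, y)); try easy.
    apply HG; [easy |]; pose proof (Rabs_le y s Hy); lra.
  - replace ((s - - s) * (A / IZR (Z.abs n) ^ r) * IZR (Z.abs n) ^ r) with (2 * s * A) by (field; lra).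
    nra.
Qed.

(** With [D = / s ^ 2] from [good_nonreal], each power of [|n|] costs two powers of [/ s], and
    [sqrt D] costs one more. *)
Lemma hmass_decay r s n : 0 < s <= 1 -> (6 <= Z.abs n)%Z ->
  hmass s n * IZR (Z.abs n) ^ r <= 2 * K * (8 * INR (2 * r)) ^ r * (/ s) ^ (2 * r + 1).
Proof.
  intros Hs Hn.
  assert (Pe : 1 <= / s) by (rewrite <- Rinv_1; apply Rinv_le_contravar; lra).
  assert (Pn : 0 < IZR (Z.abs n) ^ r) by (apply pow_lt, (IZR_lt 0); lia).
  set (A := (8 * INR (2 * r)) ^ r * (/ s) ^ (2 * r + 1)).
  apply Rle_trans with ((K - - K) * (A / IZR (Z.abs n) ^ r) * IZR (Z.abs n) ^ r);
    [| right; unfold A; field; lra].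
  apply Rmult_le_compat_r; [lra |].
  apply RInt_le_const; [lra | intros; apply green_cont_hor; lra |].
  intros x Hx; apply Rmult_le_reg_r with (IZR (Z.abs n) ^ r); [easy |].
  unfold Rdiv; rewrite Rmult_assoc, Rinv_l, Rmult_1_r by lra.
  destruct (green_spec V (x, s) (proj2 (regular_nonreal x s ltac:(lra)))) as [L E].
  eapply Rle_trans; [apply (decay_abs V (x, s) _ _ r (good_nonreal V (x, s) ltac:(simpl; lra)) L E n Hn) |].
  simpl snd; unfold A.
  replace (/ s ^ 2) with ((/ s) ^ 2) by (rewrite pow_inv; easy).
  rewrite sqrt_pow2 by lra.
  replace ((/ s) ^ (2 * r + 1)) with ((/ s) * ((/ s) ^ 2) ^ r)
    by (rewrite <- pow_mult, Nat.add_1_r; easy).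
  replace ((8 * INR (2 * r)) ^ r * (/ s * ((/ s) ^ 2) ^ r))
    with (/ s * ((8 * INR (2 * r)) * (/ s) ^ 2) ^ r) by (rewrite Rpow_mult_distr; ring).
  apply Rmult_le_compat_l; [lra |]; apply pow_incr.
  pose proof (pos_INR (2 * r)) as Pr; pose proof (pow2_ge_0 (/ s)) as P2.
  assert (1 <= (/ s) ^ 2) by (simpl; nra).
  split; [apply Rmult_le_pos; lra |].
  replace (8 * INR (2 * r) * (/ s) ^ 2) with (4 * INR (2 * r) * (2 * (/ s) ^ 2)) by ring.
  apply Rmult_le_compat_l; lra.
Qed.

(* AM-GM, [|g| <= lam + |g|^2 / lam], trades Cauchy-Schwarz for powers of [T]. *)
Lemma RInt_amgm (f mx : R -> R) A lam : 0 < lam ->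
  (forall x, continuous f x) -> (forall x, continuous mx x) -> (forall x, 1 <= mx x) ->
  (forall x, - K <= x <= K -> mx x * f x ^ 2 <= A) ->
  RInt f (- K) K <= 2 * K * lam + A / lam * RInt (fun x => / mx x) (- K) K.
Proof.
  intros Hl Hf Hm Hm1 HA.
  assert (Xi : ex_RInt (fun x => / mx x) (- K) K).
  { apply ex_RInt_cont; [lra |]; intros x _.
    apply continuous_comp; [apply Hm |].
    apply (ex_derive_continuous (V := R_NormedModule)); auto_derive; specialize (Hm1 x); lra. }
  assert (Xc : ex_RInt (fun _ => lam) (- K) K) by apply ex_RInt_const.
  replace (2 * K * lam) with (RInt (fun _ => lam) (- K) K)
    by (rewrite RInt_const; unfold scal; simpl; unfold mult; simpl; ring).
  rewrite <- RInt_scal_R by easy.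
  assert (P := RInt_plus (V := R_CompleteNormedModule) (fun _ => lam) (fun x => A / lam * / mx x) (- K) K
    Xc (ex_RInt_scal_R _ _ _ _ Xi)); unfold plus in P; simpl in P; rewrite <- P.
  apply RInt_le; [lra | apply ex_RInt_cont; [lra | auto] | |].
  - apply (ex_RInt_plus (V := R_NormedModule)); [easy | now apply ex_RInt_scal_R].
  - intros x Hx; specialize (HA x ltac:(lra)); specialize (Hm1 x).
    (* Where [f] exceeds [lam], [lam * f] is at most [f ^ 2], which [HA] bounds by [A / mx]. *)
    destruct (Rle_dec (f x) lam) as [L | L].
    + assert (0 <= A) by (eapply Rle_trans; [| exact HA]; pose proof (pow2_ge_0 (f x)); nra).
      assert (0 <= A / lam * / mx x).
      { apply Rmult_le_pos; [apply Rmult_le_pos; [easy |] |]; left; apply Rinv_0_lt_compat; lra. }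
      lra.
    + apply Rle_trans with (A / lam * / mx x); [| lra].
      apply Rmult_le_reg_r with (lam * mx x); [nra |].
      replace (A / lam * / mx x * (lam * mx x)) with A by (field; lra).
      apply Rle_trans with (2 := HA).
      replace (f x * (lam * mx x)) with (mx x * (f x * lam)) by ring.
      apply Rmult_le_compat_l; [lra |]; simpl; nra.
Qed.

Lemma Phi_max_ge_1 y z sg : 3 <= y ->
  1 <= max_range (fun k => opnorm (Phi V (sg k) z) ^ 2) y.
Proof.
  intros Hy; eapply Rle_trans; [apply (Phi_opnorm_ge_1 V (sg 3%Z) z) |].
  apply (max_range_ge (fun k => opnorm (Phi V (sg k) z) ^ 2) y 3); [lia | simpl; lra].
Qed.

(** The power [T ^ 10] collects [e ^ 2] from the tail bound and [e ^ 8] from the square in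
    [right_bound] and [left_bound], at [e = T]. *)
Lemma hmass_transfer : exists A, 0 <= A /\ forall T n lam, 1 <= T -> 0 < lam ->
  3 <= c0 * Rpower T alpha -> c0 * Rpower T alpha < IZR (Z.abs n) ->
  hmass (/ T) n <= 2 * K * lam + A * T ^ 10 / lam *
    (Rabs (Ipos V K c0 alpha T) + Rabs (Ineg V K c0 alpha T)).
Proof.
  set (G := Bv + K + 1); set (A := 100 * (50 * G ^ 2 * (G + 1)) ^ 2).
  assert (PA : 0 <= A) by (unfold A; apply Rmult_le_pos; [lra | apply pow2_ge_0]).
  exists A; split; [easy |]; intros T n lam HT Hl Hy Hn.
  assert (Hs := inv_unit T HT).
  set (y := c0 * Rpower T alpha) in *.
  (* [sg] selects the half-line that contains [n], so that both signs share one argument. *)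
  assert (Q : forall sg : Z -> Z, (sg = (fun k => k) /\ (0 <= n)%Z \/ sg = Z.opp /\ (n < 0)%Z) ->
    hmass (/ T) n <= 2 * K * lam + A * T ^ 10 / lam *
      RInt (fun E => / max_range (fun k => opnorm (Phi V (sg k) (E, / T)) ^ 2) y) (- K) K).
  { intros sg Hsg; unfold hmass.
    apply (RInt_amgm (fun x => Cmod (green V (x, / T) n))
      (fun E => max_range (fun k => opnorm (Phi V (sg k) (E, / T)) ^ 2) y)); try easy.
    - intros x; apply green_cont_hor; lra.
    - intros x; apply (max_range_continuous (fun k E => opnorm (Phi V (sg k) (E, / T)) ^ 2)).
      intros k; apply Phi_opnorm_continuous.
    - intros x; now apply Phi_max_ge_1.
    - intros x Hx.
      destruct (green_spec V (x, / T) (proj2 (regular_nonreal x (/ T) ltac:(lra)))) as [L E].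
      assert (Hx' : Rabs x <= K) by now apply Rabs_le.
      replace (A * T ^ 10) with ((/ / T) ^ 2 * (100 * (50 * G ^ 2 * (G + 1) * (/ / T) ^ 4) ^ 2))
        by (rewrite Rinv_inv; unfold A; ring).
      destruct Hsg as [[-> H0] | [-> H0]].
      + apply (max_right_bound V Bv K (x, / T) _ HV ltac:(lra) Hs Hx' L E).
        now rewrite Z.abs_eq in Hn.
      + rewrite Z.abs_neq in Hn by lia.
        assert (B := max_left_bound V Bv K (x, / T) _ HV ltac:(lra) Hs Hx' L E y (- n) Hn).
        now rewrite Z.opp_involutive in B. }
  assert (C : 0 <= A * T ^ 10 / lam).
  { apply Rmult_le_pos; [apply Rmult_le_pos; [easy | apply pow_le; lra] | left; now apply Rinv_0_lt_compat]. }
  pose proof (Rabs_pos (Ipos V K c0 alpha T)); pose proof (Rabs_pos (Ineg V K c0 alpha T)).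
  pose proof (Rle_abs (Ipos V K c0 alpha T)); pose proof (Rle_abs (Ineg V K c0 alpha T)).
  destruct (Z_lt_le_dec n 0) as [Hn0 | Hn0].
  - eapply Rle_trans; [apply (Q Z.opp); now right |]; apply Rplus_le_compat_l, Rmult_le_compat_l; [easy |].
    fold (Ineg V K c0 alpha T); change (Ineg V K c0 alpha T <= Rabs (Ipos V K c0 alpha T) + Rabs (Ineg V K c0 alpha T)); lra.
  - eapply Rle_trans; [apply (Q (fun k => k)); now left |]; apply Rplus_le_compat_l, Rmult_le_compat_l; [easy |].
    change (Ipos V K c0 alpha T <= Rabs (Ipos V K c0 alpha T) + Rabs (Ineg V K c0 alpha T)); lra.
Qed.

(** With [lam = / T ^ m], the hypothesis of order [2 * m + 10] beats both [T ^ 10] and [/ lam]. On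
    the vertical sides [r > m / alpha] turns [|n| >= T ^ alpha] into [|n| ^ r >= T ^ m]. *)
Lemma contour_mass_small m : exists A T0, 1 <= T0 /\ forall T n, T0 <= T ->
  (6 <= Z.abs n)%Z -> c0 * Rpower T alpha < IZR (Z.abs n) -> Rpower T alpha <= IZR (Z.abs n) ->
  contour_mass V K (/ T) n <= A / T ^ m.
Proof.
  destruct hmass_transfer as (A1 & PA1 & H1).
  assert (M1 : 1 <= INR (2 * m + 10)) by (apply (le_INR 1); lia).
  destruct (Hpos _ M1) as (cp & Tp & HP), (Hneg _ M1) as (cn & Tn & HN).
  destruct (INR_unbounded (INR m / alpha)) as [r Hr].
  destruct (vmass_decay r) as (A2 & s0 & PA2 & Hs0 & H2).
  destruct (Rpower_unbounded alpha (3 / c0) ltac:(lra)) as (Tc & HTc1 & HTc2).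
  exists (2 * (2 * K + A1 * (cp + cn)) + 2 * A2), (Rmax (Rmax Tp Tn) (Rmax Tc (/ s0))).
  pose proof (Rmax_l (Rmax Tp Tn) (Rmax Tc (/ s0))); pose proof (Rmax_r (Rmax Tp Tn) (Rmax Tc (/ s0))).
  pose proof (Rmax_l Tp Tn); pose proof (Rmax_r Tp Tn).
  pose proof (Rmax_l Tc (/ s0)); pose proof (Rmax_r Tc (/ s0)).
  split; [lra |]; intros T n HT Hn6 Hn1 Hn2.
  assert (T1 : 1 <= T) by lra.
  assert (Ps : 0 < / T) by (apply Rinv_0_lt_compat; lra).
  assert (Hs : / T <= s0).
  { rewrite <- (Rinv_inv s0); apply Rinv_le_contravar; [apply Rinv_0_lt_compat |]; lra. }
  assert (PTm : 0 < T ^ m) by (apply pow_lt; lra).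
  rewrite contour_mass_split by easy.
  assert (Hh : hmass (/ T) n <= (2 * K + A1 * (cp + cn)) / T ^ m).
  { assert (L3 : 3 <= c0 * Rpower T alpha).
    { specialize (HTc2 T ltac:(lra)).
      apply (Rmult_le_compat_l c0) in HTc2; [| lra].
      replace (c0 * (3 / c0)) with 3 in HTc2 by (field; lra); easy. }
    eapply Rle_trans; [apply (H1 T n (/ T ^ m) T1 ltac:(now apply Rinv_0_lt_compat) L3 Hn1) |].
    specialize (HP T ltac:(lra)); specialize (HN T ltac:(lra)).
    rewrite Rpower_opp_nat in HP, HN by lra.
    assert (C : 0 <= A1 * T ^ 10 / / T ^ m).
    { unfold Rdiv; rewrite Rinv_inv; apply Rmult_le_pos; [apply Rmult_le_pos; [easy |] |]; apply pow_le; lra. }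
    apply Rle_trans with (2 * K * / T ^ m + A1 * T ^ 10 / / T ^ m * ((cp + cn) * / T ^ (2 * m + 10))).
    - apply Rplus_le_compat_l, Rmult_le_compat_l; [easy | lra].
    - right; replace (2 * m + 10)%nat with (m + m + 10)%nat by lia; rewrite !(pow_add T); field.
      repeat split; (apply pow_nonzero; lra) || lra. }
  assert (Hv : forall x, Rabs x = K -> vmass x (/ T) n <= A2 / T ^ m).
  { intros x Hx; specialize (H2 x (/ T) n Hx ltac:(lra) Hn6).
    assert (Pn : 0 < IZR (Z.abs n) ^ r) by (apply pow_lt, (IZR_lt 0); lia).
    assert (Pw : T ^ m <= IZR (Z.abs n) ^ r).
    { apply Rle_trans with (Rpower T alpha ^ r); [| apply pow_incr; split; [left; apply exp_pos | easy]].
      rewrite <- (Rpower_pow r), Rpower_mult, <- (Rpower_pow m) by (apply exp_pos || lra).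
      apply Rle_Rpower; [easy |].
      apply (Rmult_lt_compat_l alpha) in Hr; [| lra].
      replace (alpha * (INR m / alpha)) with (INR m) in Hr by (field; lra); lra. }
    apply Rle_trans with (A2 / IZR (Z.abs n) ^ r).
    - apply Rmult_le_reg_r with (IZR (Z.abs n) ^ r); [easy |].
      unfold Rdiv; rewrite (Rmult_assoc A2), Rinv_l, Rmult_1_r by lra; easy.
    - apply Rmult_le_compat_l; [easy | now apply Rinv_le_contravar]. }
  pose proof (Hv K ltac:(rewrite Rabs_pos_eq; lra)).
  pose proof (Hv (- K) ltac:(rewrite Rabs_left; lra)).
  unfold Rdiv in *; lra.
Qed.

Lemma contour_mass_far r : exists A T0, 1 <= T0 /\ 0 <= A /\ forall T n, T0 <= T -> (6 <= Z.abs n)%Z ->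
  contour_mass V K (/ T) n * IZR (Z.abs n) ^ r <= A * T ^ (2 * r + 1).
Proof.
  destruct (vmass_decay r) as (A2 & s0 & PA2 & Hs0 & H2).
  set (A1 := 2 * K * (8 * INR (2 * r)) ^ r).
  assert (PA1 : 0 <= A1).
  { unfold A1; apply Rmult_le_pos; [lra | apply pow_le; pose proof (pos_INR (2 * r)); lra]. }
  exists (2 * A1 + 2 * A2), (Rmax 1 (/ s0)).
  pose proof (Rmax_l 1 (/ s0)); pose proof (Rmax_r 1 (/ s0)).
  split; [easy | split; [lra |]]; intros T n HT Hn6.
  assert (T1 : 1 <= T) by lra.
  assert (Ps : 0 < / T) by (apply Rinv_0_lt_compat; lra).
  assert (Hs : / T <= s0).
  { rewrite <- (Rinv_inv s0); apply Rinv_le_contravar; [apply Rinv_0_lt_compat |]; lra. }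
  rewrite contour_mass_split by easy.
  assert (B1 := hmass_decay r (/ T) n ltac:(lra) Hn6); rewrite Rinv_inv in B1; fold A1 in B1.
  assert (B2 := H2 K (/ T) n ltac:(rewrite Rabs_pos_eq; lra) ltac:(lra) Hn6).
  assert (B3 := H2 (- K) (/ T) n ltac:(rewrite Rabs_left; lra) ltac:(lra) Hn6).
  assert (1 <= T ^ (2 * r + 1)) by (apply pow_R1_Rle; lra).
  nra.
Qed.

(** Of the two factors in the squared contour mass one is estimated by [contour_mass_small], the
    other by [contour_mass_far]; the order [m + (2 * r + 1)] of the former compensates the loss in
    the latter. *)
Lemma a_nT_decay alpha' m r : alpha < alpha' -> exists A T0, 1 <= T0 /\ 0 <= A /\
  forall T n, T0 <= T -> Rpower T alpha' - 2 <= IZR (Z.abs n) ->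
  a_nT V n T * IZR (Z.abs n) ^ r <= A / T ^ m.
Proof.
  intros Ha.
  destruct (contour_mass_small (m + (2 * r + 1))) as (A1 & T1 & HT1 & H1).
  destruct (contour_mass_far r) as (A2 & T2 & HT2 & PA2 & H2).
  (* The contour has height [/ (2 * T)], hence thresholds at [2 * T]. The 8 is the 6 of the decay
     bounds plus the 2 subtracted in [S_plus]. *)
  destruct (Rpower_dominates alpha alpha' ((c0 + 1) * Rpower 2 alpha) 8) as (T3 & HT3 & H3); [lra |].
  exists (2 * Rabs A1 * A2), (Rmax T1 (Rmax T2 T3)).
  pose proof (Rmax_l T1 (Rmax T2 T3)); pose proof (Rmax_r T1 (Rmax T2 T3)).
  pose proof (Rmax_l T2 T3); pose proof (Rmax_r T2 T3).
  pose proof (Rabs_pos A1).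
  split; [lra | split; [apply Rmult_le_pos; lra |]]; intros T n HT Hn.
  specialize (H3 T ltac:(lra)).
  assert (E : Rpower (2 * T) alpha = Rpower 2 alpha * Rpower T alpha)
    by (apply eq_sym, Rpower_mult_distr; lra).
  assert (P2T : 0 < Rpower (2 * T) alpha) by apply exp_pos.
  assert (N : (c0 + 1) * Rpower (2 * T) alpha + 6 <= IZR (Z.abs n)) by (rewrite E; lra).
  assert (N6 : (6 <= Z.abs n)%Z).
  { apply le_IZR; assert (0 <= (c0 + 1) * Rpower (2 * T) alpha) by (apply Rmult_le_pos; lra); lra. }
  assert (C1 := H1 (2 * T) n ltac:(lra) N6 ltac:(nra) ltac:(nra)).
  assert (C2 := H2 (2 * T) n ltac:(lra) N6).
  destruct (a_nT_contour V Bv K n T HV ltac:(lra) Hreg ltac:(lra)) as [_ B].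
  assert (Q0 := contour_mass_nonneg V K ltac:(lra) Hreg (/ (2 * T)) n ltac:(apply Rinv_0_lt_compat; lra)).
  set (q := contour_mass V K (/ (2 * T)) n) in *.
  assert (Pn : 0 <= IZR (Z.abs n) ^ r) by (apply pow_le, (IZR_le 0); lia).
  apply Rle_trans with (2 * (q * (q * IZR (Z.abs n) ^ r))).
  { apply Rle_trans with (2 * q ^ 2 * IZR (Z.abs n) ^ r); [now apply Rmult_le_compat_r | right; ring]. }
  assert (P1 : 0 < (2 * T) ^ (2 * r + 1)) by (apply pow_lt; lra).
  assert (P2 : 0 < (2 * T) ^ m) by (apply pow_lt; lra).
  assert (C3 : q * (q * IZR (Z.abs n) ^ r) <=
    Rabs A1 / (2 * T) ^ (m + (2 * r + 1)) * (A2 * (2 * T) ^ (2 * r + 1))).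
  { apply Rmult_le_compat; [easy | now apply Rmult_le_pos | | easy].
    eapply Rle_trans; [exact C1 |]; apply Rmult_le_compat_r; [| apply Rle_abs].
    left; apply Rinv_0_lt_compat, pow_lt; lra. }
  replace (Rabs A1 / (2 * T) ^ (m + (2 * r + 1)) * (A2 * (2 * T) ^ (2 * r + 1)))
    with (Rabs A1 * A2 / (2 * T) ^ m) in C3 by (rewrite (pow_add (2 * T)); field; lra).
  assert (C4 : Rabs A1 * A2 / (2 * T) ^ m <= Rabs A1 * A2 / T ^ m).
  { apply Rmult_le_compat_l; [apply Rmult_le_pos; lra |].
    apply Rinv_le_contravar; [apply pow_lt; lra | apply pow_incr; lra]. }
  unfold Rdiv in *; lra.
Qed.

End decay.

(** * Tails, moments and transport exponents *)

Lemma sumZ_le f b : (forall N, zsum f (- Z.of_nat N) (2 * N + 1) <= b) -> Rbar_le (sumZ f) b.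
Proof.
  intros H; unfold sumZ.
  match goal with |- Rbar_le (Rbar_lub ?E) _ => destruct (proj2_sig (Rbar_ex_lub E)) as [_ L] end.
  apply L; intros x [N ->]; rewrite sym_sum_zsum; apply H.
Qed.

Definition inv_sq (n : Z) : R := if Z.eq_dec n 0 then 0 else / IZR (Z.abs n) ^ 2.

Lemma inv_sq_sum N : zsum inv_sq (- Z.of_nat N) (2 * N + 1) <= 4.
Proof.
  rewrite <- sym_sum_zsum; change (inv_sq 0) with 0.
  assert (H : forall k, sum_f_R0 (fun k => inv_sq (Z.of_nat k) + inv_sq (- Z.of_nat k)%Z) (S k)
     <= 4 - 2 * / INR (S k)).
  { assert (E : forall k, inv_sq (Z.of_nat (S k)) + inv_sq (- Z.of_nat (S k))%Z = 2 * / INR (S k) ^ 2).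
    { intros k; unfold inv_sq; destruct (Z.eq_dec (Z.of_nat (S k)) 0), (Z.eq_dec (- Z.of_nat (S k)) 0); try lia.
      rewrite Z.abs_opp, Z.abs_eq, <- INR_IZR_INZ by lia; ring. }
    induction k.
    - rewrite tech5, E; unfold inv_sq; simpl; lra.
    - rewrite tech5, E.
      assert (P : 0 < INR (S k)) by (apply lt_0_INR; lia).
      assert (Q : / INR (S (S k)) ^ 2 <= / INR (S k) - / INR (S (S k))).
      { rewrite (S_INR (S k)); set (a := INR (S k)) in *.
        replace (/ a - / (a + 1)) with (/ (a * (a + 1))) by (field; lra).
        apply Rinv_le_contravar; [nra | simpl; nra]. }
      lra. }
  destruct N.
  - unfold inv_sq; simpl; lra.
  - specialize (H N).
    assert (0 < / INR (S N)) by (apply Rinv_0_lt_compat, lt_0_INR; lia); lra.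
Qed.

Lemma limsup_infty_le g y : (exists M, forall T, M < T -> Rbar_le (g T) y) ->
  Rbar_le (limsup_infty g) y.
Proof.
  intros [M H]; unfold limsup_infty.
  match goal with |- Rbar_le (Rbar_glb ?E) _ => destruct (proj2_sig (Rbar_ex_glb E)) as [L _] end.
  eapply Rbar_le_trans; [apply L; now exists M |].
  match goal with |- Rbar_le (Rbar_lub ?E) _ => destruct (proj2_sig (Rbar_ex_lub E)) as [_ U] end.
  apply U; intros x (T & HT & ->); now apply H.
Qed.

(** A nonpositive [P] has logarithm [m_infty], which multiplication by the positive [/ d] preserves,
    so the degenerate case is harmless. *)
Lemma ln_ratio_le P b d y : Rbar_le P (Finite b) -> 0 < b -> 0 < d -> ln b <= y * d ->
  Rbar_le (Rbar_mult (ln_Rbar P) (Finite (/ d))) (Finite y).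
Proof.
  intros HP Hb Hd Hy.
  assert (Pd : 0 < / d) by now apply Rinv_0_lt_compat.
  assert (Hm : Rbar_le (Rbar_mult m_infty (Finite (/ d))) (Finite y)).
  { rewrite Rbar_mult_comm; unfold Rbar_mult, Rbar_mult'.
    destruct (Rle_dec 0 (/ d)) as [H | H]; [| lra].
    destruct (Rle_lt_or_eq_dec 0 (/ d) H) as [H' | H']; [exact I | lra]. }
  destruct P as [p | |]; simpl in HP; try easy.
  simpl ln_Rbar; destruct (Rlt_dec 0 p) as [Hp | Hp]; [| easy].
  simpl; apply Rmult_le_reg_r with d; [easy |].
  rewrite Rmult_assoc, Rinv_l, Rmult_1_r by lra.
  apply Rle_trans with (2 := Hy); now apply ln_le.
Qed.

(** Lying off the spectrum is a double negation of [resolvent], removed classically. *)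
Lemma regular_off_spectrum V Bv K : bounded_by V Bv -> 4 <= K ->
  (forall z : C, spectrum V z -> snd z = 0 /\ - K + 1 <= fst z <= K - 1) ->
  forall z, snd z <> 0 \/ K - 1 < Rabs (fst z) -> regular V z.
Proof.
  intros HV HK Hsp z Hz; apply (resolvent_good V Bv z HV).
  apply NNPP; intros N; destruct (Hsp z N) as [H1 H2].
  destruct Hz as [Hz | Hz]; [easy |].
  assert (Rabs (fst z) <= K - 1) by (apply Rabs_le; lra); lra.
Qed.

Section conclusion.
Variables (V : Z -> R) (Bv K c0 alpha : R).
Hypothesis HV : bounded_by V Bv.
Hypothesis HK : 4 <= K.
Hypothesis Hreg : forall z, snd z <> 0 \/ K - 1 < Rabs (fst z) -> regular V z.
Hypothesis Hc0 : 0 < c0.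
Hypothesis Hal : 0 < alpha < 1.
Hypothesis Hpos : forall m, 1 <= m -> bigO_neg_pow (Ipos V K c0 alpha) m.
Hypothesis Hneg : forall m, 1 <= m -> bigO_neg_pow (Ineg V K c0 alpha) m.

Lemma P_NT_small alpha' m : alpha < alpha' -> exists T0, forall T, T0 <= T ->
  Rbar_le (P_NT V (Rpower T alpha' - 2) T) (Finite (/ T ^ m)).
Proof.
  intros Ha.
  (* The power 2 of [|n|] makes the tail summable; the surplus power of [T] absorbs the constant
     once [T >= 4 * A]. *)
  destruct (a_nT_decay V Bv K c0 alpha HV HK Hreg Hc0 Hal Hpos Hneg alpha' (S m) 2 Ha)
    as (A & T1 & HT1 & PA & H1).
  (* From [T2] on the cutoff is nonnegative, which keeps site 0 out of the tail. *)
  destruct (Rpower_unbounded alpha' 2 ltac:(lra)) as (T2 & HT2 & H2).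
  exists (Rmax (4 * A) (Rmax T1 T2)); intros T HT.
  pose proof (Rmax_l (4 * A) (Rmax T1 T2)); pose proof (Rmax_r (4 * A) (Rmax T1 T2)).
  pose proof (Rmax_l T1 T2); pose proof (Rmax_r T1 T2).
  specialize (H2 T ltac:(lra)).
  assert (PT : 0 < T) by lra.
  assert (PTm : 0 < T ^ m) by now apply pow_lt.
  assert (PC : 0 <= A / T ^ S m) by (apply Rmult_le_pos; [easy | left; apply Rinv_0_lt_compat, pow_lt; lra]).
  apply sumZ_le; intros N.
  apply Rle_trans with (zsum (fun n => A / T ^ S m * inv_sq n) (- Z.of_nat N) (2 * N + 1)).
  - apply zsum_le; intros n; unfold inv_sq.
    destruct (Rlt_dec (Rpower T alpha' - 2) (IZR (Z.abs n))) as [L | L], (Z.eq_dec n 0) as [-> | Hn].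
    + simpl in L; lra.
    + assert (Pn : 0 < IZR (Z.abs n) ^ 2) by (apply pow_lt, (IZR_lt 0); lia).
      specialize (H1 T n ltac:(lra) ltac:(lra)).
      apply Rmult_le_reg_r with (IZR (Z.abs n) ^ 2); [easy |].
      rewrite (Rmult_assoc (A / _)), Rinv_l, Rmult_1_r by lra; easy.
    + lra.
    + apply Rmult_le_pos; [easy | left; apply Rinv_0_lt_compat, pow_lt, (IZR_lt 0); lia].
  - rewrite zsum_scal.
    apply Rle_trans with (A / T ^ S m * 4); [apply Rmult_le_compat_l; [easy | apply inv_sq_sum] |].
    apply Rmult_le_reg_r with (T ^ S m); [apply pow_lt; lra |].
    simpl pow; replace (A / (T * T ^ m) * 4 * (T * T ^ m)) with (4 * A) by (field; lra).
    replace (/ T ^ m * (T * T ^ m)) with T by (field; lra); lra.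
Qed.

(** Superpolynomial smallness of the tail puts the limsup below [- m] for every [m]. *)
Lemma S_plus_infinite alpha' : alpha < alpha' -> S_plus V alpha' = p_infty.
Proof.
  intros Ha; unfold S_plus.
  set (g := fun T => Rbar_mult (ln_Rbar (P_NT V (Rpower T alpha' - 2) T)) (Finite (/ ln T))).
  assert (H : forall m : nat, Rbar_le (limsup_infty g) (Finite (- INR m))).
  { intros m; apply limsup_infty_le.
    destruct (P_NT_small alpha' m Ha) as [T0 HT0].
    exists (Rmax 1 T0); intros T HT.
    pose proof (Rmax_l 1 T0); pose proof (Rmax_r 1 T0).
    apply (ln_ratio_le _ (/ T ^ m)).
    - apply HT0; lra.
    - apply Rinv_0_lt_compat, pow_lt; lra.
    - rewrite <- ln_1; apply ln_increasing; lra.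
    - rewrite ln_Rinv by (apply pow_lt; lra); rewrite ln_pow by lra; lra. }
  destruct (limsup_infty g) as [l | |]; [| exfalso; exact (H 0%nat) | reflexivity].
  exfalso; destruct (INR_unbounded (- l)) as [m Hm]; specialize (H m); simpl in H; lra.
Qed.

(** Sites within [T ^ alpha'] contribute at most [T ^ (p * alpha')], as the total probability is at
    most 1. Beyond them [q > p] and two further powers of [|n|] leave a summable bound independent
    of [T]. *)
Lemma moment_bound p alpha' : 0 < p -> alpha < alpha' -> exists A T0, 0 <= A /\ 1 <= T0 /\
  forall T, T0 <= T -> Rbar_le (moment' V p T) (Finite (Rpower T (p * alpha') + A)).
Proof.
  intros Hp Ha.
  destruct (INR_unbounded p) as [q Hq].
  destruct (a_nT_decay V Bv K c0 alpha HV HK Hreg Hc0 Hal Hpos Hneg alpha' 0 (q + 2) Ha)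
    as (A & T1 & HT1 & PA & H1).
  exists (4 * A), T1; split; [lra | split; [easy |]]; intros T HT.
  assert (PT : 0 < T) by lra.
  set (X := Rpower T (p * alpha')).
  assert (PX : 0 < X) by apply exp_pos.
  apply sumZ_le; intros N.
  apply Rle_trans with (zsum (fun n => X * a_nT V n T + A * inv_sq n) (- Z.of_nat N) (2 * N + 1)).
  - apply zsum_le; intros n.
    destruct (a_nT_contour V Bv K n T HV ltac:(lra) Hreg ltac:(lra)) as [Pa _].
    assert (PXa : 0 <= X * a_nT V n T) by (apply Rmult_le_pos; lra).
    unfold inv_sq, abspow; destruct (Z.eq_dec n 0) as [-> | Hn]; [lra |].
    assert (N1 : 1 <= IZR (Z.abs n)) by (apply (IZR_le 1); lia).
    assert (Pi : 0 < / IZR (Z.abs n) ^ 2) by (apply Rinv_0_lt_compat, pow_lt; lra).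
    assert (PAi : 0 <= A * / IZR (Z.abs n) ^ 2) by (apply Rmult_le_pos; lra).
    destruct (Rle_dec (IZR (Z.abs n)) (Rpower T alpha')) as [L | L].
    + assert (Rpower (IZR (Z.abs n)) p <= X).
      { unfold X; rewrite Rmult_comm, <- Rpower_mult; apply Rle_Rpower_l; lra. }
      assert (Rpower (IZR (Z.abs n)) p * a_nT V n T <= X * a_nT V n T) by now apply Rmult_le_compat_r.
      lra.
    + specialize (H1 T n HT ltac:(lra)); rewrite pow_O in H1; unfold Rdiv in H1.
      rewrite Rinv_1, Rmult_1_r, pow_add in H1.
      assert (Rpower (IZR (Z.abs n)) p <= IZR (Z.abs n) ^ q).
      { rewrite <- Rpower_pow by lra; apply Rle_Rpower; lra. }
      assert (Rpower (IZR (Z.abs n)) p * a_nT V n T <= IZR (Z.abs n) ^ q * a_nT V n T)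
        by now apply Rmult_le_compat_r.
      assert (IZR (Z.abs n) ^ q * a_nT V n T <= A * / IZR (Z.abs n) ^ 2).
      { apply Rmult_le_reg_r with (IZR (Z.abs n) ^ 2); [apply pow_lt; lra |].
        rewrite (Rmult_assoc A), Rinv_l, Rmult_1_r by (apply pow_nonzero; lra); lra. }
      lra.
  - rewrite zsum_plus, !zsum_scal.
    assert (S1 := a_nT_sum_le_1 V Bv HV T PT N); assert (S2 := inv_sq_sum N).
    assert (X * zsum (fun n => a_nT V n T) (- Z.of_nat N) (2 * N + 1) <= X * 1)
      by (apply Rmult_le_compat_l; lra).
    assert (A * zsum inv_sq (- Z.of_nat N) (2 * N + 1) <= A * 4) by (apply Rmult_le_compat_l; lra).
    lra.
Qed.

(** Choosing [alpha' = alpha + eta / 2] leaves the other half of [eta] to absorb the additive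
    constant of [moment_bound]. *)
Lemma beta_plus_le p : 0 < p -> Rbar_le (beta_plus V p) (Finite alpha).
Proof.
  intros Hp.
  assert (H : forall eta, 0 < eta -> Rbar_le (beta_plus V p) (Finite (alpha + eta))).
  { intros eta Heta; apply limsup_infty_le.
    destruct (moment_bound p (alpha + eta / 2) Hp ltac:(lra)) as (A & T1 & PA & HT1 & H1).
    destruct (Rpower_dominates (p * (alpha + eta / 2)) (p * (alpha + eta)) 1 A) as (T2 & HT2 & H2).
    { split; [apply Rmult_le_pos; lra | apply Rmult_lt_compat_l; lra]. }
    exists (Rmax T1 T2); intros T HT.
    pose proof (Rmax_l T1 T2); pose proof (Rmax_r T1 T2).
    assert (L : 0 < ln T) by (rewrite <- ln_1; apply ln_increasing; lra).
    apply (ln_ratio_le _ (Rpower T (p * (alpha + eta)))).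
    - eapply Rbar_le_trans; [apply H1; lra |]; specialize (H2 T ltac:(lra)); simpl; lra.
    - apply exp_pos.
    - now apply Rmult_lt_0_compat.
    - unfold Rpower; rewrite ln_exp; right; ring. }
  destruct (beta_plus V p) as [b | |]; [| exact (H 1 Rlt_0_1) | exact I].
  simpl; apply le_epsilon; intros eta Heta; exact (H eta Heta).
Qed.

Lemma alpha_u_plus_le : Rbar_le (alpha_u_plus V) (Finite alpha).
Proof.
  unfold alpha_u_plus.
  match goal with |- Rbar_le (Rbar_lub ?E) _ => destruct (proj2_sig (Rbar_ex_lub E)) as [_ L] end.
  apply L; intros x (a & Ha & -> & HS); simpl.
  destruct (Rle_dec a alpha) as [H | H]; [easy | exfalso].
  rewrite S_plus_infinite in HS by lra; exact HS.
Qed.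

End conclusion.

Theorem theorem1 (V : Z -> R) (K c0 alpha : R) :
  (exists B, forall n, Rabs (V n) <= B) ->
  4 <= K ->
  (forall z : C, spectrum V z -> snd z = 0 /\ - K + 1 <= fst z <= K - 1) ->
  0 < c0 -> 0 < alpha < 1 ->
  (forall m, 1 <= m -> bigO_neg_pow (Ipos V K c0 alpha) m) ->
  (forall m, 1 <= m -> bigO_neg_pow (Ineg V K c0 alpha) m) ->
  Rbar_le (alpha_u_plus V) (Finite alpha) /\
  (forall p, 0 < p -> Rbar_le (beta_plus V p) (Finite alpha)).
Proof.
  intros [Bv HV] HK Hsp Hc0 Hal Hpos Hneg.
  assert (Hreg := regular_off_spectrum V Bv K HV HK Hsp).
  split.
  - now apply (alpha_u_plus_le V Bv K c0).
  - intros p Hp; now apply (beta_plus_le V Bv K c0).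
Qed.
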